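(* Let $N\ge 3$ and let $\mathcal{L}$ be a singular Born--Infeld type Lagrangian with truncation threshold $s\le \frac12$, $b=\mathcal{L}'$. Let $\rho\in\mathcal{A}^*$ be radially distributed with $\rho\in L^d(\mathbb{R}^N)\cap L^e(B_\xi(0))$ for some $d\ge1$, $e\ge N$, $\xi>0$, and assume additionally that $\rho\in C^0(0,\infty)$ (as a function of $r=|x|$). Then the weak solution $\phi_0=\phi_0(r)$ of $$-\operatorname{div}\left(b\left(\tfrac12|\nabla\phi|^2\right)\nabla\phi\right)=\rho\ \text{ in }\mathbb{R}^N,\qquad \lim_{|x|\to\infty}\phi(x)=0,$$ satisfies $\phi_0\in C^2(0,\infty)$ and $$-\frac{1}{r^{N-1}}\frac{d}{dr}\left(b\left(\tfrac12\phi_0'(r)^2\right)\phi_0'(r)\,r^{N-1}\right)=\rho(r),\qquad \forall\, r>0.$$ If moreover $\rho$ is continuous at the origin, then $\phi_0\in C^2(\mathbb{R}^N)$ and the displayed equation holds for all $r\ge0$.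
   Context: Function space: $\mathcal{A}=D^{1,2}(\mathbb{R}^N)\cap\{\phi\in C^{0,1}(\mathbb{R}^N): |\nabla\phi|^2\le 1 \text{ a.e.}\}$, with $\|\phi\|_{D^{1,2}}=\left(\int_{\mathbb{R}^N}|\nabla\phi|^2dx\right)^{1/2}$. $\mathcal{A}^*$ denotes its dual, i.e. the linear functionals $\rho$ satisfying $|\langle\rho,\phi\rangle|\le \|\rho\|_{\mathcal{A}^*}\|\nabla\phi\|_{L^2}$. When $\rho$ is given by a locally integrable function, $\langle\rho,\psi\rangle=\int_{\mathbb{R}^N}\rho\,\psi\,dx$ (e.g. for compactly supported $\psi\in\mathcal{A}$). Singular Born--Infeld type Lagrangian with truncation threshold $s\le\frac12$: a $C^2$ function $\mathcal{L}:[0,\frac12)\to\mathbb{R}$ with $\mathcal{L}(0)=0$, $\mathcal{L}'(0)=1$, $b(s):=\mathcal{L}'(s)>0$ and $\mathcal{L}''(s)>0$ for all $s$, $\lim_{s\to(1/2)^-}\mathcal{L}(s)=+\infty$ and $\lim_{s\to(1/2)^-}b(s)=+\infty$. One sets $\mathcal{L}(\frac12)=+\infty$. Radially distributed: for $\tau\in O(N)$ put $\phi^\tau(x)=\phi(\tau x)$ and $\langle\rho^\tau,\phi\rangle=\langle\rho,\phi^{\tau^{-1}}\rangle$ for $\phi\in\mathcal{A}$; $\rho$ is radially distributed if $\rho^\tau=\rho$ for every $\tau\in O(N)$. Weak solution: $\phi\in\mathcal{A}$ such that $\int_{\mathbb{R}^N}b\left(\frac12|\nabla\phi|^2\right)\nabla\phi\cdot\nabla\psi\,dx=\langle\rho,\psi\rangle$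 for all $\psi\in\mathcal{A}$. For radially distributed $\rho$ the weak solution is unique and radial. At $r=0$ the left-hand side of the radial equation is understood as its continuous extension (limit $r\to0^+$). *)

(* Defs.v *)
From HB Require Import structures.
From mathcomp Require Import all_boot all_order all_algebra.
From mathcomp Require Import all_classical all_reals all_analysis.

Set Implicit Arguments.
Unset Strict Implicit.
Unset Printing Implicit Defensive.

Import Order.TTheory GRing.Theory Num.Theory.
Import numFieldTopology.Exports numFieldNormedType.Exports.

Local Open Scope classical_set_scope.
Local Open Scope ring_scope.

Definition rV_display : measure_display.
Proof. exact: default_measure_display. Qed.

(* Points of R^n are row vectors; the sigma-algebra generated by the coordinates
   is the Borel sigma-algebra. *)
Section measurable_rV.
Context (R : realType) (n : nat).

Let coord : 'I_n -> 'rV[R]_n -> measurableTypeR R := fun i x => x ord0 i.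

Let rV_set0 : g_sigma_preimage coord set0.
Proof. exact: sigma_algebra0. Qed.

Let rV_setC A : g_sigma_preimage coord A -> g_sigma_preimage coord (~` A).
Proof. exact: sigma_algebraC. Qed.

Let rV_bigcup (F : (set 'rV[R]_n)^nat) :
  (forall i, g_sigma_preimage coord (F i)) ->
  g_sigma_preimage coord (\bigcup_i (F i)).
Proof. exact: sigma_algebra_bigcup. Qed.

HB.instance Definition _ := @isMeasurable.Build rV_display 'rV[R]_n
  (g_sigma_preimage coord) rV_set0 rV_setC rV_bigcup.

Lemma measurable_coord (i : 'I_n) :
  measurable_fun [set: 'rV[R]_n] (fun x => x ord0 i : measurableTypeR R).
Proof.
move=> _ Y mY; rewrite setTI; apply: sub_sigma_algebra => /=.
rewrite -bigcup_seq/=; exists i => /=; first by rewrite mem_index_enum.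
by exists Y => //; rewrite setTI.
Qed.

Lemma measurable_fun_rV d (T : measurableType d) (f : T -> 'rV[R]_n) :
  (forall i, measurable_fun [set: T] (fun t => f t ord0 i : measurableTypeR R)) ->
  measurable_fun [set: T] f.
Proof.
move=> mf; have sub : g_sigma_preimage coord `<=`
    [set A | measurable (f @^-1` A)].
  apply: smallest_sub.
    split=> [|A mA|F mF]; rewrite /=.
    - by rewrite preimage_set0.
    - by rewrite setTD preimage_setC; exact: measurableC.
    - by rewrite preimage_bigcup; apply: bigcupT_measurable => k; exact: mF.
  rewrite -bigcup_seq/=; apply: bigcup_sub => i _ A [B mB <-] /=.
  by rewrite setTI; have := mf i measurableT B mB; rewrite setTI.
by move=> _ A mA; rewrite setTI; exact: sub.
Qed.

End measurable_rV.

Definition cons_rV (R : realType) (n : nat)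
    (p : measurableTypeR R * 'rV[R]_n) : 'rV[R]_n.+1 :=
  row_mx (\row_(_ < 1) (p.1 : R)) p.2.

Lemma sigma_finite_prod d1 d2 (T1 : measurableType d1) (T2 : measurableType d2)
    (R : realType) (m1 : {sigma_finite_measure set T1 -> \bar R})
    (m2 : {sigma_finite_measure set T2 -> \bar R}) :
  sigma_finite setT (m1 \x m2)%E.
Proof.
have /sigma_finiteP[F [TF ndF Foo]] := sigma_finiteT m1.
have /sigma_finiteP[G [TG ndG Goo]] := sigma_finiteT m2.
exists (fun k => F k `*` G k).
  rewrite -setXTT TF TG predeqE => -[x y]; split.
    move=> [/= [k _ Fkx] [l _ Gly]]; exists (maxn k l) => //; split.
    - by move: x Fkx; exact/subsetPset/ndF/leq_maxl.
    - by move: y Gly; exact/subsetPset/ndG/leq_maxr.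
  by move=> [k _ []/= ? ?]; split; exists k.
move=> k; have [? ?] := Foo k; have [? ?] := Goo k.
split; first exact: measurableX.
by rewrite product_measure1E// lte_mul_pinfty// ge0_fin_numE.
Qed.

Section cons_measure.
Context (R : realType) (n : nat).

Lemma measurable_cons_rV : measurable_fun setT (@cons_rV R n).
Proof.
apply: measurable_fun_rV => i; rewrite /cons_rV.
case: (@split_ordP 1 n i) => j ->.
  under eq_fun do rewrite (@row_mxEl _ 1 1 n) mxE.
  exact: measurable_fst.
under eq_fun do rewrite (@row_mxEr _ 1 1 n).
exact: measurableT_comp (measurable_coord j) measurable_snd.
Qed.

Variable m : {sigma_finite_measure set 'rV[R]_n -> \bar R}.

Definition cons_measure : set 'rV[R]_n.+1 -> \bar R :=
  pushforward (@lebesgue_measure R \x m)%E (@cons_rV R n).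

Let cons_measure0 : cons_measure set0 = 0%E.
Proof. by rewrite /cons_measure /pushforward preimage_set0 measure0. Qed.

Let cons_measure_ge0 A : (0 <= cons_measure A)%E.
Proof. exact: (measure_ge0 (@lebesgue_measure R \x m)%E). Qed.

Let cons_measure_sigma_additive : semi_sigma_additive cons_measure.
Proof.
move=> F mF tF mUF; rewrite /cons_measure /pushforward preimage_bigcup.
apply: measure_semi_sigma_additive.
- by move=> k; rewrite -[X in measurable X]setTI; exact: measurable_cons_rV.
- apply/trivIsetP => /= i j _ _ ij; rewrite -preimage_setI.
  by move/trivIsetP : tF => /(_ _ _ _ _ ij) ->//; rewrite preimage_set0.
- rewrite -preimage_bigcup -[X in measurable X]setTI.
  exact: measurable_cons_rV.
Qed.

HB.instance Definition _ := isMeasure.Build _ _ _ cons_measure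
  cons_measure0 cons_measure_ge0 cons_measure_sigma_additive.

Let cons_measure_sigma_finite : sigma_finite setT cons_measure.
Proof.
have [F TF Foo] := sigma_finite_prod (@lebesgue_measure R) m.
pose h (x : 'rV[R]_n.+1) : measurableTypeR R * 'rV[R]_n :=
  (x ord0 ord0, \row_j x ord0 (lift ord0 j)).
have hK : cancel (@cons_rV R n) h.
  move=> [a y]; rewrite /h /cons_rV; congr pair.
    have -> : ord0 = lshift n (ord0 : 'I_1) by exact: ord_inj.
    by rewrite (@row_mxEl _ 1 1 n) mxE.
  apply/rowP => j; rewrite mxE.
  have -> : lift ord0 j = rshift 1 j by exact: ord_inj.
  by rewrite (@row_mxEr _ 1 1 n).
have mh : measurable_fun setT h.
  apply: measurable_fun_pair => /=; first exact: measurable_coord.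
  apply: measurable_fun_rV => j.
  under eq_fun do rewrite mxE.
  exact: measurable_coord.
exists (fun k => h @^-1` F k).
  by rewrite -preimage_bigcup -TF preimage_setT.
move=> k; have [mFk Fkoo] := Foo k; split.
  by rewrite -[X in measurable X]setTI; exact: mh.
by rewrite /cons_measure /pushforward -comp_preimage (_ : h \o _ = id)//;
  apply/funext => x; exact: hK.
Qed.

HB.instance Definition _ :=
  Measure_isSigmaFinite.Build _ _ _ cons_measure cons_measure_sigma_finite.

End cons_measure.

Fixpoint lebesgue_rV (R : realType) (n : nat) :
    {sigma_finite_measure set 'rV[R]_n -> \bar R} :=
  match n with
  | 0 => \d_(0 : 'rV[R]_0)
  | k.+1 => cons_measure (lebesgue_rV R k)
  end.

(* The norm `|x| of the library on 'rV[R]_n is the sup norm. *)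
Section calculus.
Context (R : realType) (n : nat).
Implicit Types (x y : 'rV[R]_n) (f : 'rV[R]_n -> R).

Definition dot x y : R := \sum_i x ord0 i * y ord0 i.

Definition enorm x : R := Num.sqrt (dot x x).

Definition eball (r : R) : set 'rV[R]_n := [set x | enorm x < r].

Definition partial (i : 'I_n) f : 'rV[R]_n -> R := 'D_(delta_mx ord0 i) f.

Definition grad f x : 'rV[R]_n := \row_i partial i f x.

Definition iter_partial (s : seq 'I_n) f : 'rV[R]_n -> R := foldr partial f s.

Definition classC (k : nat) f : Prop := forall s : seq 'I_n,
  ((size s <= k)%N -> continuous (iter_partial s f)) /\
  ((size s < k)%N ->
    forall x i, derivable (iter_partial s f) x (delta_mx ord0 i)).

Definition compactly_supported f : Prop :=
  compact (closure [set x | f x != 0]).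

Definition test_function f : Prop :=
  (forall k, classC k f) /\ compactly_supported f.

Definition weak_gradient f (g : 'I_n -> 'rV[R]_n -> R) : Prop :=
  forall eta, test_function eta -> forall i,
    \int[lebesgue_rV R n]_x (f x * partial i eta x) =
    - \int[lebesgue_rV R n]_x (g i x * eta x).

(* For n >= 3 the completion of the test functions for the L^2 norm of the
   gradient is, by the Sobolev inequality, the space of functions in L^{2n/(n-2)}
   whose weak gradient is in L^2. *)
Definition D12 : set ('rV[R]_n -> R) := [set f |
  f \in Lfun (lebesgue_rV R n) (2 * n%:R / (n%:R - 2))%:E /\
  exists g, weak_gradient f g /\
    forall i, g i \in Lfun (lebesgue_rV R n) 2%:E].

(* By Rademacher's theorem the classical gradient of a Lipschitz function exists
   almost everywhere and is its weak gradient. *)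
Definition admissible : set ('rV[R]_n -> R) := [set f |
  [/\ D12 f, lipschitz f &
      {ae lebesgue_rV R n, forall x, enorm (grad f x) ^+ 2 <= 1}]].

Definition D12_norm f : \bar R :=
  'N[lebesgue_rV R n]_2%:E[EFin \o (enorm \o grad f)].

(* [admissible] is convex but not a vector space: linearity is required for the
   linear combinations that remain admissible.  This amounts to linearity on
   the span of [admissible]. *)
Definition dual_admissible : set (('rV[R]_n -> R) -> R) := [set T |
  (forall (a b : R) f g, admissible f -> admissible g ->
     admissible (fun x => a * f x + b * g x) ->
     T (fun x => a * f x + b * g x) = a * T f + b * T g) /\
  exists C : R, forall f, admissible f -> (`|T f|%:E <= C%:E * D12_norm f)%E].

Definition represented_by (T : ('rV[R]_n -> R) -> R) (rho : 'rV[R]_n -> R) :=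
  forall psi, admissible psi -> compactly_supported psi ->
    T psi = \int[lebesgue_rV R n]_x (rho x * psi x).

Definition orthogonal_mx (Q : 'M[R]_n) : Prop := Q *m Q^T = 1%:M.

(* x |-> f (Q x); points are row vectors, so Q x is written x *m Q^T. *)
Definition rotate_fun (Q : 'M[R]_n) f : 'rV[R]_n -> R := fun x => f (x *m Q^T).

Definition rotate_dist (Q : 'M[R]_n) (T : ('rV[R]_n -> R) -> R) :=
  fun f => T (rotate_fun (invmx Q) f).

Definition radially_distributed (T : ('rV[R]_n -> R) -> R) : Prop :=
  forall Q, orthogonal_mx Q ->
    forall f, admissible f -> rotate_dist Q T f = T f.

Definition vanishes_at_infinity f : Prop :=
  forall eps : R, 0 < eps -> exists M : R, forall x, M < enorm x -> `|f x| < eps.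

End calculus.

(* Derivatives relative to A are one-sided at an endpoint of A. *)
Section derive_in.
Context (R : realType) (A : set R).

Definition derivable_in (f : R -> R) (x : R) : Prop :=
  cvg ((f y - f x) / (y - x) @[y --> within (A `\ x) (nbhs x)]).

Definition derive_in (f : R -> R) (x : R) : R :=
  lim ((f y - f x) / (y - x) @[y --> within (A `\ x) (nbhs x)]).

End derive_in.

Section lagrangian.
Context (R : realType).
Implicit Types L : R -> R.

Definition lag_dom : set R := `[0, 2^-1[.

Definition lag_b L : R -> R := derive_in lag_dom L.

(* Only the values of L on [0, 1/2) are relevant. *)
Record singular_lagrangian L : Prop := SingularLagrangian {
  lag_derivable : forall s, lag_dom s -> derivable_in lag_dom L s ;
  lag_b_derivable : forall s, lag_dom s -> derivable_in lag_dom (lag_b L) s ;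
  lag_db_continuous : {within lag_dom, continuous (derive_in lag_dom (lag_b L))} ;
  lag_0 : L 0 = 0 ;
  lag_b_0 : lag_b L 0 = 1 ;
  lag_b_gt0 : forall s, lag_dom s -> 0 < lag_b L s ;
  lag_db_gt0 : forall s, lag_dom s -> 0 < derive_in lag_dom (lag_b L) s ;
  lag_singular : L s @[s --> (2^-1)^'-] --> +oo ;
  lag_b_singular : lag_b L s @[s --> (2^-1)^'-] --> +oo }.

(* b extended by +oo beyond the singularity, so that the integrals in the weak
   formulation see the set where |grad phi| = 1. *)
Definition lag_bE L (s : R) : \bar R :=
  if s < 2^-1 then (lag_b L s)%:E else +oo%E.

Definition weak_solution n L (T : ('rV[R]_n -> R) -> R)
    (phi : 'rV[R]_n -> R) : Prop :=
  admissible phi /\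
  forall psi, admissible psi ->
    let F x := (lag_bE L (enorm (grad phi x) ^+ 2 / 2) *
                (dot (grad phi x) (grad psi x))%:E)%E in
    (lebesgue_rV R n).-integrable setT F /\
    (\int[lebesgue_rV R n]_x F x = (T psi)%:E)%E.

Definition flux n L (f : R -> R) : R -> R :=
  fun r => lag_b L (derive1 f r ^+ 2 / 2) * derive1 f r * r ^+ n.-1.

End lagrangian.

Definition C2_on (R : realType) (U : set R) (f : R -> R) : Prop :=
  forall r, U r ->
    [/\ derivable f r 1, derivable (derive1 f) r 1 &
        {for r, continuous (derive1n 2 f)}].

(* Main.v *)
(* Write N for the dimension, K(r) for the integral of rho(s) s^(N-1) over [0, r],
   G(r) = K(r) / r^(N-1), and g for the solution of b(g^2/2) g = G; it is unique,
   |g| < 1, because t |-> b(t^2/2) t is an increasing bijection from (-1, 1) to R.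
   The field V(x) = -G(|x|) x/|x| satisfies -div V = rho, and V = b(|q|^2/2) q for
   q(x) = -g(|x|) x/|x|, the gradient of Phi(x) = int_|x|^oo g.  Testing with
   truncations of Phi bounds int g G r^(N-1), hence int_1^oo |g| < oo: Phi exists and
   tends to 0 at infinity.  The function w = phi0 - Phi is Lipschitz and tends to 0, so
   that S(w) is, up to a factor, an admissible test function with compact support for
   every S vanishing near 0; strict monotonicity of p |-> b(|p|^2/2) p then shows that
   the gradient of S(w) is 0 almost everywhere, hence w = 0.  The regularity of phi0 is
   that of Phi, and the equation is K' = rho r^(N-1). *)

From HB Require Import structures.
Require Import Defs.
From mathcomp Require Import all_boot all_order all_algebra.
From mathcomp Require Import all_classical all_reals all_analysis.
From mathcomp Require Import measurable_realfun ess_sup_inf ring lra.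

Set Implicit Arguments.
Unset Strict Implicit.
Unset Printing Implicit Defensive.

Import Order.TTheory GRing.Theory Num.Theory.
Import numFieldTopology.Exports numFieldNormedType.Exports.

Local Open Scope classical_set_scope.
Local Open Scope ring_scope.

(** Reduction to one variable shapes the analysis. The measure on R^n is built one coordinate at a
    time, and by translation invariance an integral over R^n is an average of integrals over unit
    segments parallel to an axis. Almost everywhere derivability and integration by parts for
    Lipschitz functions then follow from their one-variable versions; since only almost every
    segment matters, the field may be singular at the origin. The exponent N is what controls that
    singularity: integrability of |rho|^N near 0 makes K of order r^(N-1), hence G bounded there.
    The pairing of T with rho is given on tests of compact support, so both uses of the equation are
    truncated: in the radius for the energy bound, which the bound of T by the D12 norm makes
    uniform in the truncation, and in the value for the comparison. In the latter, b >= 1 makes the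
    monotonicity coercive with constant 1. That a compactly supported function with zero gradient
    vanishes is obtained from the same divergence formula, applied to the field x. *)

Lemma pushforward_measureE d1 d2 (T1 : measurableType d1)
    (T2 : measurableType d2) (R : realType) (m : {measure set T1 -> \bar R})
    (f : T1 -> T2) : measurable_fun setT f ->
  exists pm : {measure set T2 -> \bar R}, forall A, pm A = m (f @^-1` A).
Proof.
move=> mf; unshelve refine (ex_intro _ (pushforward m f : measure _ _) _) => //.
Qed.

(** * Translations and dilations of Lebesgue measure *)

Section affine1.
Context (R : realType) (c v : R).
Hypothesis c0 : 0 < c.

Let aff : R -> measurableTypeR R := fun t => c * t + v.

Lemma measurable_affine1 : measurable_fun [set: measurableTypeR R] aff.
Proof.
apply: continuous_measurable_fun => x.
apply: continuousD; last exact: cst_continuous.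
by apply: continuousM; [exact: cst_continuous|].
Qed.

(** The pushforward by the affine map, multiplied by c, agrees with Lebesgue measure on the
    intervals ]a, b], and these determine the measure. *)
Lemma lebesgue_affine1 (A : set (measurableTypeR R)) : measurable A ->
  lebesgue_measure (aff @^-1` A) = (c^-1%:E * lebesgue_measure A)%E.
Proof.
move=> mA.
have [pm pmE] := pushforward_measureE lebesgue_measure measurable_affine1.
pose m := mscale (NngNum (ltW c0)) pm.
have -> : lebesgue_measure A = (c%:E * lebesgue_measure (aff @^-1` A))%E.
  suff H : forall X, ocitv X -> lebesgue_measure X = m X.
    by rewrite (lebesgue_measure_unique H mA) /m /= /mscale /= pmE.
  move=> _ [[a b]] _ <-.
  rewrite /m /= /mscale /= pmE.
  have -> : aff @^-1` [set` `]a, b]] = [set` `](a - v) / c, (b - v) / c]].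
    apply/seteqP; split => x /=; rewrite !in_itv /= /aff ltr_pdivrMr// ler_pdivlMr//.
      by rewrite ltrBlDr lerBrDr [x * c]mulrC.
    by rewrite ltrBlDr lerBrDr [x * c]mulrC.
  rewrite lebesgue_measure_itv [X in _ = (_ * X)%E](lebesgue_measure_itv (Interval (BRight
    _) (BRight _))) /=.
  rewrite !lte_fin.
  rewrite ltr_pM2r ?invr_gt0//.
  rewrite ltrD2r; case: ifPn => _; last by rewrite mule0.
  by rewrite -!EFinB -EFinM; congr EFin; field; rewrite gt_eqF.
by rewrite muleA -EFinM mulVf ?gt_eqF// mul1e.
Qed.

End affine1.

Lemma ge0_integral_affine1 (R : realType) (c v : R) (f : R -> \bar R) :
  0 < c -> measurable_fun [set: measurableTypeR R] f -> (forall t, 0 <= f t)%E ->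
  (\int[lebesgue_measure]_t f (c * t + v)%R =
   c^-1%:E * \int[lebesgue_measure]_t f t)%E.
Proof.
move=> c0 mf f0.
have ci : 0 <= c^-1 by rewrite invr_ge0 ltW.
rewrite -(@ge0_integral_mscale _ _ _ lebesgue_measure _ measurableT (NngNum ci) f)//.
transitivity (\int[pushforward (@lebesgue_measure R)
   (fun t => (c * t + v)%R : measurableTypeR R)]_t f t)%E.
  rewrite ge0_integral_pushforward//; exact: measurable_affine1.
apply: eq_measure_integral; first exact: measurable_affine1.
by move=> ? A mA _; exact: lebesgue_affine1.
Qed.

Lemma measurable_cons_rV_xsection (R : realType) n (A : set 'rV[R]_n.+1) :
  measurable A -> measurable (@cons_rV R n @^-1` A).
Proof.
by move=> mA; rewrite -[X in measurable X]setTI; exact: measurable_cons_rV.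
Qed.

Lemma measurable_affine_rV (R : realType) n (c : R) (v : 'rV[R]_n) :
  measurable_fun [set: 'rV[R]_n] (fun x => c *: x + v).
Proof.
apply: measurable_fun_rV => i; under eq_fun do rewrite !mxE.
apply: measurable_funD; last exact: measurable_cst.
by apply: measurable_funM; [exact: measurable_cst|exact: measurable_coord].
Qed.

(** Once the first coordinate is split off, the section at t of the preimage is the preimage of the
    section at c t + v0. The induction hypothesis gives the factor c^-n, and the change of variable
    in t gives one more factor c^-1. *)
Lemma lebesgue_rV_affine (R : realType) n (c : R) (v : 'rV[R]_n)
    (A : set 'rV[R]_n) : 0 < c -> measurable A ->
  lebesgue_rV R n ((fun x => c *: x + v) @^-1` A) =
  ((c ^- n)%:E * lebesgue_rV R n A)%E.
Proof.
move=> c0; elim: n v A => [|n IH] v A mA.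
  rewrite expr0 invr1 mul1e; congr (_ _).
  apply/seteqP; split => x /=; first by rewrite [c *: x + v]thinmx0 [x]thinmx0.
  by rewrite [c *: x + v]thinmx0 [x]thinmx0.
pose v0 := v ord0 ord0; pose v' : 'rV[R]_n := \row_j v ord0 (lift ord0 j).
have consE t y : c *: cons_rV (t, y) + v = cons_rV (c * t + v0, c *: y + v').
  rewrite /cons_rV; apply/rowP => i; rewrite !mxE.
  case: (@split_ordP 1 n i) => j -> /=.
    rewrite !mxE /= /v0; congr (_ + v ord0 _); apply/val_inj => /=.
    by rewrite ord1.
  rewrite !mxE /=; congr (_ + v ord0 _); exact/val_inj.
rewrite /= /cons_measure /pushforward /= /product_measure1 /=.
set B := cons_rV (n:=n) @^-1` A.
have mB : measurable B by exact: measurable_cons_rV_xsection.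
transitivity (\int[lebesgue_measure]_t ((c ^- n)%:E *
    lebesgue_rV R n (xsection B (c * t + v0)%R)))%E.
  apply: eq_integral => t _ /=; rewrite -(IH v'); last exact: measurable_xsection.
  congr (_ _); apply/seteqP; split => y /=;
    by rewrite /xsection /= !inE /B /= consE.
rewrite ge0_integralZl//; last 2 first.
- apply: (measurableT_comp (f := lebesgue_rV R n \o xsection B)).
    exact: measurable_fun_xsection.
  exact: measurable_affine1.
- by rewrite lee_fin invr_ge0 exprn_ge0// ltW.
rewrite (@ge0_integral_affine1 R c v0 (lebesgue_rV R n \o xsection B) c0)//;
  last exact: measurable_fun_xsection.
rewrite muleA -EFinM; congr (_%:E * _)%E.
by rewrite exprS invfM mulrC.
Qed.

Section translation.
Context (R : realType) (n : nat) (v : 'rV[R]_n).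
Local Notation mu := (lebesgue_rV R n).

Lemma measurable_translation :
  measurable_fun [set: 'rV[R]_n] (fun x : 'rV[R]_n => x + v).
Proof.
by have := measurable_affine_rV 1 v; under eq_fun do rewrite scale1r.
Qed.

Lemma lebesgue_rV_translation (A : set 'rV[R]_n) : measurable A ->
  mu ((fun x => x + v) @^-1` A) = mu A.
Proof.
move=> mA; have -> : (fun x => x + v) = (fun x => 1 *: x + v).
  by apply/funext => x; rewrite scale1r.
by rewrite (lebesgue_rV_affine v ltr01 mA) expr1n invr1 mul1e.
Qed.

Lemma ge0_integral_translation (f : 'rV[R]_n -> \bar R) :
  measurable_fun setT f -> (forall x, 0 <= f x)%E ->
  (\int[mu]_x f (x + v)%R = \int[mu]_x f x)%E.
Proof.
move=> mf f0.
transitivity (\int[pushforward mu (fun x => (x + v)%R)]_x f x)%E.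
  rewrite ge0_integral_pushforward//; exact: measurable_translation.
apply: eq_measure_integral; first exact: measurable_translation.
by move=> ? A mA _; exact: lebesgue_rV_translation.
Qed.

Lemma integrable_translation (f : 'rV[R]_n -> \bar R) :
  mu.-integrable setT f -> mu.-integrable setT (fun x => f (x + v)%R).
Proof.
move=> /integrableP[mf fi]; apply/integrableP; split.
  by apply: measurableT_comp => //; exact: measurable_translation.
by rewrite (@ge0_integral_translation (fun x => `|f x|)%E)//; exact: measurableT_comp.
Qed.

Lemma integral_translation (f : 'rV[R]_n -> \bar R) :
  mu.-integrable setT f -> (\int[mu]_x f (x + v)%R = \int[mu]_x f x)%E.
Proof.
move=> fi; have mf : measurable_fun setT f by exact: measurable_int fi.
rewrite integralE [RHS]integralE; congr (_ - _)%E.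
  rewrite -(@ge0_integral_translation f^\+%E) //; last exact: measurable_funepos.
  by apply: eq_integral => x _; rewrite unlock.
rewrite -(@ge0_integral_translation f^\-%E) //; last exact: measurable_funeneg.
by apply: eq_integral => x _; rewrite unlock.
Qed.

End translation.

(** * Euclidean norm and Borel sets *)

Section enorm.
Context (R : realType) (n : nat).
Implicit Types (x y z : 'rV[R]_n) (a : R).

Lemma dotC x y : dot x y = dot y x.
Proof. by apply: eq_bigr => i _; rewrite mulrC. Qed.

Lemma dotDl x y z : dot (x + y) z = dot x z + dot y z.
Proof. by rewrite /dot -big_split; apply: eq_bigr => i _; rewrite mxE mulrDl. Qed.

Lemma dotDr x y z : dot z (x + y) = dot z x + dot z y.
Proof. by rewrite dotC dotDl !(dotC z). Qed.

Lemma dotZl a x y : dot (a *: x) y = a * dot x y.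
Proof. by rewrite /dot mulr_sumr; apply: eq_bigr => i _; rewrite mxE mulrA. Qed.

Lemma dotZr a x y : dot x (a *: y) = a * dot x y.
Proof. by rewrite dotC dotZl dotC. Qed.

Lemma dotNl x y : dot (- x) y = - dot x y.
Proof. by rewrite -scaleN1r dotZl mulN1r. Qed.

Lemma dotNr x y : dot x (- y) = - dot x y.
Proof. by rewrite dotC dotNl dotC. Qed.

Lemma dot_ge0 x : 0 <= dot x x.
Proof. by apply: sumr_ge0 => i _; rewrite -expr2 sqr_ge0. Qed.

Lemma enorm_ge0 x : 0 <= enorm x. Proof. exact: sqrtr_ge0. Qed.

Lemma enorm_sqr x : enorm x ^+ 2 = dot x x.
Proof. by rewrite sqr_sqrtr// dot_ge0. Qed.

Lemma enormZ a x : enorm (a *: x) = `|a| * enorm x.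
Proof.
by rewrite /enorm dotZl dotZr mulrA -expr2 sqrtrM ?sqr_ge0// sqrtr_sqr.
Qed.

Lemma enormN x : enorm (- x) = enorm x.
Proof. by rewrite -scaleN1r enormZ normrN1 mul1r. Qed.

Lemma enorm0 : enorm (0 : 'rV[R]_n) = 0.
Proof. by rewrite -(scale0r 0) enormZ normr0 mul0r. Qed.

Lemma normr_coord_enorm x i : `|x ord0 i| <= enorm x.
Proof.
rewrite -sqrtr_sqr ler_sqrt ?dot_ge0// /dot (bigD1 i)//= -expr2 lerDl.
by apply: sumr_ge0 => j _; rewrite -expr2 sqr_ge0.
Qed.

Lemma normr_coord x i : `|x ord0 i| <= `|x|.
Proof.
by rewrite [leRHS]/Num.norm /= mx_normrE; apply/bigmax_geP; right => /=; exists (ord0, i).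
Qed.

Lemma norm_le_enorm x : `|x| <= enorm x.
Proof.
rewrite [leLHS]/Num.norm /= mx_normrE; apply/bigmax_leP; split; first exact: enorm_ge0.
by move=> [i j] _ /=; rewrite ord1 normr_coord_enorm.
Qed.

Lemma enorm_eq0 x : (enorm x == 0) = (x == 0).
Proof.
apply/eqP/eqP => [x0|->]; last exact: enorm0.
apply/eqP; rewrite -normr_le0 -x0; exact: norm_le_enorm.
Qed.

Lemma enorm_gt0 x : (0 < enorm x) = (x != 0).
Proof. by rewrite lt0r enorm_eq0 enorm_ge0 andbT. Qed.

Lemma cauchy_schwarz x y : `|dot x y| <= enorm x * enorm y.
Proof.
suff H : dot x y ^+ 2 <= dot x x * dot y y.
  rewrite -sqrtr_sqr (le_trans (_ : _ <= Num.sqrt (dot x x * dot y y)))//.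
    by rewrite ler_sqrt// mulr_ge0// dot_ge0.
  by rewrite sqrtrM ?dot_ge0.
have [x0|x0] := eqVneq (dot x x) 0.
  have /eqP : enorm x = 0 by rewrite /enorm x0 sqrtr0.
  rewrite enorm_eq0 => /eqP ->.
  by rewrite -(scale0r 0) !dotZl !mul0r expr0n.
have xx : 0 < dot x x by rewrite lt0r x0 dot_ge0.
(* With a = |x|^2, b = x.y and c = |y|^2, this square expands to a (a c - b^2). *)
have := dot_ge0 (dot x x *: y - dot x y *: x).
rewrite dotDl !dotDr !dotNl !dotNr !dotZl !dotZr (dotC y x).
set a := dot x x in xx *; set b := dot x y; set c := dot y y => h.
have : 0 <= a * (a * c - b ^+ 2) by apply: le_trans h _; rewrite le_eqVlt; apply/orP; left;
  apply/eqP; ring.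
by rewrite pmulr_rge0// subr_ge0.
Qed.

Lemma ler_dot_enorm x y : dot x y <= enorm x * enorm y.
Proof. exact: le_trans (ler_norm _) (cauchy_schwarz x y). Qed.

Lemma ler_enormD x y : enorm (x + y) <= enorm x + enorm y.
Proof.
rewrite -(@ler_pXn2r _ 2)// ?nnegrE ?addr_ge0 ?enorm_ge0//.
rewrite enorm_sqr dotDl !dotDr (dotC y x) sqrrD !enorm_sqr.
have := ler_dot_enorm x y; lra.
Qed.

Lemma ler_dist_enorm x y : `|enorm x - enorm y| <= enorm (x - y).
Proof.
have h (u v : 'rV[R]_n) : enorm u - enorm v <= enorm (u - v).
  by rewrite lerBlDr; have := ler_enormD (u - v) v; rewrite subrK.
by rewrite ler_norml h andbT lerNl opprB -(enormN (x - y)) opprB h.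
Qed.

Lemma enorm_le_sum x : enorm x <= \sum_i `|x ord0 i|.
Proof.
have s0 : 0 <= \sum_i `|x ord0 i| by exact: sumr_ge0.
rewrite -(@ler_pXn2r _ 2)// ?nnegrE ?enorm_ge0// enorm_sqr expr2 mulr_suml.
apply: ler_sum => i _; rewrite -expr2 -real_normK ?num_real// expr2.
apply: ler_wpM2l => //; rewrite (bigD1 i)//= lerDl.
exact: sumr_ge0.
Qed.

Lemma enorm_le_norm x : enorm x <= n%:R * `|x|.
Proof.
apply: le_trans (enorm_le_sum x) _.
apply: le_trans (ler_sum _ (fun i _ => normr_coord x i)) _.
by rewrite sumr_const card_ord mulr_natl.
Qed.

Lemma enorm_delta (i : 'I_n) : enorm (delta_mx ord0 i : 'rV[R]_n) = 1.
Proof.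
rewrite /enorm /dot (bigD1 i)//= big1 => [|j ji].
  by rewrite !mxE !eqxx/= mulr1 addr0 sqrtr1.
by rewrite !mxE (negbTE ji) andbF mulr0.
Qed.

Lemma enorm_continuous : continuous (@enorm R n).
Proof.
move=> x; apply/(@cvgrPdist_le _ _ _ (nbhs x)) => e e0.
have n0 : 0 < (n.+1)%:R :> R by [].
have : \forall y \near x, `|x - y| <= e / n.+1%:R.
  by apply: (@cvgr_dist_le _ _ _ (nbhs x)) => //; rewrite divr_gt0.
apply: filterS => y; rewrite ler_pdivlMr// => xy.
rewrite (le_trans (ler_dist_enorm _ _))// (le_trans (enorm_le_norm _))//.
by apply: le_trans xy; rewrite mulrC ler_wpM2l// ler_nat.
Qed.

End enorm.

Section borel.
Context (R : realType) (n : nat).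

(** Balls are those of the sup norm, hence finite intersections of slabs, each depending on one
    coordinate. *)
Lemma measurable_ball_rV (x : 'rV[R]_n) (e : R) : measurable (ball x e).
Proof.
have [e0|e0] := ltP 0 e; last first.
  by rewrite (_ : ball x e = set0)//; apply/seteqP; split => y //= -[]; rewrite ltNge e0.
have -> : ball x e = \bigcap_(i in [set: 'I_n])
    ((fun y : 'rV[R]_n => y ord0 i : measurableTypeR R) @^-1` (ball (x ord0 i) e)).
  apply/seteqP; split => [y [_ h] i _|y h] /=; first exact: h.
  by split => // i j; rewrite ord1; exact: h.
apply: fin_bigcap_measurable => // i _.
rewrite -[X in measurable X]setTI; apply: measurable_coord => //.
exact: measurable_ball.
Qed.

(** The balls with rational centre and radius 1/(k+1) form a countable base of the topology, so the
    coordinate sigma-algebra contains the open sets. *)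
Lemma open_measurable_rV (U : set 'rV[R]_n) : open U -> measurable U.
Proof.
move=> oU.
pose q (p : 'rV[rat]_n * nat) : set 'rV[R]_n :=
  ball (map_mx (ratr : rat -> R) p.1) (p.2.+1%:R^-1).
have -> : U = \bigcup_p (if `[< q p `<=` U >] then q p else set0).
  apply/seteqP; split => [x Ux|x [p _]]; last by case: asboolP => // h /h.
  have /nbhs_ballP[e /= e0 eU] := open_nbhs_nbhs (conj oU Ux).
  (* The radius d satisfies 2 d < e, so that a ball of radius d whose centre is within d of x stays
     in [ball x e]. *)
  pose k := Num.truncn (2 / e); set d : R := k.+1%:R^-1.
  have d0 : 0 < d by rewrite invr_gt0.
  have de : d + d < e.
    have := truncnS_gt (2 / e); rewrite -/k ltr_pdivrMr// => h.
    by rewrite -mulr2n -mulr_natr mulrC /d ltr_pdivrMr// mulrC.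
  have rx i : exists r : rat, ball (x ord0 i) d (ratr r).
    have /rat_in_itvoo[r] : x ord0 i - d < x ord0 i + d.
      by rewrite ltrBlDr -addrA ltrDl addr_gt0.
    rewrite in_itv/= => /andP[r1 r2]; exists r.
    by rewrite /ball/= ltr_distlC r1 r2.
  have [r rP] := choice rx.
  exists (\row_i r i, k) => //=.
  have xq : ball x d (map_mx (ratr : rat -> R) (\row_i r i)).
    by split => // i j; rewrite ord1 !mxE; exact: rP.
  case: asboolP => [_|]; first exact: ball_sym.
  case; move=> y /= qy; apply: eU; apply: le_ball (ltW de) _ _.
  exact: ball_triangle xq qy.
apply: countable_bigcupT_measurable; first exact: countableP.
by move=> p; case: asboolP => _ //; exact: measurable_ball_rV.
Qed.

Lemma continuous_measurable_rV (f : 'rV[R]_n -> R) :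
  continuous f -> measurable_fun [set: 'rV[R]_n] f.
Proof.
move=> cf; apply: (measurability _ (RGenOpens.measurableE R)).
move=> _ [_ [a [b ->] <-]]; rewrite setTI; apply: open_measurable_rV.
have /continuousP := cf; apply.
exact: interval_open.
Qed.

Lemma measurable_enorm : measurable_fun [set: 'rV[R]_n] (@enorm R n).
Proof. by apply: continuous_measurable_rV; exact: enorm_continuous. Qed.

Lemma measurable_eball r : measurable (@eball R n r).
Proof.
have := measurable_enorm measurableT (measurable_itv `]-oo, r[).
rewrite setTI; congr measurable; apply/seteqP.
Qed.

End borel.

(** * Derivation rules *)

Section derivative_rules.
Context (R : realType) (V : normedModType R).
Implicit Types (f g : V -> R) (x v : V) (a b : R).

Lemma der_cst (c : R) x v : is_derive x v (fun=> c) 0.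
Proof. exact: is_derive_cst. Qed.

Lemma derD f g x v a b : is_derive x v f a -> is_derive x v g b ->
  is_derive x v (fun y => f y + g y) (a + b).
Proof. exact: is_deriveD. Qed.

Lemma derB f g x v a b : is_derive x v f a -> is_derive x v g b ->
  is_derive x v (fun y => f y - g y) (a - b).
Proof. exact: is_deriveB. Qed.

Lemma derN f x v a : is_derive x v f a -> is_derive x v (fun y => - f y) (- a).
Proof. exact: is_deriveN. Qed.

Lemma derZ (c : R) f x v a : is_derive x v f a ->
  is_derive x v (fun y => c * f y) (c * a).
Proof. exact: is_deriveZ. Qed.

Lemma derM f g x v a b : is_derive x v f a -> is_derive x v g b ->
  is_derive x v (fun y => f y * g y) (a * g x + f x * b).
Proof.
move=> df dg; have := @is_deriveM R V f g x v a b df dg.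
by rewrite addrC /GRing.scale /= [g x * a]mulrC.
Qed.

Lemma derX f x v a n : is_derive x v f a ->
  is_derive x v (fun y => f y ^+ n.+1) (n.+1%:R * f x ^+ n * a).
Proof.
move=> df; elim: n => [|n IH]; first by rewrite expr0 mulr1 mul1r.
have -> : (fun y => f y ^+ n.+2) = (fun y => f y * f y ^+ n.+1).
  by apply/funext => y; rewrite exprS.
have -> : n.+2%:R * f x ^+ n.+1 * a = a * f x ^+ n.+1 + f x * (n.+1%:R * f x ^+ n * a).
  by rewrite exprS -[n.+2]addn1 natrD; ring.
exact: derM.
Qed.

Lemma der_near_eq f g x v a : {near x, f =1 g} -> v != 0 ->
  is_derive x v f a -> is_derive x v g a.
Proof. by move=> fg v0; exact: near_eq_is_derive. Qed.

(** Both difference quotients are the same function of the increment. This carries the one-variable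
    theorems over to directional derivatives. *)
Lemma is_derive_line f x v (t : R) a :
  is_derive (x + t *: v) v f a <-> is_derive t 1 (fun h : R => f (x + h *: v)) a.
Proof.
have E : (fun h : R => h^-1 *: ((f \o shift (x + t *: v)) (h *: v) - f (x + t *: v))) =
    (fun h : R => h^-1 *: (((fun h : R => f (x + h *: v)) \o shift t) (h *: 1) -
       f (x + t *: v))).
  apply/funext => h /=; congr (_ *: (f _ - _)).
  by rewrite -[h *: 1]/(h * 1) mulr1 scalerDl addrCA.
split=> -[d1 d2]; apply: DeriveDef.
- by move: d1; rewrite /derivable E.
- by move: d2; rewrite /derive E.
- by rewrite /derivable E.
- by rewrite /derive E.
Qed.

Lemma is_derive_line0 f x v a :
  is_derive x v f a <-> is_derive (0 : R) 1 (fun h : R => f (x + h *: v)) a.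
Proof. by have := is_derive_line f x v 0 a; rewrite scale0r addr0. Qed.

Lemma der_comp (F : R -> R) f x v a b : is_derive (f x) 1 F a ->
  is_derive x v f b -> is_derive x v (fun y => F (f y)) (a * b).
Proof.
move=> dF /is_derive_line0 df; apply/is_derive_line0.
apply: (@is_derive1_comp R F (fun h => f (x + h *: v))) => //.
by rewrite scale0r addr0.
Qed.

End derivative_rules.

Section derivative1.
Context (R : realType).
Implicit Types (f g : R -> R) (x a b : R).

Lemma der_id x : is_derive x 1 (fun y : R => y) 1.
Proof. exact: is_derive_id. Qed.

Lemma is_derive1P f x a :
  is_derive x 1 f a <-> derivable f x 1 /\ derive1 f x = a.
Proof.
split=> [[d1 d2]|[d1 d2]]; first by rewrite derive1E.
by apply: DeriveDef; rewrite -?derive1E.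
Qed.

Lemma der_lin (c : R) x : is_derive x 1 (fun y : R => c * y) c.
Proof. by rewrite -[X in is_derive _ _ _ X]mulr1; apply: derZ; exact: der_id. Qed.

Lemma is_derive1_continuous f x a : is_derive x 1 f a -> {for x, continuous f}.
Proof. by move=> [d _]; apply/differentiable_continuous; exact/derivable1_diffP. Qed.

(** The form suited to functions defined by cases: at a junction point each branch is estimated
    separately, without one-sided derivatives. *)
Lemma is_derive1_remainder f x a : (forall e, 0 < e -> \forall y \near x,
    `|f y - f x - a * (y - x)| <= e * `|y - x|) -> is_derive x 1 f a.
Proof.
move=> H; apply/is_derive1_caratheodory.
exists (fun y => if y == x then a else (f y - f x) / (y - x)); split.
- move=> z; case: eqVneq => [->|zx]; first by rewrite !subrr mulr0.
  by rewrite divfK// subr_eq0.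
- apply/(@cvgrPdist_le _ _ _ (nbhs x)) => e e0.
  near=> y; rewrite eqxx; case: eqVneq => [_|yx]; first by rewrite subrr normr0 ltW.
  have yx0 : 0 < `|y - x| by rewrite normr_gt0 subr_eq0.
  rewrite -(ler_pM2r yx0) -normrM mulrBl divfK ?subr_eq0// distrC.
  by near: y; exact: H.
- by rewrite eqxx.
Unshelve. all: by end_near. Qed.

Lemma near_norm_lt x a : `|x| < a -> \forall y \near x, `|y| < a.
Proof.
move=> xa; have d0 : 0 < a - `|x| by rewrite subr_gt0.
have : \forall y \near x, `|x - y| < a - `|x|.
  by apply: (@cvgr_dist_lt _ _ _ (nbhs x)).
apply: filterS => y; rewrite ltrBrDl; apply: le_lt_trans.
by rewrite -{1}(subrK x y) addrC (distrC x) ler_normD.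
Qed.

Lemma cvg_dnbhs_seq f a : f h @[h --> 0^'] --> a ->
  f (k.+1%:R^-1) @[k --> \oo] --> a.
Proof.
move=> H P /H [d /= d0 dP].
have := near_infty_natSinv_lt (PosNum d0); apply: filterS => k /= kd.
apply: dP; last by rewrite /= invr_eq0 pnatr_eq0.
by rewrite /ball_ /= sub0r normrN gtr0_norm ?invr_gt0.
Qed.

Lemma near_eq_derive1 f g x a : {near x, f =1 g} ->
  derivable f x 1 /\ derive1 f x = a -> derivable g x 1 /\ derive1 g x = a.
Proof.
move=> fg /is_derive1P df; apply/is_derive1P.
by apply: der_near_eq df; rewrite ?oner_neq0.
Qed.

End derivative1.

Section almost_everywhere.
Context d (T : measurableType d) (R : realType).
Variable mu : {measure set T -> \bar R}.
Implicit Types P Q S U : T -> Prop.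

Let aef : Filter (almost_everywhere mu) := ae_filter_ringOfSetsType mu.

Lemma ae_impl P Q : (forall x, P x -> Q x) ->
  {ae mu, forall x, P x} -> {ae mu, forall x, Q x}.
Proof. by move=> PQ; apply: (@filterS _ _ aef). Qed.

Lemma ae_impl2 P Q S : (forall x, P x -> Q x -> S x) ->
  {ae mu, forall x, P x} -> {ae mu, forall x, Q x} -> {ae mu, forall x, S x}.
Proof. by move=> PQ; apply: (@filterS2 _ _ aef). Qed.

Lemma ae_impl3 P Q S U : (forall x, P x -> Q x -> S x -> U x) ->
  {ae mu, forall x, P x} -> {ae mu, forall x, Q x} -> {ae mu, forall x, S x} ->
  {ae mu, forall x, U x}.
Proof. by move=> PQ; apply: (@filterS3 _ _ aef). Qed.

Lemma ae_forall (I : finType) (P : I -> T -> Prop) :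
  (forall i, {ae mu, forall x, P i x}) -> {ae mu, forall x, forall i, P i x}.
Proof. by move=> H; apply: (@filter_forall _ _ _ _ aef). Qed.

Lemma ae_eq_integrable (D : set T) (f g : T -> \bar R) : measurable D ->
  measurable_fun D g -> ae_eq mu D f g -> mu.-integrable D f -> mu.-integrable D g.
Proof.
move=> mD mg fg /integrableP[mf fi]; apply/integrableP; split => //.
suff <- : (\int[mu]_(x in D) `|f x| = \int[mu]_(x in D) `|g x|)%E by [].
apply: ae_eq_integral => //; [exact: measurableT_comp|exact: measurableT_comp|].
by move: fg; apply: ae_impl => x h Dx /=; rewrite h.
Qed.

End almost_everywhere.

(** * Lipschitz functions of one variable *)

Section lipschitz1.
Context (R : realType).
Local Notation mu := (@lebesgue_measure R).

(** The retraction of the line onto [a, b]. It is 1-Lipschitz, so that composing with it extends a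
    function Lipschitz on [a, b] to the whole line. *)
Definition clamp (a b t : R) : R := Num.max a (Num.min t b).

Lemma clamp_id a b t : a <= t <= b -> clamp a b t = t.
Proof. by move=> /andP[at_ tb]; rewrite /clamp (min_idPl tb) (max_idPr at_). Qed.

Lemma clamp_itv a b t : a <= b -> a <= clamp a b t <= b.
Proof. by move=> ab; rewrite /clamp le_max lexx ge_max ab ge_min lexx orbT. Qed.

Lemma clamp_lip a b s t : `|clamp a b s - clamp a b t| <= `|s - t|.
Proof.
wlog st : s t / s <= t.
  move=> H; case: (leP s t) => [/H//|/ltW/H].
  by rewrite distrC (distrC t).
rewrite /clamp /Num.max /Num.min.
rewrite (ler0_norm (_ : s - t <= 0)); last by rewrite subr_le0.
have [sb|sb] := ltP s b; have [tb|tb] := ltP t b;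
  repeat case: ifPn; rewrite -?leNgt => *; rewrite ler_norml; lra.
Qed.

Lemma klip_continuous (f : R -> R) k :
  (forall s t, `|f s - f t| <= k * `|s - t|) -> continuous f.
Proof.
move=> fk x; apply/(@cvgrPdist_le _ _ _ (nbhs x)) => e e0.
have k0 : 0 < `|k| + 1 by rewrite ltr_wpDl.
have : \forall y \near x, `|x - y| <= e / (`|k| + 1).
  by apply: (@cvgr_dist_le _ _ _ (nbhs x)) => //; rewrite divr_gt0.
apply: filterS => y; rewrite ler_pdivlMr// mulrC => xy.
apply: le_trans (fk _ _) _; apply: le_trans xy; rewrite ler_wpM2r//.
by rewrite (le_trans (ler_norm k))// lerDl.
Qed.

Lemma ndecr_cumulative (g : R -> R) : {homo g : x y / x <= y} -> continuous g ->
  exists c : cumulative R R, forall x, c x = g x.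
Proof.
move=> gnd gc.
have rc : right_continuous g by move=> x; exact: right_continuousW.
pose m := isCumulative.Build R _ R g gnd rc.
pose c : cumulative R R := HB.pack g m.
by exists c.
Qed.

Section global.
Variables (f : R -> R) (k a b : R).
Hypotheses (ab : a < b) (k0 : 0 < k).
Hypothesis fk : forall s t, `|f s - f t| <= k * `|s - t|.

(** Both k x + f and k x - f are nondecreasing and continuous, and their sum is 2 k x. Their
    Stieltjes measures therefore add up to 2 k times Lebesgue measure; the first one is absolutely
    continuous, and h is its Radon-Nikodym density. *)
Let RN : exists h : R -> R, mu.-integrable setT (EFin \o h) /\
  forall x, a <= x <= b -> \int[mu]_(t in `]a, x]) h t = (f x + k * x) - (f a + k * a).
Proof.
have fc := klip_continuous fk.
have kc : continuous (fun t : R => k * t).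
  by move=> t; apply: continuousM; [exact: cst_continuous|].
have [g1 g1E] : exists c : cumulative R R, forall x, c x = f x + k * x.
  apply: ndecr_cumulative => [s t st|t]; last by apply: continuousD; [exact: fc|exact: kc].
  have := fk s t; rewrite (ler0_norm (_ : s - t <= 0)) ?subr_le0// ler_norml; lra.
have [g2 g2E] : exists c : cumulative R R, forall x, c x = k * x - f x.
  apply: ndecr_cumulative => [s t st|t]; last by apply: continuousB; [exact: kc|exact: fc].
  have := fk s t; rewrite (ler0_norm (_ : s - t <= 0)) ?subr_le0// ler_norml; lra.
pose n1 := lebesgue_stieltjes_measure g1.
pose n2 := lebesgue_stieltjes_measure g2.
have LSE (c : cumulative R R) x y : x <= y ->
    lebesgue_stieltjes_measure c `]x, y] = (c y - c x)%:E.
  move=> xy; rewrite /lebesgue_stieltjes_measure /measure_extension measurable_mu_extE/=;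
    last exact: is_ocitv.
  by rewrite wlength_itv_bnd.
have kk0 : 0 <= (2 * k)^-1 by rewrite invr_ge0 mulr_ge0// ltW.
have sumE A : measurable A -> mu A = ((2 * k)^-1%:E * (n1 A + n2 A))%E.
  move=> mA; pose m := mscale (NngNum kk0) (measure_add n1 n2).
  have mE B : m B = ((2 * k)^-1%:E * (n1 B + n2 B))%E.
    by congr (_ * _)%E; exact: measure_addE.
  rewrite -mE.
  suff H : forall X, ocitv X -> lebesgue_measure X = m X.
    exact: (lebesgue_measure_unique H mA).
  move=> _ [[x y]] _ <-; rewrite mE /=.
  have [xy|yx] := leP x y; last first.
    by rewrite /n1 /n2 !set_itv_ge ?bnd_simp -?leNgt// ?ltW// !measure0 adde0 mule0.
  rewrite /n1 /n2 !LSE// -EFinD -EFinM !g1E !g2E.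
  rewrite lebesgue_measure_itv /= lte_fin; case: ltgtP xy => // [xy _|-> _].
    by rewrite -EFinB; congr EFin; field; rewrite gt_eqF.
  by congr EFin; ring.
have n1mu : n1 `<< mu.
  apply/null_content_dominatesP => A mA A0.
  have := sumE A mA; rewrite A0 => /esym/eqP; rewrite mule_eq0 eqe.
  rewrite invr_eq0 mulf_eq0 pnatr_eq0/= gt_eqF//= padde_eq0 ?measure_ge0//.
  by move=> /andP[/eqP].
have mab : measurable (`]a, b] : set (measurableTypeR R)) by exact: measurable_itv.
have n1oo : (n1 `]a, b]%classic < +oo)%E by rewrite /n1 LSE ?ltry// ltW.
(* Restricting to ]a, b] makes the measure finite, so that its density is integrable on the whole
   line. *)
pose n3 : {finite_measure set (measurableTypeR R) -> \bar R} := mfrestr mab n1oo.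
have n3mu : n3 `<< mu.
  apply/null_content_dominatesP => A mA A0.
  move/null_content_dominatesP : n1mu => n1mu.
  rewrite /n3/= /mfrestr /mrestr; apply/eqP; rewrite eq_le measure_ge0 andbT.
  rewrite -(n1mu A mA A0); apply: le_measure; rewrite ?inE//.
  exact: measurableI.
have [h [h0 hfin hint hE]] := radon_nikodym_sigma_finite n3mu.
have hEfin : EFin \o (fine \o h) = h by apply/funext => t /=; rewrite fineK.
exists (fine \o h); rewrite hEfin; split => // x /andP[ax xb].
rewrite /Rintegral -[RHS]/(fine (f x + k * x - (f a + k * a))%:E); congr fine.
rewrite -!g1E -LSE//.
transitivity (n3 `]a, x]%classic).
  by rewrite hE//; apply: eq_integral => t _ /=; rewrite fineK.
rewrite /n3/= /mfrestr /mrestr setIidl//.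
by move=> t /=; rewrite !in_itv/= => /andP[-> /le_trans]; exact.
Qed.

(** By Lebesgue's differentiation theorem the indefinite integral of the density of f + k x is
    derivable almost everywhere, with that density as derivative; the linear part is then
    subtracted. *)
Lemma klip_ftc : exists h : R -> R, [/\ mu.-integrable `[a, b] (EFin \o h),
  {ae mu, forall x, a < x < b -> derivable f x 1 /\ derive1 f x = h x} &
  \int[mu]_(t in `[a, b]) h t = f b - f a].
Proof.
have [h [hi hE]] := RN.
have kci : mu.-integrable `[a, b] (EFin \o cst k).
  apply: measurable_bounded_integrable => //.
    by rewrite /= lebesgue_measure_itv /= lte_fin ab ltry.
  by exists k; split; [exact: num_real|move=> x kx t _ /=;
    rewrite (le_trans _ (ltW kx))// gtr0_norm].
have hi' : mu.-integrable `[a, b] (EFin \o h) by exact: integrableS hi.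
exists (fun t => h t - k); split.
- rewrite (_ : EFin \o _ = (EFin \o h) \- (EFin \o cst k))%E//.
  exact: integrableB.
- have locf : locally_integrable [set: R] h.
    by apply: open_integrable_locally => //; exact: openT.
  have hiy y : mu.-integrable [set` Interval (BRight a) (BRight y)] (EFin \o h).
    exact: integrableS hi.
  pose G x := \int[mu]_(t in `]a, x]) h t.
  have : {ae mu, forall x, a < x -> derivable G x 1 /\ derive1 G x = h x}.
    have := FTC1 hiy locf; apply: ae_impl.
    by move=> x /= H ax; apply: H; rewrite lte_fin.
  apply: ae_impl.
  move=> x + /andP[ax xb] => /(_ ax) [dG G'].
  have nE : {near x, (fun y => G y - (k * y - (f a + k * a))) =1 f}.
    near=> y; rewrite /G /= hE; first by ring.
    rewrite !ltW//; near: y; [exact: lt_nbhsl|exact: lt_nbhsr].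
  have dG' : is_derive x 1 (fun y => G y - (k * y - (f a + k * a))) (h x - k).
    apply: derB; first exact/is_derive1P.
    by rewrite -[X in is_derive _ _ _ X]subr0; exact: (derB (der_lin _ _) (der_cst _ _ _)).
  apply: (near_eq_derive1 nE); exact/is_derive1P.
- rewrite RintegralB//.
  rewrite -Rintegral_itv_obnd_cbnd; last first.
    exact: integrableS hi.
  rewrite hE ?lexx ?ltW// Rintegral_cst//= lebesgue_measure_itv/= lte_fin ab /=.
  ring.
Unshelve. all: by end_near. Qed.

End global.

Lemma ae_neq (c : R) : {ae mu, forall x, x != c}.
Proof.
exists [set c]; split; [exact: measurable_set1|exact: lebesgue_measure_set1|].
by move=> x /= /negP; rewrite negbK => /eqP.
Qed.

Section interval.
Variables (f : R -> R) (k a b : R).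
Hypothesis ab : a < b.
Hypothesis fk : forall s t, a <= s <= b -> a <= t <= b ->
  `|f s - f t| <= k * `|s - t|.

Let F t := f (clamp a b t).

Let clip : exists h : R -> R, [/\ mu.-integrable `[a, b] (EFin \o h),
  {ae mu, forall x, a < x < b -> derivable f x 1 /\ derive1 f x = h x} &
  \int[mu]_(t in `[a, b]) h t = f b - f a].
Proof.
have k0 : 0 < `|k| + 1 by rewrite ltr_wpDl.
have Fk s t : `|F s - F t| <= (`|k| + 1) * `|s - t|.
  apply: le_trans (fk (clamp_itv _ (ltW ab)) (clamp_itv _ (ltW ab))) _.
  apply: (@le_trans _ _ ((`|k| + 1) * `|clamp a b s - clamp a b t|)).
    by rewrite ler_wpM2r// (le_trans (ler_norm k))// lerDl.
  by rewrite ler_pM2l// clamp_lip.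
have [h [hi hd hE]] := klip_ftc ab k0 Fk.
have Ff t : a <= t <= b -> F t = f t by move=> abt; rewrite /F clamp_id.
exists h; split => //; last by rewrite hE !Ff// lexx ltW.
move: hd; apply: ae_impl => x hx axb.
have FE : {near (x : R), F =1 f}.
  have /andP[ax xb] := axb; near=> y; rewrite Ff//.
  by rewrite !ltW//; near: y; [exact: lt_nbhsl|exact: lt_nbhsr].
exact: near_eq_derive1 FE (hx axb).
Unshelve. all: by end_near. Qed.

Lemma lip_ae_derivable : {ae mu, forall x, a < x < b -> derivable f x 1}.
Proof.
have [h [_ hd _]] := clip; move: hd.
by apply: ae_impl => x hx /hx[].
Qed.

(** The condition on [u] is conditional on derivability: any measurable function that gives the
    derivative where it exists will do, whatever its values elsewhere. *)
Lemma lip_ftc (u : R -> R) : measurable_fun (`[a, b] : set (measurableTypeR R)) u ->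
  {ae mu, forall x, a < x < b -> derivable f x 1 -> derive1 f x = u x} ->
  mu.-integrable `[a, b] (EFin \o u) /\
  (\int[mu]_(t in `[a, b]) (u t)%:E = (f b - f a)%:E)%E.
Proof.
move=> mU; have [h [hi hd hE]] := clip => ud.
have ae : ae_eq mu `[a, b]%classic (EFin \o h) (EFin \o u).
  have huE : {ae mu, forall x, a < x < b -> h x = u x}.
    by move: hd ud; apply: ae_impl2 => x h1 h2 axb; have [d1 <-] := h1 axb; rewrite h2.
  move: huE (ae_neq a) (ae_neq b).
  apply: ae_impl3 => x hx xa xb /=; rewrite in_itv/= => /andP[ax xb'].
  by rewrite hx// !lt_neqAle eq_sym xa ax xb xb'.
have mh : measurable_fun (`[a, b] : set (measurableTypeR R)) (EFin \o h)
  by exact: measurable_int hi.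
have mEu : measurable_fun (`[a, b] : set (measurableTypeR R)) (EFin \o u)
  by exact/measurable_EFinP.
split; first by apply: (ae_eq_integrable _ mEu ae hi).
have <- : (\int[mu]_(t in `[a, b]) (h t)%:E = \int[mu]_(t in `[a, b]) (u t)%:E)%E.
  exact: ae_eq_integral.
by rewrite -hE /Rintegral fineK//; exact: integrable_fin_num.
Qed.

End interval.

End lipschitz1.

(** * Integration along lines and integration by parts *)

Section lines.
Context (R : realType) (n : nat) (i : 'I_n).
Local Notation RT := (measurableTypeR R).
Local Notation lam := (@lebesgue_measure R).
Local Notation mu := (lebesgue_rV R n).
Local Notation e := (delta_mx ord0 i : 'rV[R]_n).

Let I01 : set RT := `[0, 1]%classic.

Let mI01 : measurable I01. Proof. exact: measurable_itv. Qed.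

Let lamI01 : lam I01 = 1%E.
Proof. by rewrite /I01 lebesgue_measure_itv /= lte_fin ltr01 -EFinB subr0. Qed.

Let int_I01 : (\int[lam]_t (\1_I01 t)%:E = 1)%E.
Proof. by rewrite integral_indic// setIT; exact: lamI01. Qed.

Lemma measurable_line_shift :
  measurable_fun [set: RT * 'rV[R]_n] (fun z => z.2 + (z.1 : R) *: e).
Proof.
apply: measurable_fun_rV => j; under eq_fun do rewrite !mxE.
apply: measurable_funD.
  exact: (measurableT_comp (measurable_coord j) measurable_snd).
by apply: measurable_funM; [exact: measurable_fst|exact: measurable_cst].
Qed.

Lemma measurable_line (x : 'rV[R]_n) :
  measurable_fun [set: RT] (fun t => x + (t : R) *: e).
Proof.
apply: measurable_fun_rV => j; under eq_fun do rewrite !mxE.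
apply: measurable_funD; first exact: measurable_cst.
by apply: measurable_funM; [exact: measurable_id|exact: measurable_cst].
Qed.

Let F (f : 'rV[R]_n -> \bar R) (z : RT * 'rV[R]_n) : \bar R :=
  (f (z.2 + (z.1 : R) *: e)%R * (\1_I01 z.1)%:E)%E.

Let mF f : measurable_fun setT f -> measurable_fun setT (F f).
Proof.
move=> mf; apply: emeasurable_funM.
  by apply: measurableT_comp => //; exact: measurable_line_shift.
apply/measurable_EFinP; apply: measurableT_comp; last exact: measurable_fst.
exact: measurable_indic.
Qed.

Let intF f x : (\int[lam]_t F f (t, x) = \int[lam]_(t in I01) f (x + (t : R) *: e)%R)%E.
Proof. by rewrite [RHS]integral_mkcond epatch_indic. Qed.

Let intFx f t : measurable_fun setT f -> (forall x, 0 <= f x)%E ->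
  (\int[mu]_x F f (t, x) = (\1_I01 t)%:E * \int[mu]_x f x)%E.
Proof.
move=> mf f0; rewrite /F /=.
under eq_integral do rewrite muleC.
rewrite ge0_integralZl// ?lee_fin//; last first.
  by apply: measurableT_comp => //; exact: measurable_translation.
by rewrite ge0_integral_translation.
Qed.

(* Integrals over R^n are averages of integrals over unit segments parallel to an
   axis: this replaces the disintegration of the measure along that axis. *)
Lemma ge0_integral_average (f : 'rV[R]_n -> \bar R) :
  measurable_fun setT f -> (forall x, 0 <= f x)%E ->
  (\int[mu]_x f x = \int[mu]_x \int[lam]_(t in I01) f (x + (t : R) *: e)%R)%E.
Proof.
move=> mf f0; symmetry; under eq_integral do rewrite -intF.
rewrite -(@fubini_tonelli _ _ _ _ _ lam mu (F f)); last 2 first.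
- exact: mF.
- by move=> z; rewrite /F mule_ge0// lee_fin.
under eq_integral do rewrite (intFx _ mf f0) muleC.
rewrite ge0_integralZl//; last 2 first.
- exact/measurable_EFinP/measurable_indic.
- by apply: integral_ge0 => x _.
by rewrite int_I01 mule1.
Qed.

(** Averaging the indicator of A: each inner integral is the length of the trace of A on a unit
    segment. *)
Lemma negligible_lines (A : set 'rV[R]_n) : measurable A ->
  (forall x, lam (I01 `&` (fun t : RT => x + (t : R) *: e) @^-1` A) = 0%E) ->
  mu A = 0%E.
Proof.
move=> mA A0; have -> : mu A = (\int[mu]_x (\1_A x)%:E)%E by rewrite integral_indic// setIT.
rewrite ge0_integral_average//; last exact/measurable_EFinP/measurable_indic.
apply: integral0_eq => x _.
rewrite (_ : (fun t => _) = (fun t => (\1_((fun t : RT => x + (t : R) *: e) @^-1` A) t)%:E))//.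
rewrite integral_indic//; first by rewrite setIC; exact: A0.
by rewrite -[X in measurable X]setTI; exact: measurable_line.
Qed.

Let FI (u : 'rV[R]_n -> \bar R) : mu.-integrable setT u ->
  (lam \x mu)%E.-integrable setT (F u).
Proof.
move=> ui; have mU : measurable_fun setT u by exact: measurable_int ui.
have mau : measurable_fun setT (abse \o u) by exact: measurableT_comp.
apply/integrable12ltyP; first exact: mF.
  have -> : (fun t => \int[mu]_x `|F u (t, x)|)%E =
      (fun t => (\int[mu]_x `|u x|) * (\1_I01 t)%:E)%E.
    apply/funext => t; rewrite -(@ge0_integral_translation _ _ (t *: e) (abse \o u))//;
      last by move=> x /=.
    have mt : measurable_fun setT (fun x : 'rV[R]_n => (abse \o u) (x + t *: e)%R).
      by apply: (measurableT_comp (f := abse \o u)) => //; exact: measurable_translation.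
    rewrite -ge0_integralZr ?lee_fin//; last by move=> x _ /=.
    by apply: eq_integral => x _; rewrite /F /= abseM [X in (_ * X)%E]gee0_abs ?lee_fin.
  rewrite ge0_integralZl//; last 2 first.
  - exact/measurable_EFinP/measurable_indic.
  - exact: integral_ge0.
  rewrite int_I01 mule1.
  by case/integrableP : ui.
Qed.

Lemma integral_average (u : 'rV[R]_n -> \bar R) : mu.-integrable setT u ->
  (\int[mu]_x u x = \int[mu]_x \int[lam]_(t in I01) u (x + (t : R) *: e)%R)%E.
Proof.
move=> ui; symmetry; under eq_integral do rewrite -intF.
rewrite -(Fubini (FI ui)).
transitivity (\int[lam]_t ((\1_I01 t)%:E * (\int[mu]_x u x)))%E.
  apply: eq_integral => t _; rewrite /F /=.
  rewrite integralZr//; last exact: integrable_translation.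
  by rewrite integral_translation// muleC.
rewrite -(fineK (integrable_fin_num _ ui))// integralZr//; last first.
  apply/integrableP; split; first exact/measurable_EFinP/measurable_indic.
  under eq_integral do rewrite gee0_abs ?lee_fin//.
  by rewrite int_I01 ltry.
by rewrite int_I01 mul1e.
Qed.

(** After averaging, the integral of u is that of f(x + e) - f(x), which is 0 by translation
    invariance. Integrability of f thus replaces any discussion of boundary terms. *)
Lemma integral_line_derivative (f u : 'rV[R]_n -> R) :
  mu.-integrable setT (EFin \o f) -> mu.-integrable setT (EFin \o u) ->
  {ae mu, forall x, (\int[lam]_(t in I01) (u (x + (t : R) *: e)%R)%:E =
    (f (x + e)%R - f x)%:E)%E} ->
  (\int[mu]_x (u x)%:E = 0)%E.
Proof.
move=> fi ui fu; rewrite integral_average//.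
have fit := integrable_translation e fi.
transitivity (\int[mu]_x (f (x + e)%R - f x)%:E)%E; last first.
  rewrite (@integralB _ _ _ mu _ measurableT (fun x => (f (x + e)%R)%:E) (EFin \o f))//.
  rewrite (@integral_translation _ _ e (EFin \o f))// subee//.
  exact: integrable_fin_num.
apply: ae_eq_integral => //.
- rewrite (_ : (fun x => _) = fubini_G lam (F (EFin \o u))).
    exact: measurable_fubini_G (FI ui).
  by apply/funext => x; rewrite /fubini_G intF.
- by apply: measurable_int (integrableB measurableT fit fi).
- by move: fu; apply: ae_impl => x h _.
Qed.

End lines.

(** * Almost everywhere directional derivatives of Lipschitz functions *)

Section rademacher.
Context (R : realType) (n : nat) (i : 'I_n).
Local Notation RT := (measurableTypeR R).
Local Notation lam := (@lebesgue_measure R).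
Local Notation mu := (lebesgue_rV R n).
Local Notation e := (delta_mx ord0 i : 'rV[R]_n).

Definition lip_along (k : R) (f : 'rV[R]_n -> R) :=
  forall x (s t : R), `|f (x + s *: e) - f (x + t *: e)| <= k * `|s - t|.

Definition line_quotient (f : 'rV[R]_n -> R) (h : R) (x : 'rV[R]_n) : R :=
  h^-1 * (f (x + h *: e) - f x).

Lemma line_quotientE f x :
  (fun h => h^-1 *: ((f \o shift x) (h *: e) - f x)) = line_quotient f ^~ x.
Proof. by apply/funext => h; rewrite /line_quotient /= [h *: e + x]addrC. Qed.

Lemma near_rat (h : R) (P : R -> Prop) :
  (\forall y \near h, P y) -> exists q : rat, P (ratr q).
Proof.
move=> /nbhs_ballP[d /= d0 hd].
have [r] : exists r, (ball h d `&` range (@ratr R)) r.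
  apply: dense_rat; last exact: ball_open.
  by exists h; exact: ballxx.
by case=> hr [q _ qr]; exists q; apply: hd; rewrite qr.
Qed.

Section derivability.
Variables (k : R) (f : 'rV[R]_n -> R).
Hypothesis fk : lip_along k f.

Let quot_cont x h : h != 0 -> {for h, continuous (fun h => line_quotient f h x)}.
Proof.
move=> h0; apply: continuousM; first exact: inv_continuous.
apply: continuousB; last exact: cst_continuous.
by apply: (@klip_continuous _ _ k) => s t; exact: fk.
Qed.

(** The Cauchy criterion for the difference quotients, over rational increments only: derivability
    becomes a countable combination of conditions measurable in x. *)
Definition rat_cauchy (m l : nat) (p q : rat) (x : 'rV[R]_n) : bool :=
  [&& p != 0, q != 0, `|ratr p : R| < l.+1%:R^-1 & `|ratr q : R| < l.+1%:R^-1] ==>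
    (`|line_quotient f (ratr p) x - line_quotient f (ratr q) x| <= m.+1%:R^-1).

(** Away from 0 the quotient is continuous in the increment, so that bounds over rational increments
    extend to all real ones. *)
Lemma derivable_rat_cauchy x : derivable f x e <->
  (forall m, exists l, forall p q, rat_cauchy m l p q x).
Proof.
have E := line_quotientE f x.
rewrite /derivable E; split=> [fx m|H].
  have m0 : 0 < (m.+1%:R^-1 / 2 : R) by rewrite divr_gt0// invr_gt0.
  move/cvg_ex : fx => [l /(@cvgrPdist_le _ _ _ _ _) /(_ _ m0)].
  move/nbhs_ballP => [d /= d0 hd].
  exists (Num.truncn d^-1) => p q; apply/implyP => /and4P[p0 q0 pd qd].
  have dd : (Num.truncn d^-1).+1%:R^-1 < d.
    by rewrite -[ltRHS]invrK ltf_pV2 ?posrE ?invr_gt0//; exact: truncnS_gt.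
  have hp : `|l - line_quotient f (ratr p) x| <= m.+1%:R^-1 / 2.
    apply: hd; last by rewrite fmorph_eq0.
    by rewrite /ball/= sub0r normrN (lt_trans pd).
  have hq : `|l - line_quotient f (ratr q) x| <= m.+1%:R^-1 / 2.
    apply: hd; last by rewrite fmorph_eq0.
    by rewrite /ball/= sub0r normrN (lt_trans qd).
  rewrite [leRHS]splitr (le_trans (ler_distD l _ _))//.
  by rewrite lerD// distrC.
apply/cauchy_cvgP/cauchy_ballP => d d0.
pose m := Num.truncn d^-1.
have md : m.+1%:R^-1 < d.
  by rewrite -[ltRHS]invrK ltf_pV2 ?posrE ?invr_gt0//; exact: truncnS_gt.
have [l Hl] := H m.
set Q := line_quotient f ^~ x.
exists (Q @` [set h : R | h != 0 /\ `|h| < l.+1%:R^-1],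
        Q @` [set h : R | h != 0 /\ `|h| < l.+1%:R^-1]).
  have D : (0 : R)^' [set h : R | h != 0 /\ `|h| < l.+1%:R^-1].
    near=> h; split; first by near: h; exact: nbhs_dnbhs_neq.
    by near: h; apply: dnbhs0_lt; rewrite invr_gt0.
  by split; apply: filterS D => h Hh; exists h.
move=> [_ _] [/= [h [h0 hl] <-] [h' [h0' hl'] <-]].
rewrite /ball/=; apply: le_lt_trans md; rewrite leNgt; apply/negP => abs.
(* Half of the excess over 1/(m+1): replacing each increment by a rational one whose quotient is
   closer than this preserves the violation of the bound. *)
have dl : 0 < (`|Q h - Q h'| - m.+1%:R^-1) / 2.
  by rewrite divr_gt0// subr_gt0.
have near_h (z : R) : z != 0 -> `|z| < l.+1%:R^-1 -> exists q : rat,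
    [/\ q != 0, `|ratr q : R| < l.+1%:R^-1 &
        `|Q z - Q (ratr q)| < (`|Q h - Q h'| - m.+1%:R^-1) / 2].
  move=> z0 zl.
  have [q [q1 q2 q3]] : exists q : rat, [/\ (ratr q : R) != 0, `|ratr q : R| < l.+1%:R^-1 &
        `|Q z - Q (ratr q)| < (`|Q h - Q h'| - m.+1%:R^-1) / 2].
    apply: (@near_rat z (fun y => [/\ y != 0, `|y| < l.+1%:R^-1 &
        `|Q z - Q y| < (`|Q h - Q h'| - m.+1%:R^-1) / 2])).
    near=> y; split.
    - by near: y; apply: (@cvgr_neq0 _ _ _ (nbhs z) _ id z).
    - by near: y; move: zl; apply: cvgr_lt; exact: norm_continuous.
    - by near: y; apply: (@cvgr_dist_lt _ _ _ (nbhs z)) => //; exact: quot_cont.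
  by exists q; split => //; move: q1; rewrite fmorph_eq0.
have [p [p0 pl hp]] := near_h _ h0 hl.
have [q [q0 ql hq]] := near_h _ h0' hl'.
have := Hl p q; rewrite /rat_cauchy p0 q0 pl ql /= -/Q => hpq.
have := ler_distD (Q (ratr p)) (Q h) (Q h').
have := ler_distD (Q (ratr q)) (Q (ratr p)) (Q h').
rewrite -(distrC (Q h')); rewrite (distrC (Q (ratr q))) in hq *.
set D := `|Q h - Q h'| in abs dl hp hq *.
move: hp hq hpq.
set u := `|Q h - _|; set v := `|Q h' - _|; set w := `|_ - Q (ratr q)|.
rewrite -/(line_quotient f (ratr q) x).
set M := m.+1%:R^-1 in abs dl *.
lra.
Unshelve. all: by end_near. Qed.

Lemma measurable_derivable : measurable_fun setT f ->
  measurable [set x | derivable f x e].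
Proof.
move=> mf.
have mq h : measurable_fun setT (line_quotient f h).
  apply: measurable_funM; first exact: measurable_cst.
  apply: measurable_funB => //; apply: measurableT_comp => //.
  exact: measurable_translation.
have mS m l p q : measurable [set x | rat_cauchy m l p q x].
  rewrite /rat_cauchy; set c := [&& _, _, _ & _].
  case: c; last by rewrite (_ : [set _ | _] = setT)//; apply/seteqP.
  rewrite /=; rewrite -[X in measurable X]setTI.
  have mA : measurable_fun setT
      (fun x => `|line_quotient f (ratr p) x - line_quotient f (ratr q) x|).
    exact: measurableT_comp (measurable_funB (mq _) (mq _)).
  have := measurable_fun_ler mA (measurable_cst (m.+1%:R^-1 : R)).
  by move=> /(_ measurableT [set true]); apply.
rewrite (_ : [set x | _] = \bigcap_m \bigcup_l
    ~` (\bigcup_(pq : rat * rat) ~` [set x | rat_cauchy m l pq.1 pq.2 x])).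
  apply: bigcapT_measurable => m; apply: bigcupT_measurable => l.
  apply: measurableC; apply: countable_bigcupT_measurable; first exact: countableP.
  by move=> pq; exact: measurableC.
apply/seteqP; split => [x /= /derivable_rat_cauchy H m _|x H].
  have [l Hl] := H m; exists l => // -[[p q] _] /=; apply; exact: Hl.
apply/derivable_rat_cauchy => m; have [l _ Hl] := H m Logic.I.
exists l => p q; apply: contrapT => Hn; apply: Hl.
by exists (p, q).
Qed.

(** On every line parallel to the axis the function is Lipschitz in one variable, hence derivable
    almost everywhere on that line; [negligible_lines] concludes, the exceptional set being
    measurable. *)
Lemma ae_derivable_along : measurable_fun setT f ->
  {ae mu, forall x, derivable f x e}.
Proof.
move=> mf; have mD := measurable_derivable mf.
exists (~` [set x | derivable f x e]); split; [exact: measurableC| |by []].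
apply: (@negligible_lines _ _ i); first exact: measurableC.
move=> x; set B := (X in lam X).
have mB : measurable B.
  apply: measurableI; first exact: measurable_itv.
  rewrite -[X in measurable X]setTI; apply: measurable_line => //.
  exact: measurableC.
have H : {ae lam, forall t, 0 < t < 1 -> derivable (fun t : R => f (x + t *: e)) t 1}.
  by apply: (@lip_ae_derivable _ _ k) => // s t _ _; exact: fk.
have {}H : {ae lam, forall t, ~ B t}.
  move: H (ae_neq (0:R)) (ae_neq (1:R)); apply: ae_impl3 => t h t0 t1 [/=].
  rewrite in_itv/= => /andP[a b]; apply.
  have ht : 0 < t < 1 by rewrite !lt_neqAle eq_sym t0 a t1 b.
  have := h ht => /derivableP; move/is_derive_line.
  by move=> [].
have [C [mC C0 BC]] := H.
apply/eqP; rewrite -measure_le0 -C0; apply: le_measure; rewrite ?inE//.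
by move=> t Bt; apply: BC => /=; exact.
Qed.

(* The value 0 where the derivative does not exist makes this measurable. *)
Definition dpart (x : 'rV[R]_n) : R := if `[< derivable f x e >] then partial i f x else 0.

Lemma measurable_dpart : measurable_fun setT f -> measurable_fun setT dpart.
Proof.
move=> mf; have mD := measurable_derivable mf.
pose h l := line_quotient f l.+1%:R^-1.
have mh l : measurable_fun setT (h l).
  apply: measurable_funM; first exact: measurable_cst.
  apply: measurable_funB => //; apply: measurableT_comp => //.
  exact: measurable_translation.
(* A limit along the sequence of increments 1/(l+1), so that measurability passes to it. *)
apply: (@measurable_fun_cvg _ _ _ _ (fun l x => if `[< derivable f x e >] then h l x else 0)).
  move=> l; apply: measurable_fun_ifT => //.
  apply: (measurable_fun_bool true) => //.
  rewrite setTI (_ : _ @^-1` _ = [set x | derivable f x e])//.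
  by apply/seteqP; split => x /= /asboolP.
move=> x _; rewrite /dpart; case: asboolP => [dx|_]; last exact: cvg_cst.
have E := line_quotientE f x.
have : line_quotient f h0 x @[h0 --> 0^'] --> partial i f x.
  by move: dx; rewrite /derivable /partial /derive E.
exact: cvg_dnbhs_seq.
Qed.

Lemma dpart_bound x : `|dpart x| <= `|k|.
Proof.
rewrite /dpart; case: asboolP => [dx|_]; last by rewrite normr0.
have E := line_quotientE f x.
have dq : line_quotient f h0 x @[h0 --> 0^'] --> partial i f x.
  by move: dx; rewrite /derivable /partial /derive E.
have : `|line_quotient f h0 x| @[h0 --> 0^'] --> `|partial i f x| by apply: cvg_norm.
move=> H; apply: (ler_cvg_to H (cvg_cst `|k|)).
near=> h0.
rewrite /line_quotient normrM normfV.
have h00 : h0 != 0 by near: h0; exact: nbhs_dnbhs_neq.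
rewrite mulrC ler_pdivrMr ?normr_gt0//.
have := fk x h0 0; rewrite scale0r addr0 subr0 => /le_trans; apply.
by rewrite ler_wpM2r// ler_norm.
Unshelve. all: by end_near. Qed.

End derivability.
End rademacher.

Section by_parts.
Context (R : realType) (n : nat) (i : 'I_n).
Local Notation RT := (measurableTypeR R).
Local Notation lam := (@lebesgue_measure R).
Local Notation mu := (lebesgue_rV R n).
Local Notation e := (delta_mx ord0 i : 'rV[R]_n).

Lemma lip_mul (f g : R -> R) (kf kg Mf Mg a b : R) :
  (forall s, a <= s <= b -> `|f s| <= Mf) -> (forall s, a <= s <= b -> `|g s| <= Mg) ->
  (forall s t, a <= s <= b -> a <= t <= b -> `|f s - f t| <= kf * `|s - t|) ->
  (forall s t, a <= s <= b -> a <= t <= b -> `|g s - g t| <= kg * `|s - t|) ->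
  forall s t, a <= s <= b -> a <= t <= b ->
    `|f s * g s - f t * g t| <= (Mf * kg + kf * Mg) * `|s - t|.
Proof.
move=> fM gM fk gk s t sab tab.
have -> : f s * g s - f t * g t = f s * (g s - g t) + (f s - f t) * g t by ring.
rewrite (le_trans (ler_normD _ _))// [leRHS]mulrDl lerD// normrM.
  rewrite -mulrA; apply: ler_pM => //; [exact: fM|exact: gk].
by rewrite mulrAC; apply: ler_pM => //; [exact: fk|exact: gM].
Qed.

Lemma lip_bounded (f : R -> R) (k a b : R) : a <= b ->
  (forall s t, a <= s <= b -> a <= t <= b -> `|f s - f t| <= k * `|s - t|) ->
  forall s, a <= s <= b -> `|f s| <= `|f a| + `|k| * (b - a).
Proof.
move=> ab fk s sab; have aab : a <= a <= b by rewrite lexx.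
rewrite -(subrK (f a) (f s)) addrC (le_trans (ler_normD _ _))// lerD2l.
apply: le_trans (fk s a sab aab) _.
apply: le_trans (ler_wpM2r (normr_ge0 _) (ler_norm k)) _.
rewrite ler_wpM2l//; case/andP: sab => as_ sb.
by rewrite ger0_norm ?subr_ge0// lerD2r.
Qed.

(** The field component V is required to be Lipschitz only on the unit segment issued from almost
    every x, with a constant depending on x. This admits a field singular at the origin, where no
    uniform constant need exist. *)
Lemma integral_by_parts (k : R) (psi V W : 'rV[R]_n -> R) :
  measurable_fun setT psi -> lip_along i k psi ->
  measurable_fun setT V -> measurable_fun setT W ->
  {ae mu, forall x, (exists kx, forall s t : R, 0 <= s <= 1 -> 0 <= t <= 1 ->
      `|V (x + s *: e) - V (x + t *: e)| <= kx * `|s - t|) /\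
    (forall t : R, 0 < t < 1 -> is_derive (x + t *: e) e V (W (x + t *: e)))} ->
  mu.-integrable setT (fun x => (V x * psi x)%:E) ->
  mu.-integrable setT (fun x => (W x * psi x + V x * dpart i psi x)%:E) ->
  (\int[mu]_x (W x * psi x + V x * dpart i psi x)%:E = 0)%E.
Proof.
move=> mpsi psik mV mW HV i1 i2.
have mdp := measurable_dpart psik mpsi.
apply: (@integral_line_derivative _ _ i (fun x => V x * psi x)) => //.
move: HV; apply: ae_impl => x [[kx Vk] dV].
have psik' (s t : R) : 0 <= s <= 1 -> 0 <= t <= 1 ->
  `|psi (x + s *: e) - psi (x + t *: e)| <= k * `|s - t|.
  by move=> _ _; exact: psik.
pose f (t : R) := V (x + t *: e) * psi (x + t *: e).
have [||_ ->] := @lip_ftc _ f _ 0 1 ltr01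
    (@lip_mul (fun t => V (x + t *: e)) (fun t => psi (x + t *: e)) _ _ _ _ _ _
     (lip_bounded ler01 Vk) (lip_bounded ler01 psik') Vk psik')
   (fun t => W (x + t *: e) * psi (x + t *: e) + V (x + t *: e) * dpart i psi (x + t *: e)).
- have ml := measurable_line i x.
  apply: measurable_funS (measurableT) (@subsetT _ _) _.
  by apply: measurable_funD; apply: measurable_funM; apply: measurableT_comp ml.
- have : {ae lam, forall t, 0 < t < 1 -> derivable (fun t : R => psi (x + t *: e)) t 1}.
    exact: (@lip_ae_derivable _ _ k).
  apply: ae_impl => t H t01 _.
  have /derivableP/is_derive_line dpsi := H t01.
  have dd : dpart i psi (x + t *: e) = 'D_1 (fun t : R => psi (x + t *: e)) t.
    rewrite /dpart; case: asboolP => [_|]; last by case; case: dpsi.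
    by rewrite /partial; case: dpsi.
  have dV' := dV t t01.
  have D := derM dV' dpsi; rewrite -dd in D.
  have /is_derive_line D' := D.
  by have /is_derive1P[_ ->] := D'.
by rewrite /f scale1r scale0r addr0.
Qed.

End by_parts.

(** * Compactly supported Lipschitz functions *)

Section bounded_support.
Context (R : realType).

Definition box n (r : R) : set 'rV[R]_n :=
  [set x : 'rV[R]_n | forall i, - r <= x ord0 i <= r].

Lemma measurable_box n r : measurable (@box n r).
Proof.
rewrite (_ : box r = \bigcap_(i in [set: 'I_n])
  ((fun y : 'rV[R]_n => y ord0 i : measurableTypeR R) @^-1` `[- r, r])).
  apply: fin_bigcap_measurable => // i _.
  by rewrite -[X in measurable X]setTI; apply: measurable_coord => //; exact: measurable_itv.
by apply/seteqP; split => y /= H i => [_|]; have := H i; rewrite /= in_itv//; apply.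
Qed.

(** Boxes are products in the recursive construction of the measure. Comparison with them shows that
    Euclidean balls have finite and positive volume. *)
Lemma lebesgue_rV_box n (r : R) : 0 <= r ->
  lebesgue_rV R n (box r) = ((2 * r) ^+ n)%:E.
Proof.
move=> r0; elim: n => [|n IH].
  by rewrite /= diracE mem_set// => -[].
rewrite /= /cons_measure /pushforward.
have -> : cons_rV (n:=n) @^-1` (box r) =
    (`[- r, r]%classic : set (measurableTypeR R)) `*` box r.
  apply/seteqP; split => [[t y] /= H|[t y] [/= H1 H2] i].
    split=> [|j].
      have := H (lshift n (ord0 : 'I_1)); rewrite /cons_rV (@row_mxEl _ 1 1 n) mxE /=.
      by rewrite in_itv.
    by have := H (rshift 1 j); rewrite /cons_rV (@row_mxEr _ 1 1 n).
  rewrite /cons_rV; case: (@split_ordP 1 n i) => j ->.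
    by rewrite (@row_mxEl _ 1 1 n) mxE /=; move: H1; rewrite in_itv.
  by rewrite (@row_mxEr _ 1 1 n).
rewrite product_measure1E; [|exact: measurable_itv|exact: measurable_box].
have lr : lebesgue_measure (`[- r, r]%classic : set (measurableTypeR R)) = (2 * r)%:E.
  rewrite lebesgue_measure_itv /= lte_fin.
  have [rr|rr] := ltP (- r) r; first by rewrite -EFinB; congr (_%:E); ring.
  by congr (_%:E); lra.
transitivity ((2 * r)%:E * ((2 * r) ^+ n)%:E)%E; last by rewrite -EFinM exprS.
by congr (_ * _)%E; [exact: lr|exact: IH].
Qed.

Variable n : nat.
Local Notation mu := (lebesgue_rV R n).

Lemma lebesgue_eball_lty (r : R) : (mu (eball r) < +oo)%E.
Proof.
have [r0|r0] := leP 0 r; last first.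
  rewrite (_ : eball r = set0) ?measure0 ?ltry//.
  apply/seteqP; split => // x; rewrite /eball /= ltNge => /negP; apply.
  by rewrite (le_trans (ltW r0))// enorm_ge0.
apply: le_lt_trans (ltry ((2 * r) ^+ n)); rewrite -lebesgue_rV_box//.
apply: le_measure; rewrite ?inE; [exact: measurable_eball|exact: measurable_box|].
move=> x /= xr i; rewrite -ler_norml (le_trans (normr_coord_enorm x i))//.
exact: ltW.
Qed.

Lemma bounded_support_integrable (f : 'rV[R]_n -> R) (C M : R) :
  measurable_fun setT f -> (forall x, `|f x| <= C) ->
  (forall x, M <= enorm x -> f x = 0) -> mu.-integrable setT (EFin \o f).
Proof.
move=> mf fC f0.
have mE := @measurable_eball R n M.
have : mu.-integrable (eball M) (EFin \o f).
  apply: measurable_bounded_integrable => //; first exact: lebesgue_eball_lty.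
    exact: measurable_funS mf.
  exists C; split; first exact: num_real.
  by move=> c Cc x _ /=; rewrite (le_trans (fC x))// ltW.
rewrite (integrable_mkcond _ mE); congr (_.-integrable _ _).
apply/funext => x; rewrite patchE; case: ifPn => //; rewrite notin_setE /= => /negP.
by rewrite -leNgt => /f0 /= ->.
Qed.

Lemma bounded_support_Lfun (f : 'rV[R]_n -> R) (C M p : R) : 0 < p ->
  measurable_fun setT f -> (forall x, `|f x| <= C) ->
  (forall x, M <= enorm x -> f x = 0) -> f \in Lfun mu p%:E.
Proof.
move=> p0 mf fC f0; rewrite inE; apply/andP; split; rewrite inE//=.
rewrite /finite_norm unlock; apply: poweR_lty.
have : mu.-integrable setT (EFin \o (fun x => `|f x| `^ p)).
  apply: (@bounded_support_integrable _ (C `^ p) M).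
  - exact: (measurableT_comp (measurable_powR p)
      (measurableT_comp (@normr_measurable R setT) mf)).
  - move=> x; rewrite ger0_norm ?powR_ge0//; apply: ge0_ler_powR; rewrite ?nnegrE ?(ltW p0)//.
    by rewrite (le_trans _ (fC x)).
  - by move=> x /f0 ->; rewrite normr0 powR0// gt_eqF.
move=> /integrableP[_]; apply: le_lt_trans; rewrite le_eqVlt; apply/orP; left.
by apply/eqP; apply: eq_integral => x _ /=; rewrite [in RHS]ger0_norm ?powR_ge0.
Qed.

Lemma continuous_bounded_eball (f : 'rV[R]_n -> R) (M : R) : continuous f ->
  exists C, forall x, enorm x <= M -> `|f x| <= C.
Proof.
move=> cf; pose B := [set x : 'rV[R]_n | enorm x <= M].
have cB : compact B.
  apply: bounded_closed_compact.
    exists M; split; first exact: num_real.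
    move=> c Mc x /= xM; rewrite (le_trans (norm_le_enorm _))//.
    by rewrite (le_trans xM)// ltW.
  have /closed_comp := @closed_le R M; apply.
  by move=> x _; exact: enorm_continuous.
have : compact [set f x | x in B].
  by apply: continuous_compact => //; exact: continuous_subspaceT.
move=> /compact_bounded [C [_ HC]].
exists (C + 1) => x xB; apply: (HC (C + 1)); first by rewrite ltrDl.
by exists x.
Qed.

Lemma partial_eq0 (f : 'rV[R]_n -> R) (M : R) i x :
  (forall x, M < enorm x -> f x = 0) -> M < enorm x -> partial i f x = 0.
Proof.
move=> f0 Mx.
have H : {near x, (fun=> 0 : R) =1 f}.
  have : \forall y \near x, M < enorm y.
    by apply: (@cvgr_gt _ _ (nbhs x) _ _ _ (@enorm_continuous R n x)).
  by apply: filterS => y /f0.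
have d0 : (delta_mx ord0 i : 'rV[R]_n) != 0.
  by rewrite -enorm_gt0 enorm_delta.
have := der_near_eq H d0 (der_cst _ x _).
by case.
Qed.

Lemma closure_support (f : 'rV[R]_n -> R) (M : R) :
  (forall x, M < enorm x -> f x = 0) -> compactly_supported f.
Proof.
move=> f0; apply: bounded_closed_compact; last exact: closed_closure.
have cl : closed [set x : 'rV[R]_n | enorm x <= M].
  have /closed_comp := @closed_le R M; apply.
  by move=> x _; exact: enorm_continuous.
have sub : closure [set x | f x != 0] `<=` [set x | enorm x <= M].
  rewrite [X in _ `<=` X](closure_id _).1//; apply: closure_subset => x /= fx;
    rewrite leNgt; apply: contra fx => /f0 ->.
  by rewrite eqxx.
exists M; split; first exact: num_real.
move=> c Mc x /sub /= xM; rewrite (le_trans (norm_le_enorm _))//.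
by rewrite (le_trans xM)// ltW.
Qed.

Lemma C1_lip (g g' : R -> R) (a b : R) : a < b ->
  (forall t : R, is_derive t 1 g (g' t)) -> continuous g' ->
  exists k, forall s t, a <= s <= b -> a <= t <= b -> `|g s - g t| <= k * `|s - t|.
Proof.
move=> ab dg cg'.
have cg : continuous g by move=> t; exact: is_derive1_continuous (dg t).
have cn : continuous (fun t => `|g' t|) by move=> t; apply: cvg_norm; exact: cg'.
have [c _ Hc] := @EVT_max R (fun t => `|g' t|) a b (ltW ab) (continuous_subspaceT cn).
exists `|g' c|.
have main s t : s <= t -> a <= s <= b -> a <= t <= b -> `|g s - g t| <= `|g' c| * `|s - t|.
  move=> st /andP[as_ sb] /andP[at_ tb].
  have [r rst] := @MVT_segment R g g' s t st (fun x _ => dg x) (continuous_subspaceT cg).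
  rewrite distrC => ->; rewrite normrM (distrC s) ler_wpM2r//; apply: Hc.
  move: rst; rewrite !in_itv/= => /andP[sr rt].
  by rewrite (le_trans as_ sr) (le_trans rt tb).
move=> s t; case: (leP s t) => [/main//|/ltW ts sab tab].
by rewrite distrC (distrC s); exact: main.
Qed.

End bounded_support.

Section admissibility.
Context (R : realType) (n : nat).
Local Notation mu := (lebesgue_rV R n).
Implicit Types (f psi : 'rV[R]_n -> R) (k M : R).

Lemma lipschitzP f : lipschitz f <-> exists k, forall x y, `|f x - f y| <= k * `|x - y|.
Proof.
split=> [[k [_ Hk]]|[k Hk]].
  exists (k + 1) => x y.
  have /Hk : k < k + 1 by rewrite ltrDl.
  by move=> /(_ (x, y)); apply.
exists k; split; first exact: num_real.
by move=> c /ltW kc [x y] _ /=; apply: le_trans (Hk x y) _; rewrite ler_wpM2r.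
Qed.

Section lip.
Variables (k : R) (psi : 'rV[R]_n -> R).
Hypothesis psik : forall x y, `|psi x - psi y| <= k * `|x - y|.

Lemma lip_rV_continuous : continuous psi.
Proof.
move=> x; apply/(@cvgrPdist_le _ _ _ (nbhs x)) => d d0.
have k0 : 0 < `|k| + 1 by rewrite ltr_wpDl.
have : \forall y \near x, `|x - y| <= d / (`|k| + 1).
  by apply: (@cvgr_dist_le _ _ _ (nbhs x)) => //; rewrite divr_gt0.
apply: filterS => y; rewrite ler_pdivlMr// mulrC => xy.
apply: le_trans (psik _ _) _; apply: le_trans xy; rewrite ler_wpM2r//.
by rewrite (le_trans (ler_norm k))// lerDl.
Qed.

Lemma lip_rV_measurable : measurable_fun setT psi.
Proof. by apply: continuous_measurable_rV; exact: lip_rV_continuous. Qed.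

Lemma lip_rV_along i : lip_along i `|k| psi.
Proof.
move=> x s t; apply: le_trans (psik _ _) _.
apply: le_trans (ler_wpM2r (normr_ge0 _) (ler_norm k)) _; rewrite ler_wpM2l//.
have -> : x + s *: delta_mx ord0 i - (x + t *: delta_mx ord0 i) =
    (s - t) *: delta_mx ord0 i by rewrite scalerBl opprD addrACA subrr add0r.
apply: le_trans (norm_le_enorm _) _.
by rewrite enormZ enorm_delta mulr1.
Qed.

End lip.

Lemma C1_along_lip (V W : 'rV[R]_n -> R) i (x : 'rV[R]_n) :
  (forall y, is_derive y (delta_mx ord0 i) V (W y)) -> continuous W ->
  exists kx, forall s t : R, 0 <= s <= 1 -> 0 <= t <= 1 ->
    `|V (x + s *: delta_mx ord0 i) - V (x + t *: delta_mx ord0 i)| <= kx * `|s - t|.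
Proof.
move=> dV cW.
apply: (@C1_lip R (fun t => V (x + t *: delta_mx ord0 i)) (fun t =>
  W (x + t *: delta_mx ord0 i)) 0 1) => //.
  move=> t; have := dV (x + t *: delta_mx ord0 i).
  by move=> /(iffLR (@is_derive_line R _ V x (delta_mx ord0 i) t _)).
move=> t; apply: (@continuous_comp _ _ _ (fun t : R => x + t *: delta_mx ord0 i) W);
  last exact: cW.
apply: (@cvgD _ _ _ (nbhs t)); first exact: cvg_cst.
by apply: (@cvgZr_tmp _ _ _ (nbhs t)).
Qed.

(** The weak gradient is [dpart]: in the integration by parts the smooth function plays the part of
    the field and psi that of the Lipschitz factor, whose bounded support makes all the products
    integrable. *)
Lemma compact_lip_admissible k M psi : (3 <= n)%N ->
  (forall x y, `|psi x - psi y| <= k * `|x - y|) ->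
  (forall x, M < enorm x -> psi x = 0) ->
  {ae mu, forall x, enorm (grad psi x) ^+ 2 <= 1} ->
  admissible psi.
Proof.
move=> n3 psik psi0 gpsi.
have cpsi := lip_rV_continuous psik.
have mpsi := lip_rV_measurable psik.
have psi0' x : M + 1 <= enorm x -> psi x = 0.
  by move=> Mx; apply: psi0; rewrite (lt_le_trans _ Mx)// ltrDl.
have [C psiC] : exists C, forall x, `|psi x| <= C.
  have [C HC] := continuous_bounded_eball M cpsi.
  exists (Num.max C 0) => x; rewrite le_max; case: (leP (enorm x) M) => [/HC ->//|/psi0 ->].
  by rewrite normr0 lexx orbT.
have d0 i x : M + 1 <= enorm x -> dpart i psi x = 0.
  move=> Mx; rewrite /dpart; case: asboolP => // _; apply: partial_eq0 psi0 _.
  by rewrite (lt_le_trans _ Mx)// ltrDl.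
have dk i x : `|dpart i psi x| <= `| `|k| | by apply: dpart_bound; exact: lip_rV_along.
have md i : measurable_fun setT (dpart i psi).
  exact: measurable_dpart (lip_rV_along psik i) mpsi.
split; [split|by apply/lipschitzP; exists k|exact: gpsi].
- apply: bounded_support_Lfun mpsi psiC psi0'.
  have n2 : 2 < n%:R :> R by rewrite ltr_nat.
  by rewrite divr_gt0 ?subr_gt0// mulr_gt0// (lt_trans _ n2).
- exists (fun i => dpart i psi); split; last first.
    by move=> i; apply: bounded_support_Lfun (dk i) (d0 i).
  move=> eta [eta_C _] i.
  have ceta : continuous eta by have [H _] := eta_C 0%N [::]; exact: (H isT).
  have deta y : is_derive y (delta_mx ord0 i) eta (partial i eta y).
    by have [_ H] := eta_C 1%N [::]; exact: derivableP (H isT y i).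
  have cdeta : continuous (partial i eta).
    by have [H _] := eta_C 1%N [:: i]; exact: (H isT).
  have [C1 HC1] := continuous_bounded_eball (M + 1) ceta.
  have [C2 HC2] := continuous_bounded_eball (M + 1) cdeta.
  have meta : measurable_fun setT eta by exact: continuous_measurable_rV.
  have mdeta : measurable_fun setT (partial i eta) by exact: continuous_measurable_rV.
  have bd (g h : 'rV[R]_n -> R) Cg Ch : (forall x, enorm x <= M + 1 -> `|g x| <= Cg) ->
      (forall x, `|h x| <= Ch) -> (forall x, M + 1 <= enorm x -> h x = 0) ->
      measurable_fun setT g -> measurable_fun setT h ->
      mu.-integrable setT (EFin \o (fun x => g x * h x)).
    move=> gC hC h0 mg mh.
    apply: (@bounded_support_integrable _ _ _ (Num.max Cg 0 * Num.max Ch 0) (M + 1)).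
    - exact: measurable_funM.
    - move=> x; rewrite normrM; case: (leP (enorm x) (M + 1)) => xM.
        by apply: ler_pM => //; rewrite le_max ?gC ?hC.
      by rewrite (h0 _ (ltW xM)) normr0 mulr0 mulr_ge0// le_max lexx orbT.
    - by move=> x /h0 ->; rewrite mulr0.
  have i1 := bd _ _ _ _ HC2 psiC psi0' mdeta mpsi.
  have i2 := bd _ _ _ _ HC1 (dk i) (d0 i) meta (md i).
  have i3 := bd _ _ _ _ HC1 psiC psi0' meta mpsi.
  have IBP := @integral_by_parts R n i `|k| psi eta (partial i eta) mpsi
    (lip_rV_along psik i) meta mdeta
    (aeW _ (fun x => conj (C1_along_lip x deta cdeta) (fun t _ => deta _))) i3
    (integrableD measurableT i1 i2).
  have {}IBP : (\int[mu]_x (partial i eta x * psi x)%:E +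
      \int[mu]_x (eta x * dpart i psi x)%:E = 0)%E.
    by rewrite -(integralD measurableT i1 i2).
  rewrite /Rintegral -fineN.
  under eq_integral do rewrite mulrC.
  under [in RHS]eq_integral do rewrite mulrC.
  rewrite fineN; move: IBP.
  rewrite -(fineK (integrable_fin_num measurableT i1)).
  rewrite -(fineK (integrable_fin_num measurableT i2)) -EFinD => -[] /eqP.
  by rewrite addr_eq0 => /eqP.
Qed.

End admissibility.

(** * Polar coordinates *)

Section density.
Context d (T : measurableType d) (R : realType).
Variables (mu m : {measure set T -> \bar R}) (w : T -> \bar R).
Hypotheses (mw : measurable_fun setT w) (w0 : forall x, (0 <= w x)%E).
Hypothesis wfin : forall x, w x \is a fin_num.
Hypothesis mE : forall A, measurable A -> m A = (\int[mu]_(x in A) w x)%E.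

Import HBNNSimple.

(** The identity holds for indicators by [mE], for simple functions by additivity, and in general by
    monotone convergence on both sides. *)
Lemma ge0_integral_density (f : T -> \bar R) :
  measurable_fun setT f -> (forall x, 0 <= f x)%E ->
  (\int[m]_x f x = \int[mu]_x (f x * w x))%E.
Proof.
move=> mf f0.
pose f_ := nnsfun_approx measurableT mf.
transitivity (limn (fun n => \int[m]_x (f_ n x)%:E))%E.
  rewrite -monotone_convergence//.
  - by apply: eq_integral => y _; apply/esym/cvg_lim => //; exact: cvg_nnsfun_approx.
  - by move=> n; exact/measurable_EFinP.
  - by move=> n y _; rewrite lee_fin.
  - by move=> y _ k n kn; rewrite lee_fin; exact/lefP/nd_nnsfun_approx.
transitivity (limn (fun n => \int[mu]_x ((f_ n x)%:E * w x)))%E; last first.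
  rewrite -monotone_convergence//.
  - apply: eq_integral => y _; apply/cvg_lim => //.
    by apply: cvgeZr; [exact: wfin|exact: cvg_nnsfun_approx].
  - by move=> n; apply: emeasurable_funM => //; exact/measurable_EFinP.
  - by move=> n y _; rewrite mule_ge0// lee_fin.
  - by move=> y _ k n kn; rewrite lee_wpmul2r// lee_fin; exact/lefP/nd_nnsfun_approx.
congr (limn _); apply/funext => n.
transitivity (\sum_(k \in range (f_ n)) \int[m]_x (k * \1_(f_ n @^-1` [set k]) x)%:E)%E.
  under eq_integral do rewrite fimfunE -fsumEFin//.
  rewrite ge0_integral_fsum//.
  - by move=> y; exact/measurable_EFinP/measurable_funM.
  - by move=> y x _; rewrite nnfun_muleindic_ge0.
transitivity (\sum_(k \in range (f_ n)) \int[mu]_x ((k * \1_(f_ n @^-1` [set k]) x)%:E * w x))%E.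
  apply: eq_fsbigr => r; rewrite inE => -[x0 _ fr].
  have r0 : 0 <= r by rewrite -fr.
  have mr : measurable (f_ n @^-1` [set r]) by exact: measurable_sfunP.
  under eq_integral do rewrite EFinM.
  rewrite ge0_integralZl//; [|exact/measurable_EFinP/measurable_indic].
  rewrite integral_indic// setIT mE//.
  rewrite integral_mkcond -ge0_integralZl//.
  - apply: eq_integral => x _; rewrite EFinM -muleA; congr (_ * _)%E.
    by rewrite epatch_indic muleC.
  - exact/(measurable_restrictT _ _).1/measurable_funTS.
  - by move=> x _; rewrite patchE; case: ifP.
rewrite -ge0_integral_fsum//.
- apply: eq_integral => x _; rewrite [in RHS]fimfunE -fsumEFin// ge0_mule_fsuml//.
  by move=> k; rewrite nnfun_muleindic_ge0.
- move=> y; apply: emeasurable_funM => //.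
  by apply/measurable_EFinP; apply: measurable_funM.
- by move=> y x _; rewrite mule_ge0// nnfun_muleindic_ge0.
Qed.

End density.

Section polar.
Context (R : realType) (n : nat).
Local Notation N := n.+2.
Local Notation mu := (lebesgue_rV R N).
Local Notation RT := (measurableTypeR R).
Local Notation lam := (@lebesgue_measure R).

Lemma measurable_enormRT :
  measurable_fun [set: 'rV[R]_N] ((@enorm R N) : 'rV[R]_N -> RT).
Proof. exact: measurable_enorm. Qed.

Definition cball (r : R) : set 'rV[R]_N := [set x | enorm x <= r].

Lemma measurable_cball r : measurable (cball r).
Proof.
have := measurable_enorm (n := N) measurableT (measurable_itv `]-oo, r]).
by rewrite setTI; congr measurable; apply/seteqP; split => x /=; rewrite in_itv.
Qed.

Lemma cball_lty r : (mu (cball r) < +oo)%E.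
Proof.
apply: le_lt_trans (lebesgue_eball_lty N (r + 1)).
apply: le_measure; rewrite ?inE; [exact: measurable_cball|exact: measurable_eball|].
by move=> x /= xr; rewrite /eball /= (le_lt_trans xr)// ltrDl.
Qed.

Definition ball_volume : R := fine (mu (cball 1)).

Lemma ball_volumeE : mu (cball 1) = ball_volume%:E.
Proof. by rewrite fineK// ge0_fin_numE// cball_lty. Qed.

Lemma ball_volume_gt0 : 0 < ball_volume.
Proof.
rewrite -lte_fin -ball_volumeE.
have d0 : 0 < (N%:R^-1 : R) by rewrite invr_gt0.
apply: (@lt_le_trans _ _ (mu (box N%:R^-1))).
  by rewrite lebesgue_rV_box ?(ltW d0)// lte_fin exprn_gt0// mulr_gt0.
apply: le_measure; rewrite ?inE; [exact: measurable_box|exact: measurable_cball|].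
move=> x /= Hx; rewrite /cball /= (le_trans (enorm_le_sum x))//.
apply: (@le_trans _ _ (\sum_(i < N) N%:R^-1)).
  by apply: ler_sum => i _; rewrite ler_norml.
by rewrite sumr_const card_ord -[leLHS]mulr_natr mulVf// pnatr_eq0.
Qed.

(** The volume of the ball of radius r; its derivative [polar_weight] is the area of the sphere. The
    maximum with 0 extends it to a nondecreasing C^1 function on the whole line, from which a
    Stieltjes measure is built. *)
Definition ball_cumul (r : R) : R := ball_volume * Num.max r 0 ^+ N.
Definition polar_weight (r : R) : R := ball_volume * (N%:R * Num.max r 0 ^+ n.+1).

Local Notation Phi := ball_cumul.
Local Notation w := polar_weight.

Let dPhi (t : R) : is_derive t 1 Phi (w t).
Proof.
apply: derZ.
have [t0|t0|t0] := ltgtP t 0.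
- have H : {near t, (fun=> 0 : R) =1 (fun y : R => Num.max y 0 ^+ N)}.
    have : \forall y \near t, y < 0 by exact: lt_nbhsl.
    by apply: filterS => y y0; rewrite max_r ?expr0n// ltW.
  have -> : N%:R * 0 ^+ n.+1 = 0 :> R by rewrite expr0n /= mulr0.
  by apply: der_near_eq H _ (der_cst _ _ _); exact: oner_neq0.
- have H : {near t, (fun y : R => y ^+ N) =1 (fun y : R => Num.max y 0 ^+ N)}.
    have : \forall y \near t, 0 < y by exact: lt_nbhsr.
    by apply: filterS => y y0; rewrite max_l// ltW.
  apply: der_near_eq H _ _; first exact: oner_neq0.
  by have := derX n.+1 (der_id t); rewrite mulr1.
- rewrite t0 expr0n /= mulr0; apply: is_derive1_remainder => e e0.
  have : \forall y \near (0 : R), `|y| < Num.min e 1.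
    by apply: nbhs0_lt; rewrite lt_min e0 ltr01.
  apply: filterS => y; rewrite lt_min => /andP[ye y1].
  rewrite maxxx expr0n !subr0 mul0r subr0.
  have [y0|y0] := leP y 0; first by rewrite expr0n normr0 mulr_ge0// ltW.
  rewrite normrX exprS [leLHS]mulrC ler_wpM2r//.
  by rewrite exprS (le_trans _ (ltW ye))// ler_piMr// exprn_ile1// ltW.
Qed.

Let w_cont : continuous w.
Proof.
move=> t; apply: (@cvgM _ _ (nbhs t)); first exact: cvg_cst.
apply: (@cvgM _ _ (nbhs t)); first exact: cvg_cst.
have mc : continuous (fun r : R => Num.max r 0).
  apply: (@klip_continuous _ _ 1) => x y; rewrite mul1r.
  have h1 := ler_norm (x - y); have := ler_norm (y - x); rewrite (distrC y) => h2.
  by have := normr_ge0 (x - y); case: (leP x 0) => ?; case: (leP y 0) => ?;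
    rewrite ler_norml; lra.
apply: (@continuous_comp _ _ _ (fun r : R => Num.max r 0) (fun r => r ^+ n.+1));
  [exact: mc|exact: exprn_continuous].
Qed.

Let w0 r : 0 <= w r.
Proof.
apply: mulr_ge0; first by rewrite ltW// ball_volume_gt0.
by apply: mulr_ge0 => //; apply: exprn_ge0; rewrite le_max lexx orbT.
Qed.

Let Phi_nd : {homo Phi : x y / x <= y}.
Proof.
move=> x y xy; rewrite /ball_cumul ler_pM2l ?ball_volume_gt0//.
apply: lerXn2r; rewrite ?nnegrE; [by rewrite le_max lexx orbT|by rewrite le_max lexx orbT|].
by rewrite ge_max !le_max xy lexx orbT.
Qed.

Let Phi_cont : continuous Phi.
Proof. by move=> t; exact: is_derive1_continuous (dPhi t). Qed.

(** For r > 0 the ball is a dilate of the unit ball. For r <= 0 it lies in every ball of positive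
    radius, and their volumes tend to 0. *)
Lemma mu_cball r : mu (cball r) = (Phi r)%:E.
Proof.
have pos s : 0 < s -> mu (cball s) = (ball_volume * s ^+ N)%:E.
  move=> s0.
  have si0 : 0 < s^-1 by rewrite invr_gt0.
  have := lebesgue_rV_affine (0 : 'rV[R]_N) si0 (measurable_cball 1).
  rewrite exprVn invrK ball_volumeE -EFinM mulrC => <-; congr (mu _).
  apply/seteqP; split => x; rewrite /cball /= addr0 enormZ gtr0_norm//.
    by rewrite mulrC ler_pdivrMr// mul1r.
  by rewrite mulrC ler_pdivrMr// mul1r.
have [r0|r0] := ltP 0 r; first by rewrite pos// /ball_cumul max_l// ltW.
rewrite /ball_cumul max_r// expr0n mulr0; apply/eqP; rewrite -measure_le0.
apply/lee_addgt0Pr => e e0; rewrite add0e.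
pose s := Num.min 1 (e / ball_volume).
have s0 : 0 < s by rewrite lt_min ltr01 divr_gt0// ball_volume_gt0.
apply: (@le_trans _ _ (mu (cball s))).
  apply: le_measure; rewrite ?inE; [exact: measurable_cball|exact: measurable_cball|].
  by move=> x /= xr; rewrite /cball /= (le_trans xr)// (le_trans r0)// ltW.
rewrite pos// lee_fin mulrC -ler_pdivlMr ?ball_volume_gt0//.
apply: (@le_trans _ _ s); last by rewrite ge_min lexx orbT.
by rewrite exprS ler_piMr ?(ltW s0)// exprn_ile1 ?(ltW s0)// ge_min lexx.
Qed.

(** The image of the measure under the norm and the measure of density [polar_weight] both agree on
    the intervals ]a, b] with the Stieltjes measure of [ball_cumul]: the first by volumes of balls,
    the second by the fundamental theorem of calculus. *)
Lemma polar_measure (A : set RT) : measurable A ->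
  mu (@enorm R N @^-1` A) = (\int[lam]_(r in A) (w r)%:E)%E.
Proof.
have mwE : measurable_fun [set: RT] (EFin \o w).
  by apply/measurable_EFinP; apply: continuous_measurable_fun; exact: w_cont.
have mden : exists D : {measure set RT -> \bar R}, forall B, D B =
  (\int[lam]_(r in B) (w r)%:E)%E.
  have D0 : (fun A : set RT => \int[lam]_(r in A) (w r)%:E)%E set0 = 0%E by rewrite integral_set0.
  have Dge0 B : (0 <= (fun A : set RT => \int[lam]_(r in A) (w r)%:E)%E B)%E.
    by apply: integral_ge0 => r _; rewrite lee_fin.
  have Dsig := @semi_sigma_additive_nng_induced _ _ _ lam (EFin \o w) mwE (fun r => w0 r).
  pose D' := isMeasure.Build _ _ _ (fun A : set RT => \int[lam]_(r in A) (w r)%:E)%E D0 Dge0 Dsig.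
  pose D : {measure set RT -> \bar R} := HB.pack (fun A : set RT =>
    \int[lam]_(r in A) (w r)%:E)%E D'.
  by exists D.
have [D DE] := mden.
have [P PE] := pushforward_measureE mu measurable_enormRT.
move=> mA; rewrite -DE -PE.
have [c cE] := ndecr_cumulative Phi_nd Phi_cont.
have LSE x y : x <= y -> lebesgue_stieltjes_measure c `]x, y] = (Phi y - Phi x)%:E.
  move=> xy; rewrite /lebesgue_stieltjes_measure /measure_extension measurable_mu_extE/=;
    last exact: is_ocitv.
  by rewrite wlength_itv_bnd// !cE.
have HP : forall X, ocitv X -> lebesgue_stieltjes_measure c X = P X.
  move=> X /ocitvP[->|[[a b] /= ab ->]]; first by rewrite !measure0.
  rewrite LSE ?ltW// PE EFinB -!mu_cball.
  rewrite -[X in (X - _)%E](_ : (mu (cball a) + mu (@enorm R N @^-1` `]a, b])) = _)%E; last first.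
    rewrite -measureU; [|exact: measurable_cball| |].
    - congr (mu _); apply/seteqP; split => x /=; rewrite /cball /= in_itv/=.
        by case=> [xa|/andP[]//]; rewrite (le_trans xa)// ltW.
      by move=> xb; case: (leP (enorm x) a) => xa; [left|right; rewrite xb].
    - by rewrite -[X in measurable X]setTI; apply: measurable_enorm => //; exact: measurable_itv.
    - by apply/seteqP; split => // x /=; rewrite /cball /= in_itv/= =>
        -[] /le_lt_trans h /andP[/h]; rewrite ltxx.
  by rewrite addeAC subee ?add0e// ge0_fin_numE// cball_lty.
have HD : forall X, ocitv X -> lebesgue_stieltjes_measure c X = D X.
  move=> X /ocitvP[->|[[a b] /= ab ->]]; first by rewrite !measure0.
  rewrite LSE ?ltW// DE.
  have [k Hk] := C1_lip ab dPhi w_cont.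
  have [||_ <-] := @lip_ftc _ Phi k a b ab Hk w.
  - by apply: measurable_funS (measurableT) (@subsetT _ _) _; exact/measurable_EFinP.
  - by apply: aeW => t _ _; have /is_derive1P[] := dPhi t.
  rewrite integral_itv_obnd_cbnd//.
  by apply: measurable_funS (measurableT) (@subsetT _ _) mwE.
by rewrite -(lebesgue_stieltjes_measure_unique HP mA) (lebesgue_stieltjes_measure_unique HD mA).
Qed.

Lemma ge0_integral_polar (f : R -> \bar R) :
  measurable_fun [set: RT] f -> (forall r, 0 <= f r)%E ->
  (\int[mu]_x f (enorm x) = \int[lam]_r (f r * (w r)%:E))%E.
Proof.
move=> mf f0.
have [P PE] := pushforward_measureE mu measurable_enormRT.
rewrite -(@ge0_integral_density _ _ _ lam P (EFin \o w))//.
- transitivity (\int[pushforward mu (@enorm R N : _ -> RT)]_r f r)%E.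
    rewrite (ge0_integral_pushforward measurable_enormRT)//.
  apply: eq_measure_integral; first exact: measurable_enormRT.
  by move=> ? A mA _; rewrite PE.
- by apply/measurable_EFinP; apply: continuous_measurable_fun; exact: w_cont.
- by move=> A mA; rewrite PE; exact: polar_measure.
Qed.

End polar.

(** * Inversion of the flux function *)

Section flux_inverse.
Context (R : realType) (L : R -> R).
Hypothesis HL : singular_lagrangian L.
Local Notation b := (lag_b L).
Local Notation db := (derive_in (@lag_dom R) (lag_b L)).

(* [b] is prolonged affinely below [0] so that it becomes C^1 around [0]. *)
Let bt (s : R) : R := if s < 0 then 1 + db 0 * s else b s.
Let dbt (s : R) : R := if s < 0 then db 0 else db s.

Let domP (s : R) : lag_dom s = (0 <= s < 2^-1) :> Prop.
Proof. by rewrite /lag_dom /= in_itv. Qed.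

Let db_near (s e : R) : 0 <= s < 2^-1 -> 0 < e ->
  \forall y \near s, 0 <= y < 2^-1 -> `|b y - b s - db s * (y - s)| <= e * `|y - s|.
Proof.
move=> sd e0; have Ds : lag_dom s by rewrite domP.
have /cvgrPdist_le /(_ _ e0) := lag_b_derivable HL Ds.
rewrite near_withinE; apply: filterS => y Hy yd.
have [->|ys] := eqVneq y s; first by rewrite !subrr mulr0 subrr normr0 mulr0.
have ys0 : y - s != 0 by rewrite subr_eq0.
have nys : y <> s by apply/eqP.
have Dy : lag_dom y by rewrite domP.
have h := Hy (conj Dy nys).
have -> : b y - b s - db s * (y - s) = ((b y - b s) / (y - s) - db s) * (y - s).
  by rewrite mulrBl divfK.
by rewrite normrM ler_wpM2r// distrC.
Qed.

Let bt_ge0 s : 0 <= s -> bt s = b s.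
Proof. by move=> s0; rewrite /bt ltNge s0. Qed.

Let dbt_der (s : R) : s < 2^-1 -> is_derive s 1 bt (dbt s).
Proof.
move=> s2; have y2 : \forall y \near s, y < 2^-1 by exact: lt_nbhsl.
rewrite /dbt; have [s0|s0|s0] := ltgtP s 0.
- have H : {near s, (fun y => 1 + db 0 * y) =1 bt}.
    have : \forall y \near s, y < 0 by exact: lt_nbhsl.
    by apply: filterS => y y0; rewrite /bt y0.
  apply: der_near_eq H _ _; first exact: oner_neq0.
  by rewrite -[X in is_derive _ _ _ X]add0r; apply: derD; exact: der_lin.
- apply: is_derive1_remainder => e e0.
  have sd : 0 <= s < 2^-1 by rewrite (ltW s0).
  have y0 : \forall y \near s, 0 < y by exact: lt_nbhsr.
  move: y2 y0 (db_near sd e0); apply: filterS3 => y y2 y0 Hy.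
  by rewrite !bt_ge0 ?(ltW y0) ?(ltW s0)//; apply: Hy; rewrite y2 ltW.
- apply: is_derive1_remainder => e e0; subst s.
  have sd : 0 <= (0 : R) < 2^-1 by rewrite lexx.
  move: y2 (db_near sd e0); apply: filterS2 => y y2 Hy.
  rewrite /bt ltxx (lag_b_0 HL); case: ltP => y0.
    by rewrite subr0 (addrC 1) addrK subrr normr0 mulr_ge0// ltW.
  by have := Hy _; rewrite (lag_b_0 HL); apply; rewrite y0 y2.
Qed.

Let dbt_cont (s : R) : s < 2^-1 -> {for s, continuous dbt}.
Proof.
move=> s2; have y2 : \forall y \near s, y < 2^-1 by exact: lt_nbhsl.
apply/(@cvgrPdist_le _ _ _ (nbhs s)) => e e0.
have cd := (subspace_continuousP _ _).1 (lag_db_continuous HL).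
have near_s : 0 <= s -> \forall y \near s, 0 <= y < 2^-1 -> `|db s - db y| <= e.
  move=> s0; have sd : lag_dom s by rewrite domP s0.
  have /cvgrPdist_le /(_ _ e0) := cd s sd.
  by rewrite near_withinE; apply: filterS => y Hy yd; apply: Hy; rewrite domP.
rewrite /dbt; have [s0|s0|s0] := ltgtP s 0.
- have : \forall y \near s, y < 0 by exact: lt_nbhsl.
  by apply: filterS => y y0; rewrite y0 subrr normr0 ltW.
- have y0 : \forall y \near s, 0 < y by exact: lt_nbhsr.
  move: y2 y0 (near_s (ltW s0)); apply: filterS3 => y y2 y0 Hy.
  by rewrite ltNge (ltW y0) /=; apply: Hy; rewrite y2 ltW.
- subst s; move: y2 (near_s (lexx _)); apply: filterS2 => y y2 Hy.
  by case: ltP => y0; [rewrite subrr normr0 ltW|rewrite Hy// y0 y2].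
Qed.

Let dbt_gt0 s : s < 2^-1 -> 0 < dbt s.
Proof.
move=> s2.
have D (r : R) : 0 <= r < 2^-1 -> 0 < db r by rewrite -domP => /(lag_db_gt0 HL).
rewrite /dbt; case: (ltP s 0) => s0; apply: D; rewrite ?s0 ?s2//.
by rewrite lexx invr_gt0 ltr0n.
Qed.

Lemma lag_b_ndecr s t : 0 <= s -> s <= t -> t < 2^-1 -> b s <= b t.
Proof.
move=> s0 st t2; have t0 := le_trans s0 st.
rewrite -!bt_ge0//; rewrite -subr_ge0.
have [||c cst ->] := @MVT_segment R bt dbt s t st.
- move=> x; rewrite in_itv/= => /andP[_ xt]; apply: dbt_der; exact: lt_trans t2.
- apply: continuous_in_subspaceT => x; rewrite inE/= in_itv/= => /andP[_ xt].
  by apply: is_derive1_continuous; apply: dbt_der; exact: le_lt_trans t2.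
rewrite mulr_ge0 ?subr_ge0// ltW// dbt_gt0//.
by move: cst; rewrite in_itv/= => /andP[_ ct]; exact: le_lt_trans t2.
Qed.

Lemma lag_b_ge1 s : 0 <= s < 2^-1 -> 1 <= b s.
Proof. by move=> /andP[s0 s2]; rewrite -(lag_b_0 HL) lag_b_ndecr. Qed.

Definition lag_flux (t : R) : R := b (t ^+ 2 / 2) * t.

Let half_sqr (t : R) : `|t| < 1 -> t ^+ 2 / 2 < 2^-1.
Proof.
move=> t1; rewrite -[ltRHS]mul1r ltr_pM2r ?invr_gt0//.
by rewrite -real_normK ?num_real// exprn_ilt1.
Qed.

Let sqr2_ge0 (t : R) : 0 <= t ^+ 2 / 2.
Proof. by rewrite divr_ge0// sqr_ge0. Qed.

Let dflux (t : R) : R := dbt (t ^+ 2 / 2) * t ^+ 2 + bt (t ^+ 2 / 2).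

Let sqr_der (t : R) : is_derive t 1 (fun y : R => y ^+ 2 / 2) t.
Proof.
have := derZ 2^-1 (derX 1 (der_id t)); rewrite expr1 mulr1 mulrA mulVf ?pnatr_eq0// mul1r.
by under [X in is_derive _ _ X _]eq_fun do rewrite mulrC.
Qed.

Let flux_der (t : R) : `|t| < 1 -> is_derive t 1 lag_flux (dflux t).
Proof.
move=> t1.
have -> : lag_flux = (fun t => bt (t ^+ 2 / 2) * t).
  by apply/funext => y; rewrite /lag_flux bt_ge0.
have D := @der_comp R R bt (fun y : R => y ^+ 2 / 2) t 1 _ _ (dbt_der (half_sqr t1)) (sqr_der t).
have := derM D (der_id t).
by rewrite mulr1 -mulrA -expr2.
Qed.

Let dflux_gt0 (t : R) : `|t| < 1 -> 0 < dflux t.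
Proof.
move=> t1; have h := half_sqr t1; rewrite /dflux ltr_wpDl//.
  by rewrite mulr_ge0 ?sqr_ge0// ltW// dbt_gt0.
by rewrite bt_ge0// (lt_le_trans ltr01)// lag_b_ge1// sqr2_ge0.
Qed.

Let dflux_cont (t : R) : `|t| < 1 -> {for t, continuous dflux}.
Proof.
move=> t1; have h := half_sqr t1.
have cs := is_derive1_continuous (sqr_der t).
have cbt := is_derive1_continuous (dbt_der h).
apply: (@cvgD _ _ _ (nbhs t)).
  apply: (@cvgM _ _ (nbhs t)); last exact: exprn_continuous.
  exact: (@continuous_comp _ _ _ (fun y : R => y ^+ 2 / 2) dbt t cs (dbt_cont h)).
exact: (@continuous_comp _ _ _ (fun y : R => y ^+ 2 / 2) bt t cs cbt).
Qed.

Let flux_lt (s t : R) : `|s| < 1 -> `|t| < 1 -> s < t -> lag_flux s < lag_flux t.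
Proof.
rewrite !ltr_norml => /andP[s1 s2] /andP[t1 t2] st; rewrite -subr_gt0.
have in1 x : s <= x <= t -> `|x| < 1.
  by move=> /andP[sx xt]; rewrite ltr_norml (lt_le_trans s1 sx) (le_lt_trans xt t2).
have [||c cst ->] := @MVT_segment R lag_flux dflux s t (ltW st).
- move=> x; rewrite in_itv/= => /andP[sx xt]; apply: flux_der; apply: in1.
  by rewrite !ltW.
- apply: continuous_in_subspaceT => x; rewrite inE/= in_itv/= => /in1 x1.
  exact: is_derive1_continuous (flux_der x1).
by rewrite mulr_gt0 ?subr_gt0// dflux_gt0// in1.
Qed.

Lemma lag_flux_inj (s t : R) : `|s| < 1 -> `|t| < 1 -> lag_flux s = lag_flux t -> s = t.
Proof.
move=> s1 t1 st; case: (ltgtP s t) => // h.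
  by have := flux_lt s1 t1 h; rewrite st ltxx.
by have := flux_lt t1 s1 h; rewrite st ltxx.
Qed.

Lemma lag_fluxN t : lag_flux (- t) = - lag_flux t.
Proof. by rewrite /lag_flux sqrrN mulrN. Qed.

Let flux_surj_ge0 (y : R) : 0 <= y -> exists t, `|t| < 1 /\ lag_flux t = y.
Proof.
move=> y0.
(* For t = sqrt (2 s), the bound 1/8 <= s gives t >= 1/2, whence b(s) t >= 2 y / 2 = y; the
   intermediate value theorem applies on [0, t]. *)
have [s [s8 s2 sy]] : exists s, [/\ 8^-1 <= s, s < 2^-1 & 2 * y <= b s].
  have H1 : \forall s \near (2^-1 : R)^'-, 2 * y <= b s.
    by have /cvgryPge := lag_b_singular HL; apply.
  have H2 : \forall s \near (2^-1 : R)^'-, 8^-1 < s.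
    by apply: nbhs_left_gt; rewrite ltf_pV2 ?posrE ?ltr0n// ltr_nat.
  have H3 : \forall s \near (2^-1 : R)^'-, s < 2^-1 by exact: nbhs_left_lt.
  near (2^-1 : R)^'- => s; exists s; split.
  - by apply: ltW; near: s.
  - by near: s.
  - by near: s.
have s0 : 0 <= s by rewrite (le_trans _ s8)// invr_ge0.
pose t := Num.sqrt (2 * s).
have t2 : t ^+ 2 / 2 = s.
  by rewrite sqr_sqrtr ?mulr_ge0// mulrC mulrA mulVf ?pnatr_eq0// mul1r.
have t0 : 0 <= t by exact: sqrtr_ge0.
have t1 : `|t| < 1.
  rewrite ger0_norm// -(@ltr_pXn2r _ 2)// ?nnegrE// expr1n.
  have := s2; rewrite -t2 -[ltRHS]mul1r ltr_pM2r ?invr_gt0//.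
have th : 2^-1 <= t.
  rewrite -(@ler_pXn2r _ 2)// ?nnegrE ?invr_ge0//.
  have -> : t ^+ 2 = 2 * s by rewrite -t2; field.
  lra.
have ty : y <= lag_flux t.
  rewrite /lag_flux t2 (@le_trans _ _ (2 * y * 2^-1))//; first lra.
  by apply: ler_pM => //; rewrite ?mulr_ge0 ?invr_ge0.
have f0 : lag_flux 0 = 0 by rewrite /lag_flux mulr0.
have [||c ct cy] := @IVT R lag_flux 0 t y t0.
- apply: continuous_in_subspaceT => x; rewrite inE/= in_itv/= => /andP[x0 xt].
  apply: is_derive1_continuous (flux_der _).
  by rewrite ger0_norm// (le_lt_trans xt)// -(ger0_norm t0).
- rewrite f0 (min_idPl _) ?(le_trans y0)// (max_idPr _) ?(le_trans y0)//.
exists c; split => //; move: ct; rewrite in_itv/= => /andP[c0 ct].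
by rewrite ger0_norm// (le_lt_trans ct)// -(ger0_norm t0).
Unshelve. all: by end_near. Qed.

Let flux_surj (y : R) : exists t, `|t| < 1 /\ lag_flux t = y.
Proof.
have [y0|y0] := leP 0 y; first exact: flux_surj_ge0.
have /flux_surj_ge0[t [t1 ty]] : 0 <= - y by rewrite oppr_ge0 ltW.
by exists (- t); rewrite normrN lag_fluxN ty opprK.
Qed.

(** The bound |h y| <= |y| comes from b >= 1, and [dh 0 = 1] from b(0) = 1. Continuity of [dh] is
    what later gives a continuous second derivative of the profile; its value at 0 decides the
    behaviour at the origin. *)
Lemma lag_flux_inverse : exists h dh : R -> R,
  [/\ forall y, `|h y| < 1, forall y, lag_flux (h y) = y,
      forall y, `|h y| <= `|y|,
      forall y : R, is_derive y 1 h (dh y) & continuous dh /\ dh 0 = 1].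
Proof.
have [h hP] := choice flux_surj.
have h1 y : `|h y| < 1 by have [] := hP y.
have hK y : lag_flux (h y) = y by have [] := hP y.
have dh (y : R) : is_derive y 1 h (dflux (h y))^-1.
  rewrite -{1}(hK y); apply: (@is_derive_inverse _ lag_flux).
  - have := near_norm_lt (h1 y).
    by apply: filterS => t t1; apply: lag_flux_inj.
  - have := near_norm_lt (h1 y).
    by apply: filterS => t t1; exact: is_derive1_continuous (flux_der t1).
  - exact: flux_der.
  - by rewrite gt_eqF// dflux_gt0.
have h0 : h 0 = 0.
  by apply: lag_flux_inj; rewrite ?normr0// hK /lag_flux mulr0.
exists h, (fun y => (dflux (h y))^-1); split => //.
- move=> y; rewrite -[in leRHS](hK y) /lag_flux normrM ler_peMl//.
  rewrite (le_trans _ (ler_norm _))// lag_b_ge1// sqr2_ge0 half_sqr//.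
- split; last first.
    rewrite h0 /dflux expr0n /= mul0r mulr0 add0r bt_ge0// (lag_b_0 HL) invr1//.
  move=> y; apply: (@continuous_comp _ _ _ (fun y => dflux (h y)) GRing.inv).
    apply: (@continuous_comp _ _ _ h dflux); last exact: dflux_cont.
    exact: is_derive1_continuous (dh y).
  by apply: inv_continuous; rewrite gt_eqF// dflux_gt0.
Qed.

End flux_inverse.

(** * Radial sources *)

Section Lfun_power.
Context d (T : measurableType d) (R : realType).
Variable mu : {measure set T -> \bar R}.

(** On a set of finite measure a higher exponent is stronger: t^n <= 1 + t^p for n <= p, and an
    essential bound suffices when e is infinite. *)
Lemma Lfun_expn_integral_lty (D : set T) (f : T -> R) (n : nat) (e : \bar R) :
  measurable D -> (mu D < +oo)%E -> (0 < n)%N -> (n%:R%:E <= e)%E ->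
  f \_ D \in Lfun mu e ->
  (\int[mu]_(x in D) (`|f x| ^+ n)%:E < +oo)%E.
Proof.
move=> mD Doo n0 ne; set u := f \_ D => /andP[/[!inE] mu_ fu].
have -> : (\int[mu]_(x in D) (`|f x| ^+ n)%:E = \int[mu]_(x in D) (`|u x| ^+ n)%:E)%E.
  by apply: eq_integral => x xD; rewrite /u patchE xD.
have mun : measurable_fun D (fun x => (`|u x| ^+ n)%:E).
  apply: measurable_funS (measurableT) _ _ => //.
  by apply/measurable_EFinP/measurable_funX/measurableT_comp.
case: e ne fu => [p||//]; last first.
  (* The norm of exponent +oo is defined by cases, the essential supremum being taken only when the
     whole space has positive measure. *)
  move=> _; rewrite /= /finite_norm Lnorm.unlock; case: ifPn => [mu0|]; last first.
    rewrite -leNgt measure_le0 => /eqP mT0 _.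
    rewrite [X in (X < _)%E](_ : _ = 0%E) ?ltry//.
    apply: null_set_integral => //.
    by apply/eqP; rewrite -measure_le0 -mT0 le_measure ?inE.
  set s := ess_sup _ _ => sy.
  have [C uC] : exists C : R, {ae mu, forall x, `|u x| <= C}.
    exists (fine s); move: (ess_sup_ge mu (abse \o (EFin \o u))).
    apply: ae_impl => x /= ux; rewrite -lee_fin fineK// fin_numE.
    by rewrite (lt_eqF sy) andbT gt_eqF// (lt_le_trans _ ux)// ltNyr.
  apply: (@le_lt_trans _ _ (\int[mu]_(x in D) (`|C| ^+ n)%:E)%E).
    apply: ae_ge0_le_integral => //.
    by move: uC; apply: ae_impl => x uC _; rewrite lee_fin lerXn2r ?nnegrE//
        (le_trans uC)// ler_norm.
  rewrite integral_cst// lte_mul_pinfty// lee_fin exprn_ge0.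
rewrite lee_fin => np; have p0 : 0 < p by rewrite (lt_le_trans _ np)// ltr0n.
rewrite /finite_norm => fu.
have : (\int[mu]_x (`|u x| `^ p)%:E < +oo)%E.
  have := @poweR_Lnorm _ _ _ mu (EFin \o u) p; rewrite gt_eqF// => /(_ isT).
  have -> : (fun x => `|(EFin \o u) x| `^ p)%E = (fun x => (`|u x| `^ p)%:E).
    by apply/funext => x.
  by move=> <-; exact: poweR_lty.
have mup : measurable_fun setT (fun x => (`|u x| `^ p)%:E).
  apply/measurable_EFinP.
  apply: (measurableT_comp (f := fun x : R => x `^ p)) => //.
  exact: measurableT_comp.
move=> upoo; apply: (@le_lt_trans _ _ (\int[mu]_(x in D) (1 + (`|u x| `^ p)%:E))%E).
  apply: ge0_le_integral => //.
  - by apply: emeasurable_funD => //; exact: measurable_funS mup.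
  - move=> x _; rewrite -EFinD lee_fin.
    have [u1|u1] := leP `|u x| 1.
      by rewrite (@le_trans _ _ 1)// ?exprn_ile1// lerDl powR_ge0.
    rewrite -powR_mulrn// (@le_trans _ _ (`|u x| `^ p))// ?lerDr//.
    by rewrite ler_powR// ltW.
rewrite ge0_integralD//; last exact: measurable_funS mup.
rewrite integral_cst// mul1e; apply: lte_add_pinfty => //.
apply: le_lt_trans upoo; apply: ge0_subset_integral => //.
Qed.

End Lfun_power.

Section primitive.
Context (R : realType).
Local Notation lam := (@lebesgue_measure R).
Local Notation RT := (measurableTypeR R).

Lemma pos_continuous_measurable (k : R -> R) : (forall r : R, 0 < r -> {for r, continuous k}) ->
  measurable_fun ([set r | 0 < r] : set RT) k.
Proof.
move=> kc; have -> : [set r : RT | 0 < r] = `]0%R, +oo[%classic.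
  by apply/seteqP; split=> x /=; rewrite in_itv/= andbT.
apply: open_continuous_measurable_fun; first exact: interval_open.
by move=> x; rewrite inE/= in_itv/= andbT => x0; exact: kc.
Qed.

Lemma nneg_continuous_measurable (k : R -> R) : (forall r : R, 0 < r -> {for r, continuous k}) ->
  measurable_fun ([set r | 0 <= r] : set RT) k.
Proof.
move=> kc; have -> : [set r : RT | 0 <= r] = [set r : RT | 0 < r] `|` [set 0].
  apply/seteqP; split=> x /=; rewrite le_eqVlt.
    by case/orP => [/eqP<-|]; [right|left].
  by case=> [->|->]; rewrite ?orbT ?eqxx.
have -> : [set r : RT | 0 < r] = `]0%R, +oo[%classic.
  by apply/seteqP; split=> x /=; rewrite in_itv/= andbT.
apply/measurable_funU => //; split; last exact: measurable_fun_set1.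
have -> : `]0%R, +oo[%classic = [set r : RT | 0 < r].
  by apply/seteqP; split=> x /=; rewrite in_itv/= andbT.
exact: pos_continuous_measurable.
Qed.

Lemma itv_continuous_measurable (k : R -> R) r : (forall r : R, 0 < r -> {for r, continuous k}) ->
  measurable_fun (`[0, r]%classic : set RT) k.
Proof.
move=> kc; apply: (@measurable_funS _ _ _ _ ([set r | 0 <= r] : set RT)).
- have -> : [set r : RT | 0 <= r] = `[0%R, +oo[%classic.
    by apply/seteqP; split=> x /=; rewrite in_itv/= andbT.
  exact: measurable_itv.
- by move=> x /=; rewrite in_itv/= => /andP[].
- exact: nneg_continuous_measurable.
Qed.

Lemma bounded_itv_integrable (k : R -> R) r C : (forall r : R, 0 < r -> {for r, continuous k}) ->
  (forall s : R, 0 <= s <= r -> `|k s| <= C) ->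
  lam.-integrable `[0, r] (EFin \o k).
Proof.
move=> kc kC; apply: measurable_bounded_integrable => //.
- have := @lebesgue_measure_itv R `[0, r]; rewrite /= => ->.
  by case: ifPn => // _; rewrite -EFinB ltry.
- exact: itv_continuous_measurable.
- exists C; split; rewrite ?num_real// => y Cy x /=; rewrite in_itv/= => xr.
  by rewrite (le_trans (kC _ xr))// ltW.
Qed.

Definition primitive (k : R -> R) (r : R) : R := \int[lam]_(t in `[0, r]) k t.

Lemma primitive0 k : primitive k 0 = 0.
Proof. by rewrite /primitive set_itv1 Rintegral_set1. Qed.

Section integrable_primitive.
Variable k : R -> R.
Hypothesis kc : forall r : R, 0 < r -> {for r, continuous k}.
Hypothesis ki : forall r, lam.-integrable `[0, r] (EFin \o k).

Lemma primitive_der (r : R) : 0 < r -> is_derive r 1 (primitive k) (k r).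
Proof.
move=> r0; apply/is_derive1P.
by apply: (@continuous_FTC1_closed _ k 0 r (r + 1)); rewrite ?ltrDl// ; exact: kc.
Qed.

Lemma primitive_bound (C r : R) : 0 <= r -> (forall s : R, 0 <= s <= r -> `|k s| <= C) ->
  `|primitive k r| <= C * r.
Proof.
move=> r0 kC; apply: (@le_trans _ _ (\int[lam]_(t in `[0, r]) `|k t|)).
  exact: le_normr_Rintegral.
apply: (@le_trans _ _ (\int[lam]_(t in `[0, r]) (cst C t))).
  apply: le_Rintegral => //.
  - apply/integrable_norm/ki.
  - by apply: (@bounded_itv_integrable (cst C) r `|C|) => // t _; exact: cst_continuous.
rewrite Rintegral_cst//; have := @lebesgue_measure_itv R `[0, r]; rewrite /= => ->.
case: ifPn => [|].
  by rewrite oppr0 adde0.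
by rewrite lte_fin -leNgt => r0'; rewrite /= mulr0 (_ : r = 0) ?mulr0//; apply/le_anti;
  rewrite r0 r0'.
Qed.

Lemma primitive_lip (C : R) : (forall s : R, 0 <= s -> `|k s| <= C) ->
  forall r s : R, 0 <= r -> 0 <= s -> `|primitive k r - primitive k s| <= C * `|r - s|.
Proof.
move=> kC; suff H (r s : R) : 0 < s -> s < r -> `|primitive k r - primitive k s| <= C * `|r - s|.
  (* The mean value theorem is used on segments away from 0, where k is continuous; at the endpoint
     0 the direct bound on the integral replaces it. *)
  have H' (r s : R) : 0 <= s -> s < r -> `|primitive k r - primitive k s| <= C * `|r - s|.
    rewrite le_eqVlt => /predU1P[<-|]; last exact: H.
    move=> r0; rewrite primitive0 !subr0 (ger0_norm (ltW r0)).
    by apply: primitive_bound => [|t /andP[t0 _]]; [exact: ltW|exact: kC].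
  move=> r s r0 s0; have [|rs|->] := ltgtP s r; [exact: H'| |by rewrite !subrr normr0 mulr0].
  by rewrite distrC (distrC r); exact: H'.
move=> s0 sr.
have cst : {within `[s, r], continuous (primitive k)}.
  apply: continuous_in_subspaceT => x; rewrite inE/= in_itv/= => /andP[sx _].
  by apply: is_derive1_continuous (primitive_der _); rewrite (lt_le_trans s0).
have der x : x \in `]s, r[ -> is_derive x 1 (primitive k) (k x).
  by rewrite in_itv/= => /andP[sx _]; apply: primitive_der; rewrite (lt_trans s0).
have [c + ->] := MVT_segment (ltW sr) der cst.
rewrite in_itv/= => /andP[sc _].
by rewrite normrM ler_wpM2r// kC// (le_trans (ltW s0)).
Qed.

End integrable_primitive.
End primitive.

Section radial_source.
Context (R : realType) (n : nat).
Local Notation N := n.+2.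
Local Notation mu := (lebesgue_rV R N).
Local Notation RT := (measurableTypeR R).
Local Notation lam := (@lebesgue_measure R).

Lemma measurable_itv0 (r : R) : measurable (`[0, r]%classic : set RT).
Proof. exact: measurable_itv. Qed.

Definition sphere_area : R := ball_volume R n * N%:R.

Lemma sphere_area_gt0 : 0 < sphere_area.
Proof. by rewrite mulr_gt0// ?ball_volume_gt0// ltr0n. Qed.

Lemma ge0_integral_cball (f : R -> \bar R) (M : R) :
  measurable_fun (`[0, M]%classic : set RT) f -> (forall r : R, 0 <= r <= M -> (0 <= f r)%E) ->
  (\int[mu]_(x in cball M) f (enorm x) =
   sphere_area%:E * \int[lam]_(r in `[0%R, M]) (f r * (r ^+ n.+1)%:E))%E.
Proof.
move=> mf f0; set D : set RT := `[0, M]%classic.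
have mD : measurable D by exact: measurable_itv0.
have -> : (\int[mu]_(x in cball M) f (enorm x) = \int[mu]_x (f \_ D) (enorm x))%E.
  rewrite integral_mkcond; apply: eq_integral => x _; rewrite !patchE.
  suff -> : (x \in cball M) = (enorm x \in D) by [].
  apply/idP/idP; rewrite !inE /D/= in_itv/= enorm_ge0//.
have fD0 r : (0 <= (f \_ D) r)%E.
  rewrite patchE; case: ifPn => // ; rewrite inE /D/= in_itv/=; exact: f0.
rewrite ge0_integral_polar//; last by apply/(measurable_restrictT _ mD).
rewrite -ge0_integralZl//; last 3 first.
- apply: emeasurable_funM => //; apply/measurable_EFinP.
  by apply: measurable_funTS; exact: exprn_measurable.
- move=> r; rewrite /D/= in_itv/= => rM; rewrite mule_ge0 ?f0// lee_fin exprn_ge0//.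
  by case/andP: rM.
- by rewrite lee_fin ltW// sphere_area_gt0.
rewrite [RHS]integral_mkcond; apply: eq_integral => r _; rewrite !patchE -/D.
case: ifPn => [|_]; last by rewrite mul0e.
rewrite inE /D/= in_itv/= => /andP[r0 _]; rewrite /polar_weight (max_idPl r0).
by rewrite muleCA -EFinM mulrA.
Qed.

(** Nothing is assumed of f at 0 or on the negative axis: the restriction to nonnegative radii has
    the same composite with the norm, and a single point does not affect measurability. *)
Lemma radial_measurable (f : R -> R) : (forall r : R, 0 < r -> {for r, continuous f}) ->
  measurable_fun [set: 'rV[R]_N] (f \o @enorm R N).
Proof.
move=> fc; set D : set RT := [set r | 0 <= r].
have mD : measurable D.
  have -> : D = `[0%R, +oo[%classic.
    by apply/seteqP; split=> x /=; rewrite /D/= in_itv/= andbT.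
  exact: measurable_itv.
have -> : f \o @enorm R N = (f \_ D : RT -> R) \o ((@enorm R N) : 'rV[R]_N -> RT).
  apply/funext => x; rewrite /= patchE ifT// inE; exact: enorm_ge0.
apply: measurableT_comp; last exact: measurable_enormRT.
by apply/(measurable_restrictT _ mD); exact: nneg_continuous_measurable.
Qed.

Section source.
Variables (rho : R -> R) (xi : R).
Hypothesis xi0 : 0 < xi.
Hypothesis rhoc : forall r : R, 0 < r -> {for r, continuous rho}.
Hypothesis rhoN : (\int[mu]_(x in eball xi) (`|rho (enorm x)| ^+ N)%:E < +oo)%E.

Let wt (s : R) : R := rho s * s ^+ n.+1.

Lemma source_weight_continuous r : 0 < r -> {for r, continuous wt}.
Proof.
move=> r0; apply: continuousM; first exact: rhoc.
exact: exprn_continuous.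
Qed.

(** Half of xi, so that the closed ball of this radius lies in the open ball where |rho|^N is
    integrable. *)
Let dl := xi / 2.
Let dl0 : 0 < dl.
Proof. by rewrite divr_gt0. Qed.

Let powN (s : R) : R := `|rho s| ^+ N * s ^+ n.+1.

Let powN_ge0 s : 0 <= s -> 0 <= powN s.
Proof. by move=> s0; rewrite mulr_ge0// exprn_ge0. Qed.

Let rhoN_cont (r : R) : 0 < r -> {for r, continuous (fun s => `|rho s| ^+ N)}.
Proof.
move=> r0; apply: (@continuous_comp _ _ _ (fun s => `|rho s|) (fun y => y ^+ N));
  last exact: exprn_continuous.
by apply: continuous_comp; [exact: rhoc|exact: norm_continuous].
Qed.

Let powN_cont (r : R) : 0 < r -> {for r, continuous powN}.
Proof.
by move=> r0; apply: continuousM; [exact: rhoN_cont|exact: exprn_continuous].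
Qed.

Let powN_lty : (\int[lam]_(r in `[0%R, dl]) (powN r)%:E < +oo)%E.
Proof.
have : (\int[mu]_(x in cball dl) (`|rho (enorm x)| ^+ N)%:E < +oo)%E.
  apply: le_lt_trans rhoN; apply: ge0_subset_integral => //.
  - exact: measurable_cball.
  - exact: measurable_eball.
  - apply/measurable_EFinP/measurable_funTS.
    apply: (radial_measurable (f := fun r => `|rho r| ^+ N)) => r r0; exact: rhoN_cont.
  - by move=> x; rewrite /cball /eball /= => /le_lt_trans; apply; have := xi0; rewrite /dl; lra.
rewrite (@ge0_integral_cball (fun r => (`|rho r| ^+ N)%:E)); last 2 first.
- by apply/measurable_EFinP; apply: itv_continuous_measurable; exact: rhoN_cont.
- by move=> r _; rewrite lee_fin exprn_ge0.
under eq_integral do rewrite -EFinM.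
rewrite -/powN; set I := (\int[lam]_(r in _) _)%E => H.
rewrite ltey; apply/eqP => I1; move: H; rewrite [I]I1 gt0_muley ?ltxx// lte_fin.
exact: sphere_area_gt0.
Qed.

(* |rho| <= 1/s + s^(N-1) |rho|^N: compare |rho| s with 1. *)
Let wt_bound s : 0 <= s -> `|wt s| <= s ^+ n + s ^+ n.+1 * powN s.
Proof.
move=> s0; have sn k : 0 <= s ^+ k by rewrite exprn_ge0.
rewrite /wt normrM (ger0_norm (sn _)).
have [h|h] := leP (`|rho s| * s) 1.
  rewrite (@le_trans _ _ (s ^+ n))//; first by rewrite exprS mulrA ler_piMl.
  by rewrite lerDl mulr_ge0// powN_ge0.
rewrite (@le_trans _ _ (s ^+ n.+1 * powN s))//; last by rewrite lerDr.
rewrite mulrC ler_wpM2l// /powN exprS -mulrA -exprMn ler_peMr//.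
by rewrite exprn_ege1// ltW.
Qed.

Let mwt t : measurable_fun (`[0, t]%classic : set RT) wt.
Proof. by apply: itv_continuous_measurable; exact: source_weight_continuous. Qed.

(** The pointwise bound is integrated after replacing the powers of s by those of r. The exponent N
    is the one that yields exactly r^(N-1), which makes [flow] bounded near the origin. *)
Let near0_bound r : 0 <= r <= dl -> (\int[lam]_(s in `[0%R, r]) `|(wt s)%:E| <=
  (r ^+ n.+1 * (1 + fine (\int[lam]_(s in `[0%R, dl]) (powN s)%:E)))%:E)%E.
Proof.
move=> /andP[r0 rd].
have mpowN t : measurable_fun (`[0, t]%classic : set RT) (EFin \o powN).
  by apply/measurable_EFinP; apply: itv_continuous_measurable; exact: powN_cont.
apply: (@le_trans _ _ (\int[lam]_(s in `[0%R, r])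
      ((r ^+ n)%:E + (r ^+ n.+1)%:E * (powN s)%:E))%E).
  apply: ge0_le_integral => //.
  - by apply: measurableT_comp => //; exact/measurable_EFinP.
  - by apply: emeasurable_funD => //; apply: emeasurable_funM => //; exact: mpowN.
  - move=> s; rewrite /= in_itv/= => /andP[s0 sr].
    rewrite -EFinM -EFinD lee_fin (le_trans (wt_bound s0))// lerD ?ler_wpM2r ?powN_ge0//.
      by rewrite lerXn2r ?nnegrE.
    by rewrite lerXn2r ?nnegrE.
have powE0 s : `[0, r]%classic s -> (0 <= (powN s)%:E)%E.
  by rewrite /= in_itv/= => /andP[s0 _]; rewrite lee_fin powN_ge0.
rewrite ge0_integralD//; last 3 first.
- by move=> s _; rewrite lee_fin exprn_ge0.
- by move=> s rs; rewrite mule_ge0 ?lee_fin ?exprn_ge0// -lee_fin powE0.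
- by apply: emeasurable_funM => //; exact: mpowN.
have -> : (\int[lam]_(x in `[0%R, r]) (r ^+ n)%:E = (r ^+ n.+1)%:E)%E.
  rewrite integral_cst//; have := @lebesgue_measure_itv R `[0, r]; rewrite /= => ->.
  case: ifPn => [|]; rewrite lte_fin ?oppr0 ?adde0; first by rewrite -EFinM -exprSr.
  by rewrite -leNgt => r0'; rewrite mule0 (_ : r = 0) ?expr0n//; apply/le_anti; rewrite r0'.
rewrite ge0_integralZl//; last by rewrite lee_fin exprn_ge0.
rewrite mulrDr mulr1 EFinD leeD2l// EFinM lee_wpmul2l ?lee_fin ?exprn_ge0//.
rewrite fineK; last first.
  rewrite ge0_fin_numE ?powN_lty//; apply: integral_ge0 => s.
  by rewrite /= in_itv/= => /andP[s0 _]; rewrite lee_fin powN_ge0.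
apply: ge0_subset_integral => //.
- by move=> s; rewrite /= in_itv/= => /andP[s0 _]; rewrite lee_fin powN_ge0.
- by move=> s; rewrite /= !in_itv/= => /andP[-> /le_trans]; apply.
Qed.

(** Near 0 this is the preceding estimate; on the rest of the segment the integrand is continuous on
    a compact set. *)
Lemma source_integrable r : lam.-integrable `[0, r] (EFin \o wt).
Proof.
apply/integrableP; split; first exact/measurable_EFinP.
have [rd|dr] := leP r dl.
  have [r0|r0] := leP 0 r; first by rewrite (le_lt_trans (near0_bound _)) ?ltry// r0.
  by rewrite set_itv_ge ?integral_set0// -leNgt bnd_simp.
have rE : `[0, r]%classic = `[0, dl] `|` `]dl, r]%classic.
  by rewrite -itv_bndbnd_setU// bnd_simp ltW.
rewrite rE ge0_integral_setU//; last 2 first.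
- by rewrite -rE; apply: measurableT_comp => //; exact/measurable_EFinP.
- rewrite disj_set_sym; apply/disj_setPLR => s; rewrite /= !in_itv/= => /andP[ds _].
  by apply/negP; rewrite negb_and -!ltNge ds orbT.
rewrite lte_add_pinfty//; first by rewrite (le_lt_trans (near0_bound _)) ?ltry// lexx ltW.
have /integrableP[mdr] : lam.-integrable `[dl, r] (EFin \o wt).
  apply: continuous_compact_integrable; first exact: segment_compact.
  apply: continuous_in_subspaceT => s; rewrite inE/= in_itv/= => /andP[ds _].
  by apply: source_weight_continuous; rewrite (lt_le_trans dl0).
apply: le_lt_trans; apply: ge0_subset_integral => //.
- exact: measurableT_comp.
- by move=> s; rewrite /= !in_itv/= => /andP[/ltW -> ->].
Qed.

Lemma source_primitive_bound : exists C, 0 <= C /\ forall r, 0 <= r <= dl ->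
  `|primitive wt r| <= C * r ^+ n.+1.
Proof.
eexists; split; last first.
  move=> r rd; apply: (@le_trans _ _ (\int[lam]_(t in `[0, r]) `|wt t|)).
    by apply: le_normr_Rintegral => //; exact: source_integrable.
  rewrite mulrC -lee_fin; apply: le_trans (near0_bound rd).
  rewrite fineK//; have /integrable_abse/integrable_fin_num : lam.-integrable `[0, r] (EFin
    \o wt).
    exact: source_integrable.
  by apply.
rewrite addr_ge0// fine_ge0//; apply: integral_ge0 => s.
by rewrite /= in_itv/= => /andP[s0 _]; rewrite lee_fin powN_ge0.
Qed.
End source.
End radial_source.

(** * Divergence of radial fields *)

Section radial_calculus.
Context (R : realType) (n : nat).
Local Notation V := 'rV[R]_n.
Local Notation e i := (delta_mx ord0 i : 'rV[R]_n).
Implicit Types (x : V) (i j : 'I_n).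

Lemma delta_neq0 i : e i != 0.
Proof. by rewrite -enorm_gt0 enorm_delta. Qed.

Lemma der_coord x i j : is_derive x (e i) (fun y => y ord0 j) (i == j)%:R.
Proof.
apply/is_derive_line0.
have -> : (fun h : R => (x + h *: e i) ord0 j) = (fun h : R => x ord0 j + h * (i == j)%:R).
  by apply/funext => h; rewrite !mxE eqxx eq_sym.
rewrite -[X in is_derive _ _ _ X]add0r.
apply: (@derD R R (fun=> x ord0 j) (fun h : R => h * (i == j)%:R)).
rewrite [X in is_derive _ _ X](_ : _ = fun h : R => (i == j)%:R * h).
  exact: der_lin.
by apply/funext => h; rewrite mulrC.
Qed.

Lemma der_sum (I : Type) (s : seq I) (F : I -> V -> R) (a : I -> R) x v :
  (forall k, is_derive x v (F k) (a k)) ->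
  is_derive x v (fun y => \sum_(k <- s) F k y) (\sum_(k <- s) a k).
Proof.
move=> Fa; elim: s => [|k s IH].
  by under eq_fun do rewrite big_nil; rewrite big_nil; exact: der_cst.
by under eq_fun do rewrite big_cons; rewrite big_cons; exact: derD.
Qed.

Lemma der_enorm x i : x != 0 -> is_derive x (e i) (@enorm R n) (x ord0 i / enorm x).
Proof.
move=> x0; have d2 : is_derive x (e i) (fun y => dot y y) (2 * x ord0 i).
  have -> : 2 * x ord0 i = \sum_j ((i == j)%:R * x ord0 j + x ord0 j * (i == j)%:R).
    rewrite (bigD1 i)//= eqxx mul1r mulr1 big1 ?addr0; first by rewrite mulr_natl mulr2n.
    by move=> j ji; rewrite eq_sym (negbTE ji) mul0r mulr0 addr0.
  by apply: der_sum => j; apply: derM; exact: der_coord.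
have xx : 0 < dot x x by rewrite -enorm_sqr exprn_gt0// enorm_gt0.
have := @der_comp R _ Num.sqrt (fun y => dot y y) x (e i) _ _ (is_derive1_sqrt xx) d2.
have -> : (2 * Num.sqrt (dot x x))^-1 * (2 * x ord0 i) = x ord0 i / enorm x; last by [].
by rewrite /enorm invfM mulrACA mulVf ?pnatr_eq0// mul1r mulrC.
Qed.

Lemma der_radial (f : R -> R) a x i : x != 0 -> is_derive (enorm x) 1 f a ->
  is_derive x (e i) (f \o @enorm R n) (a * (x ord0 i / enorm x)).
Proof. by move=> x0 fa; apply: der_comp => //; exact: der_enorm. Qed.

Lemma continuous_coord x i : {for x, continuous (fun y : V => y ord0 i)}.
Proof. exact: coord_continuous. Qed.

Lemma continuous_radial (f : R -> R) x : {for enorm x, continuous f} ->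
  {for x, continuous (f \o @enorm R n)}.
Proof. by move=> fx; apply: continuous_comp => //; exact: enorm_continuous. Qed.

End radial_calculus.

Section radial_field.
Context (R : realType) (n : nat).
Local Notation N := n.+2.
Local Notation V := 'rV[R]_N.
Local Notation mu := (lebesgue_rV R N).
Local Notation RT := (measurableTypeR R).
Local Notation lam := (@lebesgue_measure R).
Local Notation e i := (delta_mx ord0 i : 'rV[R]_N).

(** Each line parallel to the axis meets the hyperplane in a single point. Besides the origin, this
    discards lines through the origin parallel to another axis. *)
Lemma ae_coord_neq0 (i : 'I_N) : {ae mu, forall x : V, x ord0 i != 0}.
Proof.
exists [set x : V | x ord0 i = 0]; split.
- rewrite -[X in measurable X]setTI.
  by apply: (@measurable_coord R N i measurableT [set 0]).
- apply: (@negligible_lines R N i).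
    rewrite -[X in measurable X]setTI.
    by apply: (@measurable_coord R N i measurableT [set 0]).
  move=> x; apply: (@subset_measure0 _ _ _ _ _ ([set - x ord0 i] : set RT)) => //.
  + apply: measurableI; first exact: measurable_itv.
    rewrite -[X in measurable X]setTI; apply: (@measurable_line R N i x measurableT).
    rewrite -[X in measurable X]setTI.
    by apply: (@measurable_coord R N i measurableT [set 0]).
  + move=> t [_] /=; rewrite !mxE !eqxx mulr1 => /eqP.
    by rewrite addr_eq0 -eqr_oppLR => /eqP ->.
  + exact: lebesgue_measure_set1.
- by move=> x /=; move/negP; rewrite negbK => /eqP.
Qed.

Lemma cball_dominated (M : R) (f g : V -> R) : measurable_fun setT f ->
  mu.-integrable (cball M) (EFin \o g) -> (forall x, enorm x <= M -> `|f x| <= g x) ->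
  (forall x, M < enorm x -> f x = 0) -> mu.-integrable setT (EFin \o f).
Proof.
move=> mf /(integrable_mkcond _ (measurable_cball _)) ig fg f0.
apply: le_integrable ig => //; first exact/measurable_EFinP.
move=> x _ /=; rewrite patchE; case: ifPn; rewrite ?inE ?notin_setE /cball/=.
  by move=> /fg h; rewrite lee_fin (le_trans h)// ler_norm.
by move=> /negP; rewrite -ltNge => /f0 ->; rewrite normr0 lee_fin.
Qed.

(** The divergence theorem for the field x k(|x|), of divergence N k + |x| k', tested against psi.
    Each component is integrated by parts along its own axis, and the results are summed. *)
Lemma radial_divergence (k k' : R -> R) (M c : R) (psi : V -> R) :
  (forall r : R, 0 < r -> is_derive r 1 k (k' r)) ->
  (forall r : R, 0 < r -> {for r, continuous k'}) ->
  mu.-integrable (cball M) (fun x => (k (enorm x))%:E) ->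
  mu.-integrable (cball M) (fun x => (enorm x * k' (enorm x))%:E) ->
  (forall x y, `|psi x - psi y| <= c * `|x - y|) ->
  (forall x, M < enorm x -> psi x = 0) ->
  (\int[mu]_x ((N%:R * k (enorm x) + enorm x * k' (enorm x)) * psi x +
    k (enorm x) * \sum_i x ord0 i * dpart i psi x)%:E = 0)%E.
Proof.
move=> dk ck' ik ik' psic psi0.
have ck (r : R) : 0 < r -> {for r, continuous k} by move=> /dk /is_derive1_continuous.
pose Vi (i : 'I_N) (x : V) := x ord0 i * k (enorm x).
pose Wi (i : 'I_N) (x : V) := k (enorm x) + x ord0 i * (k' (enorm x) * (x ord0 i / enorm x)).
have mpsi := lip_rV_measurable psic.
have mc (i : 'I_N) : measurable_fun setT (fun x : V => x ord0 i) by exact: measurable_coord.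
have mk : measurable_fun setT (fun x : V => k (enorm x)) by exact: (radial_measurable ck).
have mk' : measurable_fun setT (fun x : V => k' (enorm x)) by exact: (radial_measurable ck').
have mV i : measurable_fun setT (Vi i) by exact: measurable_funM.
have mW i : measurable_fun setT (Wi i).
  apply: measurable_funD => //; apply: measurable_funM => //; apply: measurable_funM => //.
  apply: measurable_funM => //.
  apply: (radial_measurable (f := fun r => r^-1)) => r r0; apply: inv_continuous.
  by rewrite gt_eqF.
have md i : measurable_fun setT (dpart i psi).
  exact: (measurable_dpart (lip_rV_along psic i) mpsi).
have dV i x : x != 0 -> is_derive x (e i) (Vi i) (Wi i x).
  move=> x0; have := derM (der_coord x i i) (der_radial i x0 (dk _ _)).
  by rewrite enorm_gt0 eqxx mul1r; exact.
have cW i x : x != 0 -> {for x, continuous (Wi i)}.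
  move=> x0; have xp : 0 < enorm x by rewrite enorm_gt0.
  apply: (@cvgD _ _ _ (nbhs x)); first exact: (continuous_radial (ck _ xp)).
  apply: (@cvgM _ _ (nbhs x)); first exact: continuous_coord.
  apply: (@cvgM _ _ (nbhs x)); first exact: (continuous_radial (ck' _ xp)).
  apply: (@cvgM _ _ (nbhs x)); first exact: continuous_coord.
  apply: (continuous_radial (f := fun r => r^-1)).
  by apply: inv_continuous; rewrite gt_eqF.
have [C psiC] : exists C, forall x, `|psi x| <= C.
  have [C HC] := continuous_bounded_eball M (lip_rV_continuous psic).
  exists `|C| => x; have [xM|/psi0 ->] := leP (enorm x) M; last by rewrite normr0.
  by rewrite (le_trans (HC x xM))// ler_norm.
have C0 : 0 <= C by rewrite (le_trans _ (psiC 0)).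
have dpc i x : `|dpart i psi x| <= `|c|.
  have := dpart_bound (lip_rV_along psic i) x; by rewrite normr_id.
have dp0 i x : M < enorm x -> dpart i psi x = 0.
  by move=> Mx; rewrite /dpart; case: asboolP => // _; exact: partial_eq0 psi0 Mx.
pose g (x : V) := C * `|k (enorm x)| + C * `|enorm x * k' (enorm x)| + M * `|c| * `|k (enorm x)|.
have ig : mu.-integrable (cball M) (EFin \o g).
  rewrite /g; under [X in _.-integrable _ X]eq_fun do rewrite /= !EFinD !EFinM.
  have mB := measurable_cball (n := n) (R := R) M.
  by apply: integrableD => //; [apply: integrableD => //|]; apply: integrableZl => //;
    exact: integrable_norm.
have xiM (i : 'I_N) x : enorm x <= M -> `|x ord0 i| <= M.
  by apply: le_trans; exact: normr_coord_enorm.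
have kVb i x : enorm x <= M -> `|Vi i x * psi x| <= M * C * `|k (enorm x)|.
  move=> xM; rewrite /Vi !normrM mulrAC ler_wpM2r// ler_pM//; exact: xiM.
have kWb i x : `|Wi i x * psi x| <= C * `|k (enorm x)| + C * `|enorm x * k' (enorm x)|.
  rewrite normrM mulrC -mulrDr; apply: ler_pM => //; rewrite (le_trans (ler_normD _ _))// lerD2l.
  have [->|x0] := eqVneq x 0; first by rewrite !mxE mul0r normr0.
  rewrite mulrCA !normrM mulrC ler_wpM2r// normfV.
  have xp : 0 < `|enorm x| by rewrite normr_gt0 gt_eqF// enorm_gt0.
  rewrite mulrA ler_pdivrMr// [`|enorm x|]ger0_norm ?enorm_ge0// ler_pM//;
    exact: normr_coord_enorm.
have ibp i : mu.-integrable setT (fun x => (Wi i x * psi x + Vi i x * dpart i psi x)%:E) /\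
    (\int[mu]_x (Wi i x * psi x + Vi i x * dpart i psi x)%:E = 0)%E.
  have iW : mu.-integrable setT (fun x => (Wi i x * psi x + Vi i x * dpart i psi x)%:E).
    apply: (@cball_dominated M _ g) => //.
    - by apply: measurable_funD; apply: measurable_funM.
    - move=> x xM; rewrite (le_trans (ler_normD _ _))// lerD//.
      by rewrite /Vi !normrM mulrAC ler_wpM2r// ler_pM// xiM.
    - by move=> x Mx; rewrite psi0// dp0// !mulr0 addr0.
  split => //; apply: (@integral_by_parts R N i `|c| psi (Vi i) (Wi i)) => //.
  - exact: lip_rV_along.
  (* The dimension is at least 2: a nonzero coordinate j other than i stays constant along the line,
     which therefore avoids the origin. *)
  - have [j ji] : exists j : 'I_N, j != i.
      by exists (if i == ord0 then ord_max else ord0); case: (eqVneq i ord0) => [->|];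
        rewrite // eq_sym.
    move: (ae_coord_neq0 j); apply: ae_impl => x xj.
    have x0 (t : R) : x + t *: e i != 0.
      apply: contra_neq xj => /matrixP /(_ ord0 j).
      by rewrite !mxE eqxx (negbTE ji) mulr0 addr0.
    split; last by move=> t _; exact: dV.
    apply: (@C1_lip R (fun t => Vi i (x + t *: e i)) (fun t => Wi i (x + t *: e i)) 0 1) => //.
      move=> t; have := dV i (x + t *: e i) (x0 t).
      by move=> /(iffLR (@is_derive_line R _ (Vi i) x (e i) t _)).
    move=> t; apply: (@continuous_comp _ _ _ (fun t : R => x + t *: e i) (Wi i)); last exact: cW.
    apply: (@cvgD _ _ _ (nbhs t)); first exact: cvg_cst.
    by apply: (@cvgZr_tmp _ _ _ (nbhs t)).
  - apply: (@cball_dominated M _ (fun x => M * C * `|k (enorm x)|)) => //.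
    + exact: measurable_funM.
    + under [X in _.-integrable _ X]eq_fun do rewrite /= !EFinM.
      by rewrite -EFinM; apply: integrableZl; [exact: measurable_cball|exact: integrable_norm].
    + by move=> x xM; exact: kVb.
    + by move=> x Mx; rewrite psi0// mulr0.
transitivity (\int[mu]_x (\sum_(i < N) (Wi i x * psi x + Vi i x * dpart i psi x)%:E))%E.
  apply: eq_integral => x _; rewrite sumEFin; congr EFin.
  rewrite big_split/= -mulr_suml; congr (_ * _ + _).
    rewrite /Wi big_split/= sumr_const card_ord mulr_natl; congr (_ + _).
    rewrite -[RHS](_ : \sum_i x ord0 i * x ord0 i * (k' (enorm x) / enorm x) = _); last first.
      by apply: eq_bigr => i _; ring.
    rewrite -mulr_suml -[\sum_i _]/(dot x x) -enorm_sqr.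
    have [->|x0] := eqVneq (enorm x) 0; first by rewrite expr0n !mul0r.
    by field.
  by rewrite mulr_sumr; apply: eq_bigr => i _; rewrite /Vi; ring.
rewrite (@integral_sum _ _ _ mu setT measurableT _ (fun i x =>
  (Wi i x * psi x + Vi i x * dpart i psi x)%:E)); last first.
  by move=> i; have [] := ibp i.
by rewrite big1// => i _; have [] := ibp i.
Qed.

End radial_field.

(** * The radial field generated by the source *)

Section radial_flux.
Context (R : realType) (n : nat).
Local Notation N := n.+2.
Local Notation V := 'rV[R]_N.
Local Notation mu := (lebesgue_rV R N).
Local Notation RT := (measurableTypeR R).
Local Notation lam := (@lebesgue_measure R).
Local Notation e i := (delta_mx ord0 i : 'rV[R]_N).

Lemma cball_integrable_radial (f : R -> R) (M : R) :
  (forall r : R, 0 < r -> {for r, continuous f}) ->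
  lam.-integrable `[0, M] (fun r => (f r * r ^+ n.+1)%:E) ->
  mu.-integrable (cball M) (fun x => (f (enorm x))%:E).
Proof.
move=> fc /integrableP[_ fi]; apply/integrableP; split.
  apply/measurable_EFinP; apply: measurable_funTS.
  exact: (radial_measurable fc).
have := @ge0_integral_cball R n (fun r => `|f r|%:E) M; rewrite /= => ->.
- rewrite [X in (_ * X)%E](_ : _ = \int[lam]_(r in `[0%R, M]) `|(f r * r ^+ n.+1)%:E|)%E.
    by rewrite lte_mul_pinfty// ?lee_fin// ltW// sphere_area_gt0.
  apply: eq_integral => r; rewrite inE/= in_itv/= => /andP[r0 _].
  by rewrite normrM [`|r ^+ _|]ger0_norm// exprn_ge0.
- apply/measurable_EFinP; apply: (itv_continuous_measurable (k := fun r => `|f r|)) => r r0.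
  by apply: continuous_comp; [exact: fc|exact: norm_continuous].
- by move=> r _; rewrite lee_fin.
Qed.

Variables (rho : R -> R) (xi : R).
Hypothesis xi0 : 0 < xi.
Hypothesis rhoc : forall r : R, 0 < r -> {for r, continuous rho}.
Hypothesis rhoN : (\int[mu]_(x in eball xi) (`|rho (enorm x)| ^+ N)%:E < +oo)%E.

Definition mass : R -> R := primitive (fun s => rho s * s ^+ n.+1).
(* The junk value at the origin is flow 0 = 0. *)
Definition flow (r : R) : R := mass r / r ^+ n.+1.

Lemma mass_der (r : R) : 0 < r -> is_derive r 1 mass (rho r * r ^+ n.+1).
Proof.
apply: (@primitive_der R (fun s => rho s * s ^+ n.+1)).
- exact: source_weight_continuous.
- by move=> t; exact: source_integrable xi0 rhoc rhoN _.
Qed.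

Lemma flow_bound (M : R) : exists C, 0 <= C /\
  forall r, 0 <= r <= M -> `|mass r| <= C * r ^+ n.+1 /\ `|flow r| <= C.
Proof.
have [C [C0 HC]] := source_primitive_bound xi0 rhoc rhoN.
pose B := \int[lam]_(t in `[0, M]) `|rho t * t ^+ n.+1|.
have dl0 : 0 < xi / 2 by rewrite divr_gt0.
have Hd k : 0 <= (xi / 2) ^+ k by rewrite exprn_ge0// ltW.
have si t := source_integrable xi0 rhoc rhoN t.
(* The term C serves on [0, xi/2]. Beyond it the mass is at most B, while r^(N-1) is at least
   (xi/2)^(N-1). *)
exists (C + `|B| / (xi / 2) ^+ n.+1); split; first by rewrite addr_ge0// divr_ge0.
have H r : 0 <= r <= M -> `|mass r| <= (C + `|B| / (xi / 2) ^+ n.+1) * r ^+ n.+1.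
  move=> /andP[r0 rM]; rewrite mulrDl; have [rd|dr] := leP r (xi / 2).
    rewrite (le_trans (HC r _)) ?r0// lerDl mulr_ge0// ?exprn_ge0//.
    by rewrite divr_ge0.
  apply: (@le_trans _ _ (`|B| / (xi / 2) ^+ n.+1 * r ^+ n.+1)); last first.
    by rewrite lerDr mulr_ge0// exprn_ge0.
  rewrite mulrAC ler_pdivlMr ?exprn_gt0// ler_pM//; last by rewrite lerXn2r ?nnegrE//; exact: ltW.
  apply: (@le_trans _ _ B); last exact: ler_norm.
  apply: (@le_trans _ _ (\int[lam]_(t in `[0, r]) `|rho t * t ^+ n.+1|)).
    by apply: le_normr_Rintegral => //; exact: si.
  have ia t : lam.-integrable `[0, t] (fun t =>
    `|rho t * t ^+ n.+1|%:E) by apply: integrable_norm; exact: si.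
  apply: fine_le; [exact: integrable_fin_num|exact: integrable_fin_num|].
  apply: ge0_subset_integral => //.
  - by have /integrableP[] := ia M.
  - by move=> t; rewrite /= !in_itv/= => /andP[-> /le_trans]; apply.
move=> r rM; split; first exact: H.
have := H r rM; case/andP: rM => r0 _.
rewrite /flow; move: r0; rewrite le_eqVlt => /predU1P[<- _|r0].
  by rewrite expr0n invr0 mulr0 normr0 addr_ge0// divr_ge0.
by rewrite normrM normfV [`|_ ^+ n.+1|]gtr0_norm ?exprn_gt0// ler_pdivrMr// exprn_gt0.
Qed.

Lemma flow_continuous (r : R) : 0 < r -> {for r, continuous flow}.
Proof.
move=> r0; apply: continuousM; first exact: is_derive1_continuous (mass_der r0).
apply: (@continuous_comp _ _ _ (fun t : R => t ^+ n.+1) (@GRing.inv R));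
  first exact: exprn_continuous.
by apply: inv_continuous; rewrite gt_eqF// exprn_gt0.
Qed.

Lemma der_invX (r : R) k : 0 < r -> is_derive r 1 (fun t : R =>
  (t ^+ k.+1)^-1) (- (k.+1%:R / r ^+ k.+2)).
Proof.
move=> r0; have d1 := derX k (der_id r).
have rk : r ^+ k.+1 != 0 by rewrite expf_neq0// gt_eqF.
have := @is_deriveV R (fun t => t ^+ k.+1) r _ 1 rk d1.
rewrite (_ : _ *: _ = - (k.+1%:R / r ^+ k.+2)); first exact.
have r0' : r != 0 by rewrite gt_eqF.
by rewrite /GRing.scale/= !exprS; field; rewrite r0' expf_neq0.
Qed.

Lemma flow_der (r : R) : 0 < r ->
  is_derive r 1 flow (rho r - n.+1%:R * (flow r / r)).
Proof.
move=> r0; have := derM (mass_der r0) (der_invX n r0).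
have r0' : r != 0 by rewrite gt_eqF.
rewrite (_ : _ + _ = rho r - n.+1%:R * (flow r / r)); first exact.
rewrite /flow !exprS; field; by rewrite r0' expf_neq0.
Qed.

(** The radial factor of the field: x kt(|x|) = -G(|x|) x/|x|. In the divergence the terms in G/r
    cancel, leaving N kt + r kt' = -rho. *)
Let kt (r : R) : R := - (flow r / r).
Let kt' (r : R) : R := - ((rho r - N%:R * (flow r / r)) / r).

Let dkt (r : R) : 0 < r -> is_derive r 1 kt (kt' r).
Proof.
move=> r0; have r0' : r != 0 by rewrite gt_eqF.
have := derN (derM (flow_der r0) (der_invX 0 r0)).
have -> : (fun y => - (flow y * (y ^+ 1)^-1)) = kt by apply/funext => y; rewrite expr1.
rewrite (_ : - _ = kt' r); first exact.
rewrite /kt' !exprS expr0 -[N]addn1 natrD; field.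
by [].
Qed.

Let ktc (r : R) : 0 < r -> {for r, continuous kt}.
Proof. by move=> /dkt /is_derive1_continuous. Qed.

Let ktc' (r : R) : 0 < r -> {for r, continuous kt'}.
Proof.
move=> r0; have c1 : {for r, continuous (@GRing.inv R)} by apply: inv_continuous; rewrite gt_eqF.
apply: continuousN; apply: continuousM => //.
apply: continuousB; first exact: rhoc.
apply: continuousM; first exact: cst_continuous.
by apply: continuousM => //; exact: flow_continuous.
Qed.

Let ikt M : lam.-integrable `[0, M] (fun r => (kt r * r ^+ n.+1)%:E).
Proof.
have [C [C0 HC]] := flow_bound M.
apply: (@bounded_itv_integrable R (fun r => kt r * r ^+ n.+1) M (C * `|M| ^+ n)).
  by move=> r r0; apply: continuousM; [exact: ktc|exact: exprn_continuous].
move=> r rM; have [_ GC] := HC r rM; case/andP: rM => r0 rM.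
rewrite /kt; move: r0; rewrite le_eqVlt => /predU1P[<-|r0].
  by rewrite invr0 mulr0 oppr0 mul0r normr0 mulr_ge0// exprn_ge0.
rewrite exprS mulrA mulNr divfK ?gt_eqF// mulNr normrN normrM ler_pM//.
by rewrite normrX lerXn2r ?nnegrE// !gtr0_norm// (lt_le_trans r0).
Qed.

Let ikt' M : lam.-integrable `[0, M] (fun r => (r * kt' r * r ^+ n.+1)%:E).
Proof.
have i1 := source_integrable xi0 rhoc rhoN M.
have i2 : lam.-integrable `[0, M] (fun r => (- N%:R)%:E * (kt r * r ^+ n.+1)%:E)%E.
  by apply: integrableZl => //; exact: ikt.
have mM : measurable (`[0, M]%classic : set RT) by exact: measurable_itv0.
have := integrableB mM i2 i1.
apply: eq_integrable => // r; rewrite inE/= in_itv/= => /andP[r0 _].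
rewrite -EFinM -EFinB; congr EFin; move: r0; rewrite le_eqVlt => /predU1P[<-|r0].
  by rewrite exprS !(mulr0, mul0r) subrr.
have r0' : r != 0 by rewrite gt_eqF.
by rewrite /kt' /kt; field.
Qed.

(** The weak form of -div V = rho. The bound on [flow] makes the field integrable up to the origin,
    so that the two terms of [radial_divergence] can be separated. *)
Lemma flux_divergence (M c : R) (psi : V -> R) :
  (forall x y, `|psi x - psi y| <= c * `|x - y|) ->
  (forall x, M < enorm x -> psi x = 0) ->
  [/\ mu.-integrable setT (fun x => (rho (enorm x) * psi x)%:E),
    mu.-integrable setT (fun x => (- (flow (enorm x) / enorm x)
      * \sum_i x ord0 i * dpart i psi x)%:E) &
  (\int[mu]_x (rho (enorm x) * psi x)%:E =
   \int[mu]_x (- (flow (enorm x) / enorm x) * \sum_i x ord0 i * dpart i psi x)%:E)%E].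
Proof.
move=> psic psi0.
have mpsi := lip_rV_measurable psic.
have := @radial_divergence R n kt kt' M c psi dkt ktc' _ _ psic psi0.
move=> /(_ (cball_integrable_radial ktc (ikt M))).
have ck2 (r : R) : 0 < r -> {for r, continuous (fun r : R => r * kt' r)}.
  by move=> r0; apply: continuousM; [exact: cvg_id|exact: ktc'].
move=> /(_ (cball_integrable_radial ck2 (ikt' M))) H.
have [C psiC] : exists C, forall x, `|psi x| <= C.
  have [C HC] := continuous_bounded_eball M (lip_rV_continuous psic).
  exists `|C| => x; have [xM|/psi0 ->] := leP (enorm x) M; last by rewrite normr0.
  by rewrite (le_trans (HC x xM))// ler_norm.
have i1 : mu.-integrable setT (fun x => (rho (enorm x) * psi x)%:E).
  apply: (@cball_dominated R n M _ (fun x => C * `|rho (enorm x)|)).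
  - by apply: measurable_funM => //; exact: (radial_measurable rhoc).
  - under [X in _.-integrable _ X]eq_fun do rewrite /= EFinM.
    apply: integrableZl; first exact: measurable_cball.
    apply: integrable_norm; apply: (cball_integrable_radial rhoc).
    exact: source_integrable xi0 rhoc rhoN M.
  - by move=> x _; rewrite normrM mulrC ler_wpM2r.
  - by move=> x Mx; rewrite psi0// mulr0.
have i2 : mu.-integrable setT (fun x => (kt (enorm x) * \sum_i x ord0 i * dpart i psi x)%:E).
  apply: (@cball_dominated R n M _ (fun x => (\sum_(i < N) M * `|c|) * `|kt (enorm x)|)).
  - apply: measurable_funM; first exact: (radial_measurable ktc).
    apply: measurable_sum => i; apply: measurable_funM; first exact: measurable_coord.
    exact: (measurable_dpart (lip_rV_along psic i) mpsi).
  - under [X in _.-integrable _ X]eq_fun do rewrite /= EFinM.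
    apply: integrableZl; first exact: measurable_cball.
    apply: integrable_norm; apply: (cball_integrable_radial ktc); exact: ikt.
  - move=> x xM; rewrite normrM mulrC ler_wpM2r// (le_trans (ler_norm_sum _ _ _))//.
    apply: ler_sum => i _; rewrite normrM ler_pM//.
      by rewrite (le_trans _ xM)// normr_coord_enorm.
    by have := dpart_bound (lip_rV_along psic i) x; rewrite normr_id.
  - move=> x Mx; rewrite big1 ?mulr0// => i _.
    by rewrite /dpart; case: asboolP => [_|]; rewrite ?(partial_eq0 _ psi0 Mx) mulr0.
split => //.
have : (\int[mu]_x ((kt (enorm x) * \sum_i x ord0 i * dpart i psi x)%:E - (rho (enorm x)
  * psi x)%:E) = 0)%E.
  rewrite -[RHS]H; apply: ae_eq_integral => //.
  - by have /integrableP[] := integrableB measurableT i2 i1.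
  - apply/measurable_EFinP; apply: measurable_funD.
      apply: measurable_funM => //; apply: measurable_funD.
        by apply: measurable_funM => //; exact: (radial_measurable ktc).
      exact: (radial_measurable ck2).
    by have /integrableP[/measurable_EFinP] := i2.
  (* The identity N kt + r kt' = -rho is that of positive radii; the default value of division by 0
     makes its left-hand side 0 at the origin, hence an equality almost everywhere. *)
  - move: (@ae_coord_neq0 R n ord0); apply: ae_impl => x x0 _.
    rewrite -EFinB; congr EFin.
    have xp : enorm x != 0.
      by rewrite enorm_eq0; apply: contra_neq x0 => ->; rewrite mxE.
    by rewrite /kt' /kt; field.
rewrite (integralB_EFin measurableT i2 i1).
have := integrable_fin_num measurableT i1; have := integrable_fin_num measurableT i2.
move=> /fineK <- /fineK <-; rewrite -EFinB => -[/eqP]; rewrite subr_eq0 => /eqP.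
by rewrite /kt => ->.
Qed.

End radial_flux.

Lemma near_eq_continuous (T U : topologicalType) (f g : T -> U) (x : T) :
  {near x, f =1 g} -> {for x, continuous f} -> {for x, continuous g}.
Proof.
move=> fg cf; rewrite /prop_for /continuous_at -(nbhs_singleton fg).
by apply: cvg_trans cf; exact: near_eq_cvg.
Qed.

Lemma near_gt0 (R : realType) (r : R) : 0 < r -> \forall t \near r, 0 < t.
Proof. by move=> r0; apply: (@cvgr_gt _ _ (nbhs r) _ id r) => //; exact: cvg_id. Qed.

Lemma der_ge0_le (R : realType) (F f : R -> R) (s t : R) : s <= t ->
  (forall x : R, s <= x <= t -> is_derive x 1 F (f x)) ->
  (forall x : R, s <= x <= t -> 0 <= f x) -> F s <= F t.
Proof.
rewrite le_eqVlt => /predU1P[->//|st] dF f0.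
have sub x : x \in `]s, t[ -> s <= x <= t by rewrite in_itv/= => /andP[/ltW -> /ltW ->].
have cst : {within `[s, t], continuous F}.
  apply: continuous_in_subspaceT => x; rewrite inE/= in_itv/= => sxt.
  exact: is_derive1_continuous (dF _ sxt).
have dF' x : x \in `]s, t[ -> is_derive x 1 F (f x) by move=> /sub; exact: dF.
have [c cin E] := MVT_segment (ltW st) dF' cst; have cst' : s <= c <= t by move: cin;
  rewrite in_itv.
by rewrite -subr_ge0 E mulr_ge0// ?f0// subr_ge0 ltW.
Qed.

(** * Gradients of radial Lipschitz functions *)

Section radial_profile.
Context (R : realType) (n : nat).
Local Notation V := 'rV[R]_n.
Local Notation mu := (lebesgue_rV R n).
Local Notation e i := (delta_mx ord0 i : V).
Variables F f : R -> R.
Hypothesis Flip : forall r s : R, 0 <= r -> 0 <= s -> `|F r - F s| <= `|r - s|.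
Hypothesis dF : forall r : R, 0 < r -> is_derive r 1 F (f r).

Lemma radial_lip (x y : V) : `|F (enorm x) - F (enorm y)| <= n%:R * `|x - y|.
Proof.
rewrite (le_trans (Flip _ _)) ?enorm_ge0// (le_trans (ler_dist_enorm _ _))//.
exact: enorm_le_norm.
Qed.

Lemma radial_partial (x : V) i : x != 0 ->
  is_derive x (e i) (fun y : V => F (enorm y)) (f (enorm x) * (x ord0 i / enorm x)).
Proof. by move=> x0; apply: der_radial => //; apply: dF; rewrite enorm_gt0. Qed.

Lemma radial_dpart (x : V) i : x != 0 ->
  dpart i (fun y : V => F (enorm y)) x = f (enorm x) * (x ord0 i / enorm x).
Proof.
by move=> x0; have [d1 d2] := radial_partial i x0; rewrite /dpart; case: asboolP.
Qed.

Lemma radial_gradE (x : V) : x != 0 ->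
  grad (fun y : V => F (enorm y)) x = (f (enorm x) / enorm x) *: x.
Proof.
move=> x0; apply/rowP => i; rewrite !mxE /partial.
by have [_ ->] := radial_partial i x0; rewrite mulrAC mulrA.
Qed.

Lemma radial_grad_enorm (x : V) : x != 0 ->
  enorm (grad (fun y : V => F (enorm y)) x) = `|f (enorm x)|.
Proof.
move=> x0; rewrite radial_gradE// enormZ normrM normfV [`|enorm x|]ger0_norm ?enorm_ge0//.
by rewrite divfK// enorm_eq0.
Qed.

End radial_profile.

(** * Energy estimate *)

Section energy.
Context (R : realType) (n : nat).
Local Notation N := n.+3.
Local Notation V := 'rV[R]_N.
Local Notation mu := (lebesgue_rV R N).
Local Notation RT := (measurableTypeR R).
Local Notation lam := (@lebesgue_measure R).
Local Notation e i := (delta_mx ord0 i : V).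

Lemma ae_neq0 : {ae mu, forall x : V, x != 0}.
Proof.
move: (@ae_coord_neq0 R n.+1 ord0); apply: ae_impl => x; apply: contra_neq => ->.
by rewrite mxE.
Qed.

Variables (rho : R -> R) (xi : R).
Hypothesis xi0 : 0 < xi.
Hypothesis rhoc : forall r : R, 0 < r -> {for r, continuous rho}.
Hypothesis rhoN : (\int[mu]_(x in eball xi) (`|rho (enorm x)| ^+ N)%:E < +oo)%E.
Local Notation G := (flow n.+1 rho).

Variable g : R -> R.
Hypothesis gc : forall r : R, 0 < r -> {for r, continuous g}.
Hypothesis g1 : forall r : R, `|g r| <= 1.
Hypothesis gG : forall r : R, g r ^+ 2 <= g r * G r.

Section cutoff.
Variable M : R.
Hypothesis M0 : 0 <= M.

Definition cutoff (s : R) : R := clamp 0 1 (M + 1 - s).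

Lemma cutoff_itv s : 0 <= cutoff s <= 1. Proof. exact: clamp_itv. Qed.

Lemma cutoff1 s : s <= M -> cutoff s = 1.
Proof. by move=> sM; rewrite /cutoff /clamp (min_idPr _) ?(max_idPr _)//; lra. Qed.

Lemma cutoff0 s : M + 1 <= s -> cutoff s = 0.
Proof.
move=> sM; rewrite /cutoff /clamp (max_idPl _)// (le_trans (_ : _ <= M + 1 - s))//; last lra.
by rewrite ge_min lexx.
Qed.

Lemma cutoff_continuous : continuous cutoff.
Proof.
apply: (@klip_continuous _ _ 1) => s t; rewrite mul1r (le_trans (clamp_lip _ _ _ _))//.
by rewrite (_ : _ - _ = t - s) 1?distrC//; ring.
Qed.

Let k (s : R) := g s * cutoff s.

Let kc (r : R) : 0 < r -> {for r, continuous k}.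
Proof. by move=> r0; apply: continuousM; [exact: gc|exact: cutoff_continuous]. Qed.

Let k1 r : `|k r| <= 1.
Proof.
rewrite normrM -[leRHS]mulr1 ler_pM//.
by have /andP[c0 c1] := cutoff_itv r; rewrite ger0_norm.
Qed.

Let ki r : lam.-integrable `[0, r] (EFin \o k).
Proof. exact: (@bounded_itv_integrable _ _ _ 1 kc). Qed.

(** The integral of k from r to M + 1. The cutoff multiplies the slope and not the potential, whose
    existence is still to be proved; P stays 1-Lipschitz and vanishes beyond M + 1. *)
Let P (r : R) := primitive k (M + 1) - primitive k r.

Let dP (r : R) : 0 < r -> is_derive r 1 P (- k r).
Proof.
move=> r0; rewrite -[- k r]add0r; apply: (@derD R R (fun=> _) (fun r => - primitive k r)).
by apply: derN; exact: primitive_der.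
Qed.

Let Plip (r s : R) : 0 <= r -> 0 <= s -> `|P r - P s| <= `|r - s|.
Proof.
move=> r0 s0; have -> : P r - P s = primitive k s - primitive k r by rewrite /P; ring.
rewrite distrC -[leRHS]mul1r.
exact: primitive_lip.
Qed.

Let P0 r : M + 1 <= r -> P r = 0.
Proof.
rewrite le_eqVlt => /predU1P[<-|Mr]; first by rewrite /P subrr.
have M1 : 0 < M + 1 by rewrite ltr_wpDl.
have der x : x \in `](M + 1), r[ -> is_derive x 1 P (- k x).
  by rewrite in_itv/= => /andP[sx _]; apply: dP; rewrite (lt_trans M1).
have cst : {within `[(M + 1), r], continuous P}.
  apply: continuous_in_subspaceT => x; rewrite inE/= in_itv/= => /andP[sx _].
  by apply: is_derive1_continuous (dP _); rewrite (lt_le_trans M1).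
have [c] := MVT_segment (ltW Mr) der cst.
rewrite in_itv/= => /andP[Mc _]; rewrite /k cutoff0// mulr0 oppr0 mul0r {2}/P subrr subr0.
exact.
Qed.

Definition energy_test (x : V) : R := P (enorm x).

Lemma energy_test_lip x y : `|energy_test x - energy_test y| <= N%:R * `|x - y|.
Proof. exact: (radial_lip Plip). Qed.

Lemma energy_test_supp x : M + 1 < enorm x -> energy_test x = 0.
Proof. by move=> /ltW; exact: P0. Qed.

Lemma energy_test_admissible : admissible energy_test.
Proof.
apply: (compact_lip_admissible _ energy_test_lip energy_test_supp) => //.
move: ae_neq0; apply: ae_impl => x x0.
by rewrite (radial_grad_enorm dP)// normrN exprn_ile1.
Qed.

Let flow_k r : 0 <= r -> k r ^+ 2 <= G r * k r.
Proof.
move=> r0; have /andP[c0 c1] := cutoff_itv r.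
have -> : G r * k r = (g r * G r) * cutoff r by rewrite /k; ring.
rewrite exprMn (le_trans (_ : _ <= g r ^+ 2 * cutoff r))//.
  by rewrite ler_wpM2l ?sqr_ge0// expr2 ler_piMl.
by rewrite ler_wpM2r.
Qed.

Let flow_k_ge0 r : 0 <= r -> 0 <= G r * k r.
Proof. by move=> r0; rewrite (le_trans (sqr_ge0 (k r)))// flow_k. Qed.

(** The gradient of the test function is -k(|x|) x/|x|, so that its scalar product with the field
    -G(|x|) x/|x| is G k. *)
Lemma energy_testE : (\int[mu]_x (rho (enorm x) * energy_test x)%:E =
  \int[mu]_x (G (enorm x) * k (enorm x))%:E)%E /\
  mu.-integrable setT (fun x => (G (enorm x) * k (enorm x))%:E).
Proof.
have [i1 i2 ->] := flux_divergence xi0 rhoc rhoN energy_test_lip energy_test_supp.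
have E : ae_eq mu setT (fun x => (- (G (enorm x) / enorm x)
  * \sum_i x ord0 i * dpart i energy_test x)%:E)
    (fun x => (G (enorm x) * k (enorm x))%:E).
  move: ae_neq0; apply: ae_impl => x x0 _; congr EFin.
  have xp : enorm x != 0 by rewrite enorm_eq0.
  under eq_bigr do rewrite (radial_dpart dP)//.
  have -> : \sum_i x ord0 i * (- k (enorm x) * (x ord0 i / enorm x)) = - k (enorm x) * enorm x.
    rewrite -[RHS](_ : (- k (enorm x) / enorm x) * \sum_i x ord0 i * x ord0 i = _).
      by rewrite mulr_sumr; apply: eq_bigr => i _; ring.
    by rewrite -[\sum_i _]/(dot x x) -enorm_sqr; field.
  by field.
have mG : measurable_fun setT (fun x : V => (G (enorm x) * k (enorm x))%:E).
  apply/measurable_EFinP; apply: measurable_funM.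
    apply: (radial_measurable (f := G)) => r r0; exact: (flow_continuous xi0 rhoc rhoN).
  exact: (radial_measurable kc).
split; last exact: ae_eq_integrable E i2.
by apply: ae_eq_integral => //; have /integrableP[] := i2.
Qed.

Lemma energy_test_norm : (D12_norm energy_test `^ 2 <= \int[mu]_x (G (enorm x)
  * k (enorm x))%:E)%E.
Proof.
have [_ iG] := energy_testE; have /integrableP[mG _] := iG.
rewrite /D12_norm poweR_Lnorm// .
(* The gradient formula fails to cover the origin; inserting the actual value there makes the
   integrand of the norm a function of |x| everywhere, whose measurability is then that of a radial
   function. *)
pose c := enorm (grad energy_test 0).
pose q (r : R) : R := (if r == 0 then c else `|k r|) ^+ 2.
have qE (x : V) : (`|(EFin \o (@enorm R N \o grad energy_test)) x| `^ 2)%E = (q (enorm x))%:E.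
  rewrite /= powR_mulrn// ger0_norm ?enorm_ge0// /q enorm_eq0; case: eqVneq => [->//|x0].
  by rewrite (radial_grad_enorm dP)// normrN.
under eq_integral do rewrite qE.
apply: ae_ge0_le_integral => //.
- by move=> x _; rewrite lee_fin sqr_ge0.
- apply/measurable_EFinP; apply: (radial_measurable (f := q)) => r r0.
  apply: (@near_eq_continuous _ _ (fun r => `|k r| ^+ 2)).
    by move: (near_gt0 r0); apply: filterS => t t0; rewrite /q gt_eqF.
  apply: (@continuous_comp _ _ _ (fun s => `|k s|) (fun y => y ^+ 2));
    last exact: exprn_continuous.
  by apply: continuous_comp; [exact: kc|exact: norm_continuous].
- by move=> x _; rewrite lee_fin flow_k_ge0// enorm_ge0.
- move: ae_neq0; apply: ae_impl => x x0 _; rewrite lee_fin /q enorm_eq0 (negbTE x0).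
  by rewrite real_normK ?num_real// flow_k// enorm_ge0.
Qed.

Variables (T : (V -> R) -> R) (C : R).
Hypothesis Trho : represented_by T (rho \o @enorm R N).
Hypothesis TC : forall f, admissible f -> (`|T f|%:E <= C%:E * D12_norm f)%E.

(* The energy E of the test function is both its pairing with rho and an upper
   bound of its squared D12 norm, so that E <= C sqrt E. *)
Lemma energy_test_bound : (\int[mu]_x (G (enorm x) * k (enorm x))%:E <= (C ^+ 2)%:E)%E.
Proof.
have [E iG] := energy_testE.
have TE : (\int[mu]_x (G (enorm x) * k (enorm x))%:E = (T energy_test)%:E)%E.
  rewrite -E (Trho energy_test_admissible (closure_support energy_test_supp)).
  rewrite fineK// E; exact: integrable_fin_num.
have T0 : 0 <= T energy_test.
  by rewrite -lee_fin -TE; apply: integral_ge0 => x _; rewrite lee_fin flow_k_ge0// enorm_ge0.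
have := energy_test_norm; have := TC energy_test_admissible.
rewrite TE !lee_fin (ger0_norm T0).
have := Lnorm_ge0 mu 2%:E (EFin \o (@enorm R N \o grad energy_test)); rewrite -/(D12_norm _).
case: (D12_norm energy_test) => [D| |]//; rewrite ?poweR_EFin.
- rewrite -EFinM !lee_fin => D0 TCD.
  rewrite powR_mulrn// => DT.
  have [->|T1] := eqVneq (T energy_test) 0; first exact: sqr_ge0.
  have Tp : 0 < T energy_test by rewrite lt_neqAle eq_sym T1.
  rewrite -(ler_pM2r Tp) -expr2 (le_trans (_ : _ <= (C * D) ^+ 2))//.
    by rewrite lerXn2r ?nnegrE// (le_trans T0).
  by rewrite exprMn ler_wpM2l ?sqr_ge0.
- by move=> _ _; rewrite poweRyr ?pnatr_eq0// leye_eq.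
Qed.

(** On the ball of radius M the cutoff is 1 and G k = G g >= g^2; outside it G k is nonnegative. The
    resulting bound does not depend on M. *)
Lemma energy_bound_cutoff :
  primitive (fun s => g s ^+ 2 * s ^+ n.+2) M <= C ^+ 2 / sphere_area R n.+1.
Proof.
have A0 := sphere_area_gt0 R n.+1.
have g2c (r : R) : 0 < r -> {for r, continuous (fun s => g s ^+ 2)}.
  move=> r0; apply: (@continuous_comp _ _ _ g (fun y => y ^+ 2)); last exact: exprn_continuous.
  exact: gc.
rewrite ler_pdivlMr// mulrC -lee_fin EFinM.
apply: le_trans energy_test_bound.
have i2 : lam.-integrable `[0, M] (fun s => (g s ^+ 2 * s ^+ n.+2)%:E).
  apply: (@bounded_itv_integrable _ (fun s => g s ^+ 2 * s ^+ n.+2) _ (M ^+ n.+2)).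
    by move=> r r0; apply: continuousM; [exact: g2c|exact: exprn_continuous].
  move=> s /andP[s0 sM]; rewrite normrM [`|s ^+ _|]ger0_norm ?exprn_ge0// -[leRHS]mul1r.
  by rewrite ler_pM ?exprn_ge0// ?normrX ?exprn_ile1// lerXn2r ?nnegrE.
rewrite /primitive /Rintegral fineK; last exact: integrable_fin_num.
under eq_integral do rewrite EFinM.
rewrite -(@ge0_integral_cball R n.+1 (fun s => (g s ^+ 2)%:E)); last 2 first.
- by apply/measurable_EFinP; apply: itv_continuous_measurable.
- by move=> r _; rewrite lee_fin sqr_ge0.
have [_ /integrableP[mG _]] := energy_testE.
apply: (@le_trans _ _ (\int[mu]_(x in cball M) (G (enorm x) * k (enorm x))%:E)%E).
  apply: ge0_le_integral => //; [exact: measurable_cball| | | |].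
  - by move=> x _; rewrite lee_fin sqr_ge0.
  - by apply/measurable_EFinP/measurable_funTS; apply: (radial_measurable g2c).
  - exact: measurable_funTS.
  - by move=> x xM; rewrite lee_fin /k (cutoff1 xM) mulr1 mulrC.
apply: ge0_subset_integral => //; first exact: measurable_cball.
by move=> x _; rewrite lee_fin flow_k_ge0// enorm_ge0.
Qed.

End cutoff.

(* AM-GM: [2 |g| <= g^2 r^2 + r^-2], so that, for [r >= 1], [primitive g] is
   dominated by the bounded nondecreasing function [U] of the proof. *)
Lemma primitive_cvg (B : R) :
  (forall M, 0 <= M -> primitive (fun s => g s ^+ 2 * s ^+ n.+2) M <= B) ->
  exists l : R, primitive g r @[r --> +oo] --> l.
Proof.
set k := fun s => _; move=> SB.
have kc (r : R) : 0 < r -> {for r, continuous k}.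
  move=> r0; apply: continuousM; last exact: exprn_continuous.
  apply: (@continuous_comp _ _ _ g (fun y => y ^+ 2)); last exact: exprn_continuous.
  exact: gc.
have ik r : lam.-integrable `[0, r] (EFin \o k).
  apply: (@bounded_itv_integrable _ k _ (r ^+ n.+2) kc).
  move=> s /andP[s0 sM]; rewrite normrM [`|s ^+ _|]ger0_norm ?exprn_ge0// -[leRHS]mul1r.
  by rewrite ler_pM ?exprn_ge0// ?normrX ?exprn_ile1// lerXn2r ?nnegrE// (le_trans s0).
have ig r : lam.-integrable `[0, r] (EFin \o g) by exact: (@bounded_itv_integrable _ _ _ 1 gc).
pose U (r : R) := (primitive k r - (r ^+ 1)^-1) / 2.
pose u (r : R) := (k r + (r ^+ 2)^-1) / 2.
have dU (r : R) : 0 < r -> is_derive r 1 U (u r).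
  move=> r0; rewrite /U /u [_ / 2]mulrC.
  rewrite [X in is_derive _ _ X](_ : _ = fun r => 2^-1 * (primitive k r - (r ^+ 1)^-1));
    last first.
    by apply/funext => t; rewrite mulrC.
  apply: derZ; rewrite -[_^-1]opprK; apply: derB; first exact: primitive_der.
  by have := der_invX 0 r0; rewrite mul1r.
have gu (r : R) : 1 <= r -> `|g r| <= u r.
  move=> r1; have r0 : 0 < r by rewrite (lt_le_trans ltr01).
  rewrite /u ler_pdivlMr//.
  have H : 0 <= (`|g r| * r - r^-1) ^+ 2 by rewrite sqr_ge0.
  have E : (`|g r| * r - r^-1) ^+ 2 = g r ^+ 2 * r ^+ 2 - 2 * `|g r| + (r ^+ 2)^-1.
    by rewrite -[g r ^+ 2]real_normK ?num_real//; field; rewrite gt_eqF.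
  have H2 : g r ^+ 2 * r ^+ 2 <= k r.
    by rewrite /k ler_wpM2l ?sqr_ge0// ler_weXn2l.
  by rewrite E in H; lra.
(* Composition with m turns monotonicity on [1, +oo[ into monotonicity on the whole line without
   changing the behaviour at infinity. *)
pose m (r : R) := Num.max r 1.
have m1 r : 1 <= m r by rewrite /m le_max lexx orbT.
have mle : {homo m : r s / r <= s}.
  by move=> r s rs; rewrite /m ge_max !le_max rs lexx/= orbT.
have gt0 (s x : R) : 1 <= s -> s <= x -> 0 < x.
  by move=> s1 sx; rewrite (lt_le_trans ltr01)// (le_trans s1).
(* Three values of c are used: 0 for the convergence of U, 1 for that of U + [primitive g], and -1
   for the upper bound on the latter. The limit of [primitive g] is the difference of the first two
   limits. *)
have nd (c : R) : `|c| <= 1 -> {homo (fun r => U (m r) + c * primitive g (m r)) : r s / r <= s}.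
  move=> c1 r s /mle rs.
  apply: (@der_ge0_le _ (fun r => U r + c * primitive g r) (fun r => u r + c * g r)) => //.
    move=> x /andP[/(gt0 _ _ (m1 _)) x0 _].
    by apply: derD; [exact: dU|apply: derZ; exact: primitive_der].
  move=> x /andP[rx _]; have /gu gx : 1 <= x by rewrite (le_trans (m1 r)).
  have : `|c * g x| <= `|g x| by rewrite normrM ler_piMl.
  by have := ler_norm (- (c * g x)); rewrite normrN; lra.
have UB r : U (m r) <= B / 2.
  have r0 : 0 < m r by exact: gt0 (m1 r) (lexx _).
  rewrite /U ler_pM2r ?invr_gt0// (le_trans (_ : _ <= primitive k (m r)))//.
    by rewrite gerBl invr_ge0 exprn_ge0// ltW.
  by rewrite SB// ltW.
have nd0 : {homo (U \o m) : r s / r <= s}.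
  by move=> r s rs; have := nd 0 _ r s rs; rewrite !mul0r !addr0; apply; rewrite normr0.
have [l0 c0] : exists l : R, U (m r) @[r --> +oo] --> l.
  eexists; apply: nondecreasing_cvgr nd0 _.
  by exists (B / 2) => _ [r _ <-]; exact: UB.
have [l1 c1] : exists l : R, U (m r) + 1 * primitive g (m r) @[r --> +oo] --> l.
  eexists; apply: nondecreasing_cvgr; first by apply: nd; rewrite normr1.
  exists (B - (U 1 - primitive g 1)) => _ [r _ <-].
  have := nd (-1) _ (Num.min r 0) r; rewrite normrN normr1 lexx ge_min lexx => /(_ isT isT).
  rewrite [m (Num.min r 0)]/m (max_idPr _); last by rewrite ge_min ler01 orbT.
  by have := UB r; lra.
exists (l1 - l0).
apply: (@cvg_trans _ _ _ _ _ (cvgB c1 c0)).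
apply: near_eq_cvg; near=> r; rewrite !fctE /= mul1r addrAC subrr add0r; congr primitive.
by rewrite /m (max_idPl _)//; near: r; exact: nbhs_pinfty_ge.
Unshelve. all: by end_near. Qed.

End energy.

(** * Comparison of the weak solution with the radial profile *)

Section comparison.
Context (R : realType) (n : nat).
Local Notation N := n.+3.
Local Notation V := 'rV[R]_N.
Local Notation mu := (lebesgue_rV R N).
Local Notation RT := (measurableTypeR R).
Local Notation lam := (@lebesgue_measure R).
Local Notation e i := (delta_mx ord0 i : V).

(** A nonzero value persists on a ball, and balls have positive measure. *)
Lemma continuous_ae_eq0 (f : V -> R) : continuous f ->
  {ae mu, forall x, f x = 0} -> forall x, f x = 0.
Proof.
move=> cf [A [mA A0 fA]] x; apply/eqP/negPn/negP => fx.
have mf := continuous_measurable_rV cf.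
have /nbhs_ballP[d /= d0 dP] : nbhs x [set y | f y != 0].
  have c0 : {for x, continuous (fun y => `|f y|)}.
    by apply: (@continuous_comp _ _ _ f (fun y : R => `|y|)); [exact: cf|exact: norm_continuous].
  have : \forall y \near x, 0 < `|f y|.
    by apply: (@cvgr_gt _ _ (nbhs x) _ _ _ c0); rewrite normr_gt0.
  by apply: filterS => y; rewrite normr_gt0.
have d2 : 0 < d / 2 by rewrite divr_gt0.
have : mu ((fun y => y + - x) @^-1` cball (d / 2)) = 0%E.
  apply: (subset_measure0 _ mA _ A0).
    rewrite -[X in measurable X]setTI; apply: measurable_translation => //.
    exact: measurable_cball.
  move=> y /= yx; apply: fA => /=; apply/eqP; apply: dP.
  rewrite -ball_normE/= distrC (le_lt_trans (norm_le_enorm _))// (le_lt_trans yx)//.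
  by rewrite ltr_pdivrMr// ltr_pMr// ltr1n.
rewrite lebesgue_rV_translation; last exact: measurable_cball.
rewrite mu_cball => -[/eqP]; rewrite gt_eqF// /ball_cumul mulr_gt0 ?ball_volume_gt0//.
by rewrite exprn_gt0// lt_max d2.
Qed.

Definition pos2 (t : R) : R := Num.max t 0 ^+ 2.

Lemma der_pos2 (t : R) : is_derive t 1 pos2 (2 * Num.max t 0).
Proof.
apply: is_derive1_remainder => ee e0.
have : \forall y \near t, `|t - y| < ee by apply: (@cvgr_dist_lt _ _ _ (nbhs t)).
apply: filterS => y yt; rewrite (le_trans (_ : _ <= `|y - t| * `|y - t|))//; last first.
  by rewrite ler_wpM2r// distrC ltW.
rewrite -normrM -expr2 [leRHS]ger0_norm ?sqr_ge0// /pos2 ler_norml.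
have := sqr_ge0 (y - t); have := sqr_ge0 y; have := sqr_ge0 t.
rewrite !expr2; case: (leP t 0) => t0; case: (leP y 0) => y0 h1 h2 h3; apply/andP; split; nra.
Qed.

Variable eps : R.
Hypothesis eps0 : 0 < eps.

(** A choice of S: odd, nondecreasing, zero exactly on [-eps, eps]. The squares make it C^1, so that
    the chain rule holds wherever w is derivable, also where |w| = eps. *)
Definition trunc (t : R) : R := pos2 (t - eps) - pos2 (- t - eps).
Definition trunc' (t : R) : R := 2 * Num.max (t - eps) 0 + 2 * Num.max (- t - eps) 0.

Lemma trunc'_ge0 t : 0 <= trunc' t.
Proof. by rewrite addr_ge0// mulr_ge0// le_max lexx orbT. Qed.

Lemma der_trunc (t : R) : is_derive t 1 trunc (trunc' t).
Proof.
have -> : trunc' t = 2 * Num.max (t - eps) 0 * (1 - 0) - 2 * Num.max (- t - eps) 0 * (- 1 - 0).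
  by rewrite /trunc'; ring.
have d1 : is_derive t 1 (fun s : R => s - eps) (1 - 0).
  exact: (derB (der_id t) (der_cst eps t 1)).
have d2 : is_derive t 1 (fun s : R => - s - eps) (- 1 - 0).
  exact: (derB (derN (der_id t)) (der_cst eps t 1)).
apply: derB.
  exact: (@der_comp R R pos2 (fun s => s - eps) t 1 _ _ (der_pos2 (t - eps)) d1).
exact: (@der_comp R R pos2 (fun s => - s - eps) t 1 _ _ (der_pos2 (- t - eps)) d2).
Qed.

Lemma trunc'_continuous : continuous trunc'.
Proof.
apply: (@klip_continuous _ _ 4) => s t; rewrite /trunc'.
have H (a b : R) : `|Num.max a 0 - Num.max b 0| <= `|a - b|.
  by case: (leP a 0) => a0; case: (leP b 0) => b0; rewrite ler_norml;
    case: (ler0P (a - b)) => h; apply/andP; split; lra.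
have h1 := H (s - eps) (t - eps); have h2 := H (- s - eps) (- t - eps).
rewrite (_ : _ - _ = 2 * (Num.max (s - eps) 0 - Num.max (t - eps) 0) +
  2 * (Num.max (- s - eps) 0 - Num.max (- t - eps) 0)); last by ring.
rewrite (le_trans (ler_normD _ _))// !normrM !(ger0_norm (ler0n R 2)).
rewrite (_ : s - eps - (t - eps) = s - t) in h1; last by ring.
rewrite (_ : - s - eps - (- t - eps) = t - s) in h2; last by ring.
by rewrite [`|t - s|]distrC in h2; lra.
Qed.

Lemma trunc_eq0 t : `|t| <= eps -> trunc t = 0.
Proof.
rewrite ler_norml => /andP[h1 h2]; rewrite /trunc /pos2.
by rewrite !(max_idPr _) ?subrr//; lra.
Qed.

Lemma trunc_neq0 t : trunc t = 0 -> `|t| <= eps.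
Proof.
rewrite /trunc /pos2 ler_norml.
case: (leP (t - eps) 0) => h1; case: (leP (- t - eps) 0) => h2 h; apply/andP.
- by split; lra.
- by have := exprn_gt0 2 h2; rewrite expr0n/= in h; lra.
- by have := exprn_gt0 2 h1; rewrite expr0n/= in h; lra.
- by exfalso; have := addr_gt0 h1 h2; have := eps0; clear; lra.
Qed.

End comparison.

Section identification.
Context (R : realType) (n : nat).
Local Notation N := n.+3.
Local Notation V := 'rV[R]_N.
Local Notation mu := (lebesgue_rV R N).
Local Notation lam := (@lebesgue_measure R).
Local Notation e i := (delta_mx ord0 i : V).

Variables (L : R -> R) (HL : singular_lagrangian L).
Local Notation b p := (lag_b L (enorm p ^+ 2 / 2)).

(** Twice the right-hand side is (b p + b q) |p - q|^2 + (b p - b q) (|p|^2 - |q|^2). The second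
    term is nonnegative because b is nondecreasing, and b >= 1 bounds the first one below. *)
Lemma lag_field_monotone (p q : V) : enorm p < 1 -> enorm q < 1 ->
  enorm (p - q) ^+ 2 <= dot (b p *: p - b q *: q) (p - q).
Proof.
move=> p1 q1.
have half_sqr (v : V) : enorm v < 1 -> 0 <= enorm v ^+ 2 / 2 < 2^-1.
  by move=> v1; rewrite divr_ge0 ?sqr_ge0//= ltr_pdivrMr// mulVf// expr_lt1// enorm_ge0.
have bp1 := lag_b_ge1 HL (half_sqr _ p1); have bq1 := lag_b_ge1 HL (half_sqr _ q1).
have M : 0 <= (b p - b q) * (enorm p ^+ 2 - enorm q ^+ 2).
  have [pq|/ltW pq] := leP (enorm p ^+ 2) (enorm q ^+ 2).
    rewrite mulr_le0// subr_le0//; apply: (lag_b_ndecr HL).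
    - by have /andP[] := half_sqr _ p1.
    - by rewrite ler_pM2r// invr_gt0.
    - by have /andP[] := half_sqr _ q1.
  rewrite mulr_ge0// subr_ge0//; apply: (lag_b_ndecr HL).
  - by have /andP[] := half_sqr _ q1.
  - by rewrite ler_pM2r// invr_gt0.
  - by have /andP[] := half_sqr _ p1.
move: M bp1 bq1; set bp := b p; set bq := b q => M bp1 bq1; move: M; rewrite !enorm_sqr.
have D0 : 0 <= dot (p - q) (p - q) by exact: dot_ge0.
have -> : dot (bp *: p - bq *: q) (p - q) =
    ((bp + bq) * dot (p - q) (p - q) + (bp - bq) * (dot p p - dot q q)) / 2.
  rewrite !(dotDl, dotDr, dotNl, dotNr, dotZl, dotZr) [dot q p]dotC; by field.
move=> M; rewrite ler_pdivlMr//; nra.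
Qed.

Variables (rho : R -> R) (xi : R).
Hypothesis xi0 : 0 < xi.
Hypothesis rhoc : forall r : R, 0 < r -> {for r, continuous rho}.
Hypothesis rhoN : (\int[mu]_(x in eball xi) (`|rho (enorm x)| ^+ N)%:E < +oo)%E.
Local Notation G := (flow n.+1 rho).

Variable g : R -> R.
Hypothesis gc : forall r : R, 0 < r -> {for r, continuous g}.
Hypothesis g1 : forall r : R, `|g r| < 1.
Hypothesis gG : forall r : R, lag_flux L (g r) = G r.

Variable l : R.
Hypothesis gl : primitive g r @[r --> +oo] --> l.

Variables (T : (V -> R) -> R) (phi0 : V -> R).
Hypothesis Trho : represented_by T (rho \o @enorm R N).
Hypothesis phi0T : weak_solution L T phi0.
Hypothesis phi0_oo : vanishes_at_infinity phi0.

Let P (r : R) := l - primitive g r.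

Let gi r : lam.-integrable `[0, r] (EFin \o g).
Proof. by apply: (@bounded_itv_integrable _ _ _ 1 gc) => s _; exact: ltW. Qed.

Lemma profile_der (r : R) : 0 < r -> is_derive r 1 P (- g r).
Proof.
move=> r0; rewrite -[- g r]add0r; apply: (@derD R R (fun=> _) (fun r => - primitive g r)).
by apply: derN; exact: primitive_der.
Qed.

Lemma profile_lip (r s : R) : 0 <= r -> 0 <= s -> `|P r - P s| <= `|r - s|.
Proof.
move=> r0 s0; have -> : P r - P s = primitive g s - primitive g r by rewrite /P; ring.
rewrite distrC -[leRHS]mul1r.
by apply: primitive_lip => // t _; exact: ltW.
Qed.

(** Tested with phi0 itself, the weak equation has an integrable integrand, hence finite almost
    everywhere; it equals +oo wherever the gradient has norm at least 1. *)
Lemma grad_lt1_ae : {ae mu, forall x, enorm (grad phi0 x) < 1}.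
Proof.
have [aphi H] := phi0T; have [/integrable_ae + _] := H _ aphi.
move=> /(_ measurableT); apply: ae_impl => x /(_ I).
rewrite /lag_bE; case: ifPn => [h _|].
  move: h; rewrite ltr_pdivrMr// mulVf// => h.
  by rewrite -(@ltr_pXn2r _ 2)// ?nnegrE ?enorm_ge0// expr1n.
rewrite -leNgt ler_pdivlMr// mulVf// -enorm_sqr => h.
by rewrite gt0_mulye// lte_fin (lt_le_trans ltr01).
Qed.

Let w (x : V) := phi0 x - P (enorm x).

Let w_lip : exists k, 0 <= k /\ forall x y, `|w x - w y| <= k * `|x - y|.
Proof.
have [[_ /lipschitzP[k kP] _] _] := phi0T.
exists (`|k| + N%:R); split; first by rewrite addr_ge0.
move=> x y; have -> : w x - w y = (phi0 x - phi0 y) - (P (enorm x) - P (enorm y))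
  by rewrite /w; ring.
rewrite (le_trans (ler_normB _ _))// mulrDl lerD//.
  by rewrite (le_trans (kP x y))// ler_wpM2r// ler_norm.
exact: (radial_lip profile_lip).
Qed.

Let w_oo (d : R) : 0 < d -> exists M, forall x, M < enorm x -> `|w x| < d.
Proof.
move=> d0; have d2 : 0 < d / 2 by rewrite divr_gt0.
have [M1 HM1] := phi0_oo d2.
move/cvgrPdist_lt : gl => /(_ _ d2)[M2 [_ HM2]].
exists (Num.max M1 M2) => x; rewrite gt_max => /andP[/HM1 h1 /HM2 /= h2].
rewrite (le_lt_trans (ler_normB _ _))// [ltRHS](splitr d) ltrD//.
Qed.

Let w_bounded : exists B, 0 < B /\ forall x, `|w x| <= B.
Proof.
have [k [_ /lip_rV_continuous wc]] := w_lip.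
have [M HM] := w_oo ltr01; have [C HC] := continuous_bounded_eball M wc.
exists (`|C| + 1); split; first by rewrite ltr_wpDl.
move=> x; have [/HC h|/HM/ltW h] := leP (enorm x) M.
  by rewrite (le_trans h)// (le_trans (ler_norm C))// lerDl.
by rewrite (le_trans h)// lerDr.
Qed.

Section level.
Variable eps : R.
Hypothesis eps0 : 0 < eps.

Let psi (x : V) := trunc eps (w x).

(** The function [trunc] grows quadratically and is Lipschitz on bounded intervals only; the bound
    on w supplies such an interval. *)
Let psi_lip : exists k, 0 <= k /\ forall x y, `|psi x - psi y| <= k * `|x - y|.
Proof.
have [B [B0 wB]] := w_bounded; have [kw [kw0 wk]] := w_lip.
have [|kS HS] := @C1_lip R (trunc eps) (trunc' eps) (- B) B _ (der_trunc eps)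
  (@trunc'_continuous R eps).
  by rewrite gt0_cp.
exists (`|kS| * kw); split; first by rewrite mulr_ge0.
move=> x y; have H := HS (w x) (w y); rewrite -!ler_norml in H.
rewrite (le_trans (H _ _))// (le_trans (ler_wpM2r _ (ler_norm kS)))// -mulrA.
by rewrite ler_wpM2l.
Qed.

Let psi_supp : exists M, forall x, M < enorm x -> psi x = 0.
Proof.
by have [M HM] := w_oo eps0; exists M => x /HM /ltW; exact: trunc_eq0.
Qed.

Let q (x : V) : V := (- g (enorm x) / enorm x) *: x.

Let psi_grad : {ae mu, forall x, x != 0 /\ forall i,
  is_derive x (e i) psi (trunc' eps (w x) * (grad phi0 x ord0 i - q x ord0 i))}.
Proof.
have [[_ /lipschitzP[k kP] _] _] := phi0T.
have : {ae mu, forall x, forall i, derivable phi0 x (e i)}.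
  apply: ae_forall => i; apply: (ae_derivable_along (lip_rV_along kP i)).
  exact: lip_rV_measurable kP.
move: (@ae_neq0 R n); apply: ae_impl2 => x x0 d; split=> // i.
apply: (@der_comp R _ (trunc eps) w); first exact: der_trunc.
apply: derB.
  by rewrite mxE; apply: DeriveDef.
have := radial_partial profile_der i x0.
by rewrite !mxE mulrAC mulrA; exact.
Qed.

Let dpartE (f : V -> R) x i a : is_derive x (e i) f a -> dpart i f x = a /\ partial i f x = a.
Proof. by move=> [d1 d2]; rewrite /dpart /partial; case: asboolP => // _; rewrite d2. Qed.

Let q_lt1 x : x != 0 -> enorm (q x) = `|g (enorm x)|.
Proof.
move=> x0; rewrite enormZ normrM normrN normfV [`|enorm x|]ger0_norm ?enorm_ge0//.
by rewrite divfK// enorm_eq0.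
Qed.

(* Test the weak equation of phi0 and the divergence identity of the profile with
   the same multiple of psi: the difference has a nonnegative integrand. *)
Let psi_crit : {ae mu, forall x, forall i, dpart i psi x = 0}.
Proof.
have [k [k0 psik]] := psi_lip; have [M psiM] := psi_supp.
(* Each partial derivative of c psi is at most c k, so that its gradient has Euclidean norm at most
   N c k <= 1. *)
pose c := (N%:R * k + 1)^-1.
have Nk : 0 < N%:R * k + 1 by rewrite ltr_wpDl// mulr_ge0.
have c0 : 0 < c by rewrite invr_gt0.
pose eta (x : V) := c * psi x.
have eta_grad : {ae mu, forall x, x != 0 /\ forall i, is_derive x (e i) eta
    (c * (trunc' eps (w x) * (grad phi0 x ord0 i - q x ord0 i)))}.
  by move: psi_grad; apply: ae_impl => x [x0 d]; split=> // i; apply: derZ.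
have etak x y : `|eta x - eta y| <= (c * k) * `|x - y|.
  by rewrite /eta -mulrBr normrM gtr0_norm// -mulrA ler_pM2l.
have etaM x : M < enorm x -> eta x = 0 by move=> /psiM; rewrite /eta => ->; rewrite mulr0.
have eta_adm : admissible eta.
  apply: (compact_lip_admissible _ etak etaM) => //.
  move: eta_grad; apply: ae_impl => x [x0 d]; rewrite exprn_ile1 ?enorm_ge0//.
  rewrite (le_trans (enorm_le_sum _))// (le_trans (_ : _ <= \sum_(i < N) c * k))//.
    apply: ler_sum => i _; rewrite mxE; have [<- ->] := dpartE (d i).
    have := dpart_bound (lip_rV_along etak i) x.
    by rewrite normr_id [`|c * k|]ger0_norm// mulr_ge0// ltW.
  rewrite sumr_const card_ord -mulr_natl mulrCA /c ler_pdivrMl// mulr1.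
  by rewrite lerDl.
have [_ H] := phi0T; have [iF EF] := H _ eta_adm.
have [i1 i2 E] := flux_divergence xi0 rhoc rhoN etak etaM.
set F := (fun x => _) in iF EF.
pose D (x : V) := (F x - (- (G (enorm x) / enorm x) * \sum_i x ord0 i * dpart i eta x)%:E)%E.
have mD : measurable_fun setT D.
  by have /integrableP[] := integrableB measurableT iF i2.
have D0 : (\int[mu]_x D x = 0)%E.
  rewrite /D (integralB measurableT iF i2) -E EF.
  rewrite (Trho eta_adm (closure_support etaM)) /Rintegral fineK ?subee//.
  - exact: integrable_fin_num i1.
  - exact: integrable_fin_num i1.
have DE : {ae mu, forall x, D x = (c * trunc' eps (w x) *
    dot (b (grad phi0 x) *: grad phi0 x - b (q x) *: q x) (grad phi0 x - q x))%:E /\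
    (enorm (grad phi0 x) < 1 /\ enorm (q x) < 1)}.
  move: grad_lt1_ae eta_grad; apply: ae_impl2 => x p1 [x0 d].
  have q1 : enorm (q x) < 1 by rewrite q_lt1.
  split=> //; rewrite /D /F /lag_bE ifT; last first.
    by rewrite ltr_pdivrMr// mulVf// expr_lt1// enorm_ge0.
  have gE : grad eta x = (c * trunc' eps (w x)) *: (grad phi0 x - q x).
    apply/rowP => i; rewrite mxE; have [_ ->] := dpartE (d i).
    by rewrite !mxE mulrA.
  have sE : - (G (enorm x) / enorm x) * \sum_i x ord0 i * dpart i eta x =
      dot (b (q x) *: q x) (grad eta x).
    have -> : \sum_i x ord0 i * dpart i eta x = dot x (grad eta x).
      apply: eq_bigr => i _; rewrite mxE.
      by have [-> ->] := dpartE (d i).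
    rewrite -dotZl; congr dot; rewrite q_lt1// real_normK ?num_real// /q scalerA.
    by rewrite -gG /lag_flux; congr (_ *: _); ring.
  rewrite sE -EFinM -EFinB; congr EFin.
  rewrite -[lag_b _ _ * _]dotZl -dotNl -dotDl gE dotZr.
  by [].
have Dge0 : {ae mu, forall x, (0 <= D x)%E}.
  move: DE; apply: ae_impl => x [-> [p1 q1]]; rewrite lee_fin mulr_ge0//.
    by rewrite mulr_ge0 ?trunc'_ge0// ltW.
  by rewrite (le_trans _ (lag_field_monotone p1 q1))// sqr_ge0.
have Dabs : (\int[mu]_x `|D x| = 0)%E.
  rewrite -D0; apply: ae_eq_integral => //; first exact: measurableT_comp.
  by move: Dge0; apply: ae_impl => x h _; rewrite gee0_abs.
have /(ae_eq_integral_abs _ measurableT mD) Dae := Dabs.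
move: Dae DE psi_grad; apply: ae_impl3 => x /(_ I) Dx0 [DxE [p1 q1]] [x0 d] i.
have [-> _] := dpartE (d i).
(* Either the factor [trunc'] is 0, or it can be cancelled and the coercive monotonicity forces
   [grad phi0 x = q x]; in both cases the derivative of psi vanishes. *)
have := trunc'_ge0 eps (w x); rewrite le_eqVlt => /predU1P[<-|t0]; first by rewrite mul0r.
move: Dx0; rewrite DxE => -[/eqP]; rewrite mulf_eq0 gt_eqF ?mulr_gt0//= => /eqP dot0.
have := lag_field_monotone p1 q1; rewrite dot0 exprn_even_le0//= enorm_eq0 subr_eq0 => /eqP ->.
by rewrite subrr mulr0.
Qed.

(** The field x has divergence N. Tested against psi^2, whose gradient is 0 almost everywhere, it
    gives N times the integral of psi^2 equal to 0; hence psi = 0, that is |w| <= eps. *)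
Lemma profile_dist x : `|phi0 x - P (enorm x)| <= eps.
Proof.
have [k [k0 psik]] := psi_lip; have [M psiM] := psi_supp.
have psic := lip_rV_continuous psik; have mpsi := lip_rV_measurable psik.
have [C psiC] : exists C, forall x, `|psi x| <= C.
  have [C HC] := continuous_bounded_eball M psic.
  exists `|C| => y; have [yM|/psiM ->] := leP (enorm y) M; last by rewrite normr0.
  by rewrite (le_trans (HC y yM))// ler_norm.
pose sq (y : V) := psi y ^+ 2.
have sqk y z : `|sq y - sq z| <= (k * (C + C)) * `|y - z|.
  rewrite /sq subr_sqr normrM mulrAC ler_pM//.
  by rewrite (le_trans (ler_normD _ _))// lerD.
have sqM y : M < enorm y -> sq y = 0 by move=> /psiM; rewrite /sq => ->; rewrite expr0n.
have sq0 : {ae mu, forall y, forall i, dpart i sq y = 0}.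
  move: psi_crit psi_grad; apply: ae_impl2 => y dy [_ d] i.
  have [d1 _] := dpartE (d i); have [-> _] := dpartE (derX 1 (d i)).
  by rewrite -d1 dy mulr0.
have mB := @measurable_cball R n.+1 M.
have H := @radial_divergence R n.+1 (fun=> 1) (fun=> 0) M (k * (C + C)) sq.
have : (\int[mu]_x (N%:R * sq x)%:E = 0)%E.
  rewrite -[RHS]H//.
  - have msq : measurable_fun setT sq by exact: (lip_rV_measurable sqk).
    apply: ae_eq_integral => //.
    + by apply/measurable_EFinP; apply: measurable_funM.
    + apply/measurable_EFinP; apply: measurable_funD.
        apply: measurable_funM => //; apply: measurable_funD => //.
        by apply: measurable_funM => //; exact: measurable_enorm.
      apply: measurable_funM => //; apply: measurable_sum => i.
      apply: measurable_funM; first exact: measurable_coord.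
      exact: (measurable_dpart (lip_rV_along sqk i) msq).
    + move: sq0; apply: ae_impl => y dy _; congr EFin.
      by rewrite big1 ?mulr0 ?addr0 ?mulr1// => i _; rewrite dy mulr0.
  - by move=> r r0; exact: cst_continuous.
  - apply: (@measurable_bounded_integrable _ _ _ mu (fun=> 1) (cball M)) => //;
      first exact: cball_lty.
    by exists 1; split; rewrite ?num_real// => y y1 z _; rewrite /= normr1 ltW.
  - by under eq_fun do rewrite mulr0; exact: integrable0.
move=> I0; have sqc : continuous sq by exact: (lip_rV_continuous sqk).
have msq : measurable_fun setT (fun y => (N%:R * sq y)%:E).
  by apply/measurable_EFinP; apply: measurable_funM => //; exact: (lip_rV_measurable sqk).
have : (\int[mu]_y `|(N%:R * sq y)%:E| = 0)%E.
  rewrite -I0; apply: eq_integral => y _.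
  by rewrite gee0_abs// lee_fin mulr_ge0// sqr_ge0.
move=> /(ae_eq_integral_abs _ measurableT msq) sqae.
have : {ae mu, forall y, sq y = 0}.
  move: sqae; apply: ae_impl => y /(_ I) [/eqP].
  by rewrite mulf_eq0 pnatr_eq0/= => /eqP.
move=> /(continuous_ae_eq0 sqc) /(_ x) /eqP; rewrite sqrf_eq0 => /eqP.
exact: trunc_neq0.
Qed.

End level.

Lemma profileE x : phi0 x = P (enorm x).
Proof.
apply/eqP; rewrite -subr_eq0 -normr_le0; apply/ler_addgt0Pl => d d0.
by rewrite addr0; exact: profile_dist.
Qed.

End identification.

(** * Regularity *)

Section removable.
Context (R : realType) (n : nat).
Local Notation V := 'rV[R]_n.
Local Notation e i := (delta_mx ord0 i : V).

(** By the mean value theorem on the line spanned by v, f(y v) - f(0) = D(c v) y for some |c| <=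
    |y|, and D is continuous at 0. *)
Lemma removable_derivative (f D : V -> R) (v : V) : continuous f ->
  (forall x, x != 0 -> is_derive x v f (D x)) -> {for 0, continuous D} -> v != 0 ->
  is_derive 0 v f (D 0).
Proof.
move=> cf df cD v0; apply/is_derive_line0.
have cline (t : R) : {for t, continuous (fun h : R => 0 + h *: v)}.
  by apply: (@cvgD _ _ _ (nbhs t)); [exact: cvg_cst|apply: (@cvgZr_tmp _ _ _ (nbhs t))].
have cF : continuous (fun h : R => f (0 + h *: v)).
  by move=> t; apply: (@continuous_comp _ _ _ (fun h : R => 0 + h *: v) f);
    [exact: cline|exact: cf].
have dF (t : R) : t != 0 -> is_derive t 1 (fun h : R => f (0 + h *: v)) (D (0 + t *: v)).
  move=> t0; have tv0 : 0 + t *: v != 0 by rewrite add0r scaler_eq0 negb_or t0.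
  exact: (iffLR (@is_derive_line R _ f 0 v t (D (0 + t *: v))) (df _ tv0)).
apply: is_derive1_remainder => ee e0.
have : {for (0 : R), continuous (fun h : R => D (0 + h *: v))}.
  by apply: (@continuous_comp _ _ _ (fun h : R => 0 + h *: v) D);
    [exact: cline|rewrite /= scale0r addr0].
move=> /cvgrPdist_le /(_ _ e0) /nbhs_ballP[d /= d0 dP].
have H (c : R) : `|c| < d -> `|D (0 + c *: v) - D 0| <= ee.
  move=> cd; have := dP c; rewrite -ball_normE/= sub0r normrN => /(_ cd).
  by rewrite scale0r addr0 distrC.
apply/nbhs_ballP; exists d => //= y; rewrite -ball_normE/= sub0r normrN => yd.
rewrite subr0 scale0r addr0.
have [->|y0] := eqVneq y 0; first by rewrite scale0r addr0 subrr mulr0 subrr !normr0 mulr0.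
have cW a b : {within `[a, b], continuous (fun h : R => f (0 + h *: v))}.
  exact: continuous_subspaceT.
suff [c cy ->] : exists2 c : R, `|c| <= `|y| & f (0 + y *: v) - f 0 = D (0 + c *: v) * y.
  by rewrite -mulrBl normrM ler_wpM2r// H// (le_lt_trans cy).
have [yp|yn|ye] := ltgtP y 0; last by rewrite ye eqxx in y0.
  have dF' x : x \in `]y, 0[ -> is_derive x 1 (fun h : R => f (0 + h *: v)) (D (0 + x *: v)).
    by rewrite in_itv/= => /andP[_ x0]; apply: dF; rewrite lt_eqF.
  have [c + E] := MVT yp dF' (cW _ _); rewrite in_itv/= => /andP[yc c0].
  exists c; first by rewrite !ltr0_norm// lerN2 ltW.
  by move: E; rewrite scale0r addr0 sub0r mulrN => /eqP; rewrite -eqr_oppLR opprB => /eqP.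
have dF' x : x \in `]0, y[ -> is_derive x 1 (fun h : R => f (0 + h *: v)) (D (0 + x *: v)).
  by rewrite in_itv/= => /andP[x0 _]; apply: dF; rewrite gt_eqF.
have [c + E] := MVT yn dF' (cW _ _); rewrite in_itv/= => /andP[c0 cy].
exists c; first by rewrite !gtr0_norm// ltW.
by move: E; rewrite scale0r addr0 subr0.
Qed.

Lemma radial_cvg0 (q : R -> R) (l : R) : q r @[r --> 0^'+] --> l ->
  q (enorm x) @[x --> (0 : V)^'] --> l.
Proof.
move=> ql A /ql H; have {}H : \forall r \near 0^'+, A (q r) by exact: H.
move: H; rewrite /at_right near_withinE => H.
have : \forall x \near (0 : V), 0 < enorm x -> A (q (enorm x)).
  have ce := @enorm_continuous R n 0; rewrite /continuous_at enorm0 in ce; exact: ce _ H.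
move=> Hx; have : \forall x \near (0 : V)^', A (q (enorm x)).
  by rewrite /dnbhs near_withinE; move: Hx; apply: filterS => x h x0; apply: h; rewrite enorm_gt0.
exact.
Qed.

(** Restriction to the ray of [delta_mx ord0 i]. Only the values of q on nonnegative radii enter the
    hypothesis, whence a limit from the right. *)
Lemma cvg_radial0 (i : 'I_n) (q : R -> R) : {for (0 : V), continuous (q \o @enorm R n)} ->
  q r @[r --> 0^'+] --> q 0.
Proof.
move=> cq; have : {for (0 : R), continuous (fun r : R => q (enorm (r *: e i)))}.
  apply: (@continuous_comp _ _ _ (fun r : R => r *: e i) (q \o @enorm R n)).
    by apply: (@cvgZr_tmp _ _ _ (nbhs (0 : R))).
  by rewrite /= scale0r.
move=> /cvg_at_right_filter; rewrite /= scale0r enorm0; apply: cvg_trans.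
apply: near_eq_cvg; near=> r.
by rewrite enormZ enorm_delta mulr1 gtr0_norm//.
Unshelve. all: by end_near. Qed.

End removable.

Lemma at_right_comp (R : realType) (h f : R -> R) (a l : R) : f r @[r --> a^'+] --> l ->
  {for l, continuous h} -> h (f r) @[r --> a^'+] --> h l.
Proof. by move=> fl hl; exact: cvg_comp fl hl. Qed.

Lemma etrans_der (R : realType) (V : normedModType R) (f : V -> R) (x v : V) (a b : R) :
  a = b -> is_derive x v f a -> is_derive x v f b.
Proof. by move=> ->. Qed.

Section regularity.
Context (R : realType) (n : nat).
Local Notation N := n.+3.
Local Notation V := 'rV[R]_N.
Local Notation mu := (lebesgue_rV R N).
Local Notation e i := (delta_mx ord0 i : V).

Variables (rho : R -> R) (xi : R).
Hypothesis xi0 : 0 < xi.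
Hypothesis rhoc : forall r : R, 0 < r -> {for r, continuous rho}.
Hypothesis rhoN : (\int[mu]_(x in eball xi) (`|rho (enorm x)| ^+ N)%:E < +oo)%E.
Local Notation G := (flow n.+1 rho).

Variables h dh : R -> R.
Hypothesis h1 : forall y, `|h y| < 1.
Hypothesis hle : forall y, `|h y| <= `|y|.
Hypothesis hder : forall y : R, is_derive y 1 h (dh y).
Hypothesis dhc : continuous dh.
Hypothesis dh0 : dh 0 = 1.

Definition slope (r : R) : R := h (G r).
Definition slope' (r : R) : R := dh (G r) * (rho r - n.+2%:R * (G r / r)).

Lemma slope_der (r : R) : 0 < r -> is_derive r 1 slope (slope' r).
Proof.
by move=> r0; apply: (@der_comp R R h G) => //; exact: (flow_der xi0 rhoc rhoN).
Qed.

Lemma slope_continuous (r : R) : 0 < r -> {for r, continuous slope}.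
Proof. by move=> /slope_der /is_derive1_continuous. Qed.

Let Gc (r : R) : 0 < r -> {for r, continuous G}.
Proof. exact: (flow_continuous xi0 rhoc rhoN). Qed.

Let invc (r : R) : 0 < r -> {for r, continuous (@GRing.inv R)}.
Proof. by move=> r0; apply: inv_continuous; rewrite gt_eqF. Qed.

Lemma slope'_continuous (r : R) : 0 < r -> {for r, continuous slope'}.
Proof.
move=> r0; apply: continuousM.
  by apply: (@continuous_comp _ _ _ G dh); [exact: Gc|exact: dhc].
apply: continuousB; first exact: rhoc.
apply: continuousM; first exact: cst_continuous.
by apply: continuousM; [exact: Gc|exact: invc].
Qed.

Section origin.
Hypothesis rho0 : {for (0 : V), continuous (rho \o @enorm R N)}.
Local Notation c := (rho 0 / N%:R).

Let rho_cvg : rho r @[r --> 0^'+] --> rho 0.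
Proof. exact: (cvg_radial0 ord0 rho0). Qed.

Let id_cvg : (r : R) @[r --> (0 : R)^'+] --> (0 : R).
Proof. by apply: cvg_at_right_filter; exact: cvg_id. Qed.

(** L'Hopital's rule for K(r) / r^N: the quotient of the derivatives is rho(r) / N. *)
Let flow_ratio : G r / r @[r --> 0^'+] --> c.
Proof.
have [C [C0 HC]] := flow_bound xi0 rhoc rhoN 1.
have powc k : (r : R) ^+ k.+1 @[r --> (0 : R)^'+] --> (0 : R).
  have := @at_right_comp R (fun t : R => t ^+ k.+1) id 0 0 id_cvg.
  by rewrite expr0n; apply; exact: exprn_continuous.
have near1 : \forall r \near (0 : R)^'+, 0 < r < 1.
  near=> r; apply/andP; split=> //; near: r; exact: nbhs_right_lt.
have := @lhopital_at_right R (mass n.+1 rho) (fun r => rho r * r ^+ n.+2)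
  (fun r => r ^+ N) (fun r => N%:R * r ^+ n.+2 * 1) 0 1 c ltr01.
have -> : (fun r => mass n.+1 rho r / r ^+ N) = (fun r => G r / r).
  by apply/funext => r; rewrite /flow exprSr invfM mulrA.
apply.
- by move=> x; rewrite in_itv/= => /andP[x0 _]; exact: (mass_der xi0 rhoc rhoN).
- by move=> x _; exact: (derX n.+2 (der_id x)).
- apply: norm_cvg0; apply: (@squeeze_cvgr _ _ _ _ (fun=> 0) (fun r => C * r ^+ n.+2)).
  + near=> r; rewrite normr_ge0/=.
    have /andP[r0 r1] : 0 < r < 1 by near: r.
    by have [] := HC r; rewrite ?(ltW r0) ?(ltW r1).
  + exact: cvg_cst.
  + by rewrite -[X in _ --> X](mulr0 C); apply: cvgM; [exact: cvg_cst|exact: powc].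
- exact: powc.
- by move=> x; rewrite in_itv/= => /andP[x0 _];
    rewrite mulr1 mulf_neq0 ?pnatr_eq0// expf_neq0// gt_eqF.
have : rho r / N%:R @[r --> 0^'+] --> c by apply: cvgM => //; exact: cvg_cst.
apply: cvg_trans.
  apply: near_eq_cvg; near=> r; have r0 : r != 0 by rewrite gt_eqF//.
  by rewrite /= mulr1 -mulf_div divff ?expf_neq0// mulr1.
Unshelve. all: by end_near. Qed.

Let flow0 : G r @[r --> 0^'+] --> 0.
Proof.
have : (G r / r) * r @[r --> 0^'+] --> c * 0 by exact: (cvgM flow_ratio id_cvg).
rewrite mulr0; apply: cvg_trans.
by apply: near_eq_cvg; near=> r; rewrite divfK// gt_eqF//.
Unshelve. all: by end_near. Qed.

(** Since [dh 0 = 1], the limit is rho(0) - (N - 1) c, which is c again. That g' and g/r share their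
    limit is what makes the Hessian continuous at the origin. *)
Let slope'_cvg : slope' r @[r --> 0^'+] --> c.
Proof.
have -> : c = 1 * (rho 0 - n.+2%:R * c) by field.
apply: cvgM.
  by rewrite -dh0; apply: (@at_right_comp R dh G 0 0 flow0); exact: dhc.
by apply: cvgB => //; apply: cvgM => //; exact: cvg_cst.
Qed.

Let slope0 : slope r @[r --> 0^'+] --> 0.
Proof.
have h0 : h 0 = 0 by apply/eqP; rewrite -normr_le0 (le_trans (hle 0))// normr0.
have := @at_right_comp R h G 0 0 flow0 (is_derive1_continuous (hder 0)).
by rewrite h0.
Qed.

Let slope_ratio : slope r / r @[r --> 0^'+] --> c.
Proof.
apply: (@lhopital_at_right R slope slope' (fun r => r) (fun=> 1) 0 1 c ltr01) => //.
- by move=> x; rewrite in_itv/= => /andP[x0 _]; exact: slope_der.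
by under eq_fun do rewrite divr1.
Qed.

Variable P : R -> R.
Hypothesis Plip : forall r s : R, 0 <= r -> 0 <= s -> `|P r - P s| <= `|r - s|.
Hypothesis Pder : forall r : R, 0 < r -> is_derive r 1 P (- slope r).

Let f (x : V) := P (enorm x).
Let D1 j (x : V) := - (slope (enorm x) / enorm x) * x ord0 j.
(** The Hessian of P(|x|) with P' = -g, written so that the only direction-dependent term carries
    the factor g' - g/r; the value at the origin is the limit. No such case is needed in [D1], where
    the coordinate is 0 at the origin. *)
Let D2 i j (x : V) := if x == 0 then - c * (i == j)%:R else
  - (slope (enorm x) / enorm x) * (i == j)%:R -
  (slope' (enorm x) - slope (enorm x) / enorm x) * (x ord0 i * x ord0 j / enorm x ^+ 2).

Let near_neq0 (x : V) : x != 0 -> \forall y \near x, y != 0.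
Proof.
rewrite -enorm_gt0 => x0.
have : \forall y \near x, 0 < enorm y.
  by apply: (@cvgr_gt _ _ (nbhs x) _ _ _ (@enorm_continuous R N x)).
by apply: filterS => y; rewrite enorm_gt0.
Qed.

Let f_continuous : continuous f.
Proof. exact: (lip_rV_continuous (radial_lip Plip)). Qed.

Let ratio_continuous (r : R) : 0 < r -> {for r, continuous (fun r : R => slope r / r)}.
Proof. by move=> r0; apply: continuousM; [exact: slope_continuous|exact: invc]. Qed.

Let D1_continuous j : continuous (D1 j).
Proof.
move=> x; have [->|x0] := eqVneq x 0; last first.
  apply: (@cvgM _ _ (nbhs x)); last exact: continuous_coord.
  apply: (@cvgN _ _ _ (nbhs x)); apply: (continuous_radial (f := fun r => slope r / r)).
  by apply: ratio_continuous; rewrite enorm_gt0.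
apply/(@continuous_withinNx _ _ (D1 j) (0 : V)).
have -> : D1 j 0 = - c * 0 by rewrite /D1 mxE !mulr0.
apply: (@cvgM _ _ (0 : V)^').
  by apply: (@cvgN _ _ _ (0 : V)^'); exact: (@radial_cvg0 R N (fun r =>
    slope r / r) c slope_ratio).
have : {for (0 : V), continuous (fun y : V => y ord0 j)} by exact: continuous_coord.
by move=> /(@continuous_withinNx _ _ (fun y : V => y ord0 j) (0 : V)); rewrite mxE.
Qed.

Let D2_continuous i j : continuous (D2 i j).
Proof.
move=> x; have [->|x0] := eqVneq x 0; last first.
  apply: (@near_eq_continuous _ _ (fun x : V => - (slope (enorm x) / enorm x) * (i == j)%:R -
      (slope' (enorm x) - slope (enorm x) / enorm x) * (x ord0 i * x ord0 j / enorm x ^+ 2))).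
    by have := near_neq0 x0; apply: filterS => y y0; rewrite /D2 (negbTE y0).
  have x0' : 0 < enorm x by rewrite enorm_gt0.
  have rc := continuous_radial (ratio_continuous x0').
  apply: (@cvgB _ _ _ (nbhs x)).
    apply: (@cvgM _ _ (nbhs x)); last exact: cvg_cst.
    by apply: (@cvgN _ _ _ (nbhs x)); exact: rc.
  apply: (@cvgM _ _ (nbhs x)).
    apply: (@cvgB _ _ _ (nbhs x)); last exact: rc.
    exact: (continuous_radial (slope'_continuous x0')).
  apply: (@cvgM _ _ (nbhs x)).
    by apply: (@cvgM _ _ (nbhs x)); exact: continuous_coord.
  apply: (continuous_radial (f := fun r : R => (r ^+ 2)^-1)).
  apply: (@continuous_comp _ _ _ (fun t : R => t ^+ 2) (@GRing.inv R));
    first exact: exprn_continuous.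
  by apply: invc; rewrite exprn_gt0.
apply/(@continuous_withinNx _ _ (D2 i j) (0 : V)).
have -> : D2 i j 0 = - c * (i == j)%:R - 0 by rewrite /D2 eqxx subr0.
(* The quotient x_i x_j / |x|^2 depends on the direction but is bounded by 1, while its factor tends
   to c - c = 0. *)
have H0 : (slope' (enorm x) - slope (enorm x) / enorm x) * (x ord0 i * x ord0 j / enorm x ^+ 2)
    @[x --> (0 : V)^'] --> (0 : R).
  have Z : slope' r - slope r / r @[r --> 0^'+] --> c - c by exact: (cvgB slope'_cvg slope_ratio).
  rewrite subrr in Z.
  have ZV := @radial_cvg0 R N (fun r => slope' r - slope r / r) 0 Z.
  apply/cvgrPdist_le => ee e0; move/cvgrPdist_le : ZV => /(_ _ e0).
  apply: filterS => y; rewrite !sub0r !normrN => ye.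
  rewrite normrM -[leRHS]mulr1 ler_pM//.
  have [->|y0] := eqVneq y 0; first by rewrite !mxE !mul0r normr0.
  have yp : 0 < enorm y by rewrite enorm_gt0.
  rewrite !normrM normfV [`|enorm y ^+ 2|]ger0_norm ?exprn_ge0 ?enorm_ge0//.
  by rewrite ler_pdivrMr ?exprn_gt0// mul1r expr2 ler_pM// normr_coord_enorm.
have H1 : - (slope (enorm x) / enorm x) * (i == j)%:R @[x --> (0 : V)^'] --> - c * (i == j)%:R.
  apply: (@cvgM _ _ (0 : V)^'); last exact: cvg_cst.
  by apply: (@cvgN _ _ _ (0 : V)^'); exact: (@radial_cvg0 R N (fun r =>
    slope r / r) c slope_ratio).
apply: (@cvg_trans _ _ _ _ _ (cvgB H1 H0)); apply: near_eq_cvg.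
rewrite /dnbhs near_withinE; near=> y => y0; rewrite /D2 ifN//.
Unshelve. all: by end_near. Qed.

Let f_der j x : is_derive x (e j) f (D1 j x).
Proof.
have H (y : V) : y != 0 -> is_derive y (e j) f (D1 j y).
  move=> y0; have := radial_partial Pder j y0.
  by rewrite /D1 !mulNr mulrA mulrAC.
have [->|] := eqVneq x 0; last exact: H.
by apply: removable_derivative => //; [exact: D1_continuous|exact: delta_neq0].
Qed.

Let D1_der i j x : is_derive x (e i) (D1 j) (D2 i j x).
Proof.
have H (y : V) : y != 0 -> is_derive y (e i) (D1 j) (D2 i j y).
  move=> y0; have yp : 0 < enorm y by rewrite enorm_gt0.
  have d1 := derN (derM (slope_der yp) (der_invX 0 yp)).
  have := derM (der_radial i y0 d1) (der_coord y i j).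
  rewrite (_ : (fun _ => _) = D1 j); last by apply/funext => z; rewrite /= expr1.
  apply: etrans_der; rewrite /D2 (negbTE y0) /= !expr1; field.
  by rewrite gt_eqF.
have [->|] := eqVneq x 0; last exact: H.
by apply: removable_derivative => //; [exact: D2_continuous|exact: delta_neq0].
Qed.

(* The second derivatives at the origin are limits of those outside it. *)
Lemma radial_classC2 : classC 2 f.
Proof.
have p1 j : partial j f = D1 j.
  by apply/funext => x; have [_ <-] := f_der j x.
have p2 i j : partial i (D1 j) = D2 i j.
  by apply/funext => x; have [_ <-] := D1_der i j x.
move=> [|i [|j [|k s]]]; split => //=; rewrite ?p1 ?p2 => _.
- by move=> x i; have [] := f_der i x.
- exact: D1_continuous.
- by move=> x j; have [] := D1_der j i x.
- exact: D2_continuous.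
Qed.

End origin.
End regularity.

(** * Equation and regularity of the weak solution *)

Unset Implicit Arguments.

Theorem theorem1p4 (R : realType) (N : nat) (L : R -> R)
    (T : ('rV[R]_N -> R) -> R) (rho : R -> R) (d e : \bar R) (xi : R)
    (phi0 : 'rV[R]_N -> R) :
  (3 <= N)%N ->
  singular_lagrangian L ->
  dual_admissible T ->
  radially_distributed T ->
  represented_by T (rho \o @enorm R N) ->
  (1 <= d)%E -> (N%:R%:E <= e)%E -> 0 < xi ->
  rho \o @enorm R N \in Lfun (lebesgue_rV R N) d ->
  (rho \o @enorm R N) \_ (eball xi) \in Lfun (lebesgue_rV R N) e ->
  (forall r : R, 0 < r -> {for r, continuous rho}) ->
  weak_solution L T phi0 ->
  vanishes_at_infinity phi0 ->
  exists phi : R -> R,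
    [/\ forall x, phi0 x = phi (enorm x),
        C2_on `]0, +oo[ phi,
        forall r : R, 0 < r ->
          [/\ lag_dom (derive1 phi r ^+ 2 / 2),
              derivable (flux N L phi) r 1 &
              - ((r ^+ N.-1)^-1 * derive1 (flux N L phi) r) = rho r]
      & {for 0, continuous (rho \o @enorm R N)} ->
        classC 2 phi0 /\
        - ((r ^+ N.-1)^-1 * derive1 (flux N L phi) r) @[r --> 0^'+] --> rho 0].
Proof.
case: N => [|[|[|n]]]// in T phi0 * => _ HL [_ [C TC]] _ Trho _ Ne xi0 _ rhoe rhoc phi0T phi0_oo.
set N := n.+3; pose mu := lebesgue_rV R N.
have rhoN : (\int[mu]_(x in eball xi) (`|rho (enorm x)| ^+ N)%:E < +oo)%E.
  apply: (Lfun_expn_integral_lty _ _ _ Ne rhoe) => //.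
  - exact: measurable_eball.
  - exact: lebesgue_eball_lty.
have [h [dh [h1 hK hle hder [dhc dh0]]]] := lag_flux_inverse HL.
pose g := slope n rho h; pose G := flow n.+1 rho.
have gc (r : R) : 0 < r -> {for r, continuous g}.
  exact: (slope_continuous xi0 rhoc rhoN hder).
have g1 r : `|g r| < 1 by exact: h1.
have gG r : lag_flux L (g r) = G r by exact: hK.
have gle r : `|g r| <= 1 by exact: ltW.
have half_sqr (r : R) : 0 <= g r ^+ 2 / 2 < 2^-1.
  rewrite divr_ge0 ?sqr_ge0//= ltr_pdivrMr// mulVf// -real_normK ?num_real//.
  by rewrite expr_lt1.
have gGe r : g r ^+ 2 <= g r * G r.
  rewrite -gG /lag_flux mulrCA -expr2 ler_peMl ?sqr_ge0//.
  exact: (lag_b_ge1 HL (half_sqr r)).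
have [l gl] : exists l : R, primitive g r @[r --> +oo] --> l.
  apply: (@primitive_cvg _ _ g gc gle (C ^+ 2 / sphere_area R n.+1)) => M M0.
  exact: (energy_bound_cutoff xi0 rhoc rhoN gc gle gGe M0 Trho TC).
have phiE := profileE HL xi0 rhoc rhoN gc g1 gG gl Trho phi0T phi0_oo.
pose P (r : R) := l - primitive g r.
have dP (r : R) : 0 < r -> is_derive r 1 P (- g r) by exact: (profile_der gc g1).
have Plip := profile_lip gc g1 l.
have dP1 (r : R) : 0 < r -> derive1 P r = - g r.
  by move=> /dP /is_derive1P[].
(* Because b(g^2/2) g = G and P' = -g, the flux of P is minus the mass, whose derivative is known;
   this holds for positive radii, hence only near r. *)
have flux_near (r : R) : 0 < r -> {near r, (fun t => - mass n.+1 rho t) =1 flux N L P}.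
  move=> r0; move: (near_gt0 r0); apply: filterS => t t0.
  rewrite /flux dP1// sqrrN mulrN mulNr -/(lag_flux L (g t)) gG /G /flow divfK//.
  by rewrite expf_neq0// gt_eqF.
have dflux (r : R) : 0 < r -> is_derive r 1 (flux N L P) (- (rho r * r ^+ n.+2)).
  move=> r0; apply: (der_near_eq (flux_near r r0)); first exact: oner_neq0.
  by apply: derN; exact: (mass_der xi0 rhoc rhoN).
have ode (r : R) : 0 < r -> - ((r ^+ N.-1)^-1 * derive1 (flux N L P) r) = rho r.
  move=> r0; have /is_derive1P[_ ->] := dflux r r0.
  by rewrite mulrN opprK mulrC mulfK// expf_neq0// gt_eqF.
exists P; split => //.
- move=> r; rewrite /= in_itv/= andbT => r0.
  have near1 (t : R) : 0 < t -> {near t, (fun s => - g s) =1 derive1 P}.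
    by move=> t0; move: (near_gt0 t0); apply: filterS => s s0; rewrite dP1.
  have d2 (t : R) : 0 < t -> is_derive t 1 (derive1 P) (- slope' n rho dh t).
    move=> t0; apply: (der_near_eq (near1 t t0)); first exact: oner_neq0.
    by apply: derN; exact: (slope_der xi0 rhoc rhoN hder).
  split; first by have [] := dP r r0.
    by have [] := d2 r r0.
  apply: (@near_eq_continuous _ _ (fun t => - slope' n rho dh t)).
    move: (near_gt0 r0); apply: filterS => t /d2 /is_derive1P[_ <-].
    by [].
  by apply: continuousN; exact: (slope'_continuous xi0 rhoc rhoN dhc).
- move=> r r0; split; last exact: ode.
    by rewrite dP1// sqrrN /lag_dom /= in_itv; exact: half_sqr.
  by have [] := dflux r r0.
- move=> rho0; split.
    have -> : phi0 = fun x => P (enorm x) by apply/funext.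
    exact: (radial_classC2 xi0 rhoc rhoN hle hder dhc dh0 rho0 Plip dP).
  apply: cvg_trans (cvg_radial0 ord0 rho0); apply: near_eq_cvg; near=> r.
  by rewrite ode.
Unshelve. all: by end_near. Qed.
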